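(* Let $\xi_1,\dots,\xi_n$ be independent real random variables with $\mathbf{E}\xi_i=0$, satisfying Bernstein's condition: there is a constant $\varepsilon>0$ such that $|\mathbf{E}\xi_i^k|\le \frac12 k!\,\varepsilon^{k-2}\mathbf{E}\xi_i^2$ for all $k\ge 3$ and $i=1,\dots,n$. Let $S_n=\sum_{i=1}^n\xi_i$ and $\sigma^2=\sum_{i=1}^n\mathbf{E}\xi_i^2>0$. Then for every $\delta\in(0,1]$ there is a constant $C_\delta$ depending only on $\delta$ such that for all $x\ge 0$, \[ \mathbf{P}(S_n>x\sigma)\le \big(1-\Phi(\widetilde{x})\big)\Big[1+C_\delta(1+\widetilde{x})\frac{\varepsilon}{\sigma}\Big],\qquad \widetilde{x}=\frac{2x}{1+\sqrt{1+2(1+\delta)x\varepsilon/\sigma}}. \] In particular, if $\varepsilon/\sigma\to 0$ and $0\le x=o(\sigma/\varepsilon)$, then $\mathbf{P}(S_n>x\sigma)\le (1-\Phi(\widetilde{x}))[1+o(1)]$.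
   Context: $\Phi(x)=\frac{1}{\sqrt{2\pi}}\int_{-\infty}^x e^{-t^2/2}\,dt$ is the standard normal distribution function. The asymptotic statement is understood along any sequence of such families of random variables (with $n,\varepsilon,\sigma,x$ allowed to vary) for which $\varepsilon/\sigma\to0$ and $x\varepsilon/\sigma\to 0$, for fixed $\delta$. *)

(* Defs.v *)
From HB Require Import structures.
From mathcomp Require Import all_boot all_order all_algebra.
From mathcomp Require Import all_classical all_reals all_analysis.
Set Implicit Arguments. Unset Strict Implicit. Unset Printing Implicit Defensive.
Import Order.TTheory GRing.Theory Num.Theory.
Local Open Scope classical_set_scope.
Local Open Scope ring_scope.

Definition Phi (R : realType) (x : R) : R :=
  (Num.sqrt (pi *+ 2))^-1 *
  fine (\int[@lebesgue_measure R]_(t in `]-oo, x]) (expR (- (t ^+ 2) / 2))%:E)%E.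

(* Mutual independence of finitely many real random variables:
   for every family of Borel sets (B_i), P(cap_i xi_i^-1 B_i) = prod_i P(xi_i^-1 B_i).
   (Taking B_i = setT for some i yields the product rule for every subfamily.) *)
Definition independent_RVs (R : realType) (d : measure_display)
  (T : measurableType d) (P : probability T R) (n : nat)
  (xi : 'I_n -> {RV P >-> R}) : Prop :=
  forall B : 'I_n -> set R, (forall i, measurable (B i)) ->
    P (\bigcap_(i in [set: 'I_n]) (xi i @^-1` B i)) =
    (\prod_(i < n) P (xi i @^-1` B i))%E.

(* Main.v *)
(* By Cramer's change of measure.  With w = sqrt (1 + 2 (1 + delta) x eps / sigma),
   tilt the law of S_n by exp (lam S_n), where lam = l / sigma and l = xt / w.
   Bernstein's condition bounds E exp (lam S_n) by exp (l^2 / (2 (1 - q))) with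
   q = l eps / sigma < 1, and this choice of l gives
     E exp (lam S_n) * exp (- l x) <= exp (- xt^2 / 2 - delta l^2 q / 2).
   If q >= 1/100 the Chernoff bound suffices, because the term in delta makes it
   smaller than exp (- xt^2 / 2) by a factor O(eps / sigma).  If q < 1/100 the
   tilted sum is within O(eps / sigma) of a Gaussian of nearly the same mean and
   variance in the uniform metric (Berry-Esseen, by Lindeberg replacement and
   Gaussian smoothing, as in Bergstrom's proof).  Integrating the exponential
   weight against that Gaussian gives the Mills ratio exp (t^2 / 2) (1 - Phi t)
   at some t close to xt, and one compares it with its value at xt. *)

Require Import Defs.
From HB Require Import structures.
From mathcomp Require Import all_boot all_order all_algebra.
From mathcomp Require Import all_classical all_reals all_analysis.
From mathcomp Require Import measurable_realfun ring lra zify.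
Set Implicit Arguments. Unset Strict Implicit. Unset Printing Implicit Defensive.
Import Order.TTheory GRing.Theory Num.Theory.
Import numFieldNormedType.Exports.
Local Open Scope classical_set_scope.
Local Open Scope ring_scope.

(** The factor [1 + xt] of the statement arises because the normal approximation leaves an additive
    error, which becomes relative on division by [mills xt], of order at least [1 / (1 + xt)]. So
    Berry-Esseen is needed at the exact rate [eps / sigma]. It is available since each tilted third
    absolute moment is at most [b] times the tilted variance, with [b = 104 * eps] whatever the
    individual variances are. Bernstein's condition controls signed moments only: passing to
    absolute moments costs a factor two, harmless in error terms, whereas the leading exponent of
    the moment generating function must use the signed ones. The threshold [1/100] keeps [q] in the
    range [q <= 1/64] of the tilted estimates and the loss [33 * q * xt] in the Gaussian argument
    below [xt / 2]. Beyond the threshold the gain in the exponent is [delta / 2 * q ^ 3 / r ^ 2]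
    with [r = eps / sigma], so the final constant grows like [1 / delta]. A tilted law is not built
    as a new measure but kept as a density against [P]; thus it and the Gaussian laws go through the
    same Lindeberg estimate. *)

Notation L1 mu f := (integrable mu [set: _] (EFin \o f)).
Notation leb := (@lebesgue_measure _).

(** * Lebesgue integrals of real functions *)

Section real_integrals.
Context d (T : measurableType d) (R : realType) (mu : {measure set T -> \bar R}).
Implicit Types (f g h : T -> R) (c : R).

Lemma L1_meas f : L1 mu f -> measurable_fun setT f.
Proof. by move=> /integrableP[/measurable_EFinP]. Qed.

Lemma L1_le f g : measurable_fun setT f -> (forall x, `|f x| <= g x) ->
  L1 mu g -> L1 mu f.
Proof.
move=> mf fg; apply: le_integrable => //; first exact/measurable_EFinP.
by move=> x _ /=; rewrite lee_fin (le_trans (fg x))// ler_norm.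
Qed.

Lemma L1D f g : L1 mu f -> L1 mu g -> L1 mu (fun x => f x + g x).
Proof. exact: integrableD. Qed.

Lemma L1B f g : L1 mu f -> L1 mu g -> L1 mu (fun x => f x - g x).
Proof. exact: integrableB. Qed.

Lemma L1Z c f : L1 mu f -> L1 mu (fun x => c * f x).
Proof. exact: integrableZl. Qed.

Lemma L1_bdd_mul f g c : measurable_fun setT f -> (forall x, `|f x| <= c) ->
  L1 mu g -> L1 mu (fun x => f x * g x).
Proof.
move=> mf fc ig; apply: (@L1_le _ (fun x => c * `|g x|)).
- by apply: measurable_funM => //; exact: L1_meas.
- by move=> x; rewrite normrM ler_wpM2r.
- exact/L1Z/integrable_norm.
Qed.

Lemma L1_fineK f : L1 mu f -> (\int[mu]_x (f x)%:E = (\int[mu]_x f x)%:E)%E.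
Proof. by move=> lf; rewrite /Rintegral fineK//; exact: integrable_fin_num. Qed.

Lemma ge0_L1 f c : measurable_fun setT f -> (forall x, 0 <= f x) ->
  (\int[mu]_x (f x)%:E <= c%:E)%E -> L1 mu f.
Proof.
move=> mf f0 fc; apply/integrableP; split; first exact/measurable_EFinP.
under eq_integral => x _ do rewrite /= ger0_norm//.
exact: le_lt_trans fc (ltry _).
Qed.

Lemma normr_Rintegral_le f g : measurable_fun setT f ->
  (forall x, `|f x| <= g x) -> L1 mu g -> `|\int[mu]_x f x| <= \int[mu]_x g x.
Proof.
move=> mf fg ig; have lf := L1_le mf fg ig.
apply: le_trans (le_normr_Rintegral _ lf) _ => //.
by apply: le_Rintegral => //; exact: integrable_norm.
Qed.

Lemma le_Rint f g : L1 mu f -> L1 mu g -> (forall x, f x <= g x) ->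
  \int[mu]_x f x <= \int[mu]_x g x.
Proof. by move=> lf lg fg; apply: le_Rintegral. Qed.

Lemma eq_Rint f g : f =1 g -> \int[mu]_x f x = \int[mu]_x g x.
Proof. by move=> fg; apply: eq_Rintegral => x _. Qed.

Lemma eq_L1 f g : f =1 g -> L1 mu f -> L1 mu g.
Proof. by move=> fg; apply: eq_integrable => // x _ /=; rewrite fg. Qed.

End real_integrals.

(** Integrability of the sections makes the inner real integrals agree with the extended ones. The
    outer integrals may be infinite: the extended integrals are equal, hence so are their images
    under [fine]. *)
Lemma Rint_Tonelli d1 d2 (T1 : measurableType d1) (T2 : measurableType d2)
    (R : realType) (m1 : {sigma_finite_measure set T1 -> \bar R})
    (m2 : {sigma_finite_measure set T2 -> \bar R}) (f : T1 -> T2 -> R) :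
  measurable_fun setT (fun z : T1 * T2 => f z.1 z.2) ->
  (forall x y, 0 <= f x y) ->
  (forall x, L1 m2 (f x)) -> (forall y, L1 m1 (f^~ y)) ->
  \int[m1]_x \int[m2]_y f x y = \int[m2]_y \int[m1]_x f x y.
Proof.
move=> mf f0 l2 l1.
have E2 x : ((\int[m2]_y f x y)%:E = \int[m2]_y (f x y)%:E)%E.
  by rewrite L1_fineK.
have E1 y : ((\int[m1]_x f x y)%:E = \int[m1]_x (f x y)%:E)%E.
  by rewrite (L1_fineK (l1 y)).
rewrite {1}/Rintegral [RHS]/Rintegral; congr fine.
rewrite (eq_integral _ _ (fun x _ => E2 x)) (eq_integral _ _ (fun y _ => E1 y)).
apply: (fubini_tonelli (fun z => (f z.1 z.2)%:E)) => [|z].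
  exact/measurable_EFinP.
by rewrite lee_fin.
Qed.

Lemma measurable_Rint d1 d2 (T1 : measurableType d1) (T2 : measurableType d2)
    (R : realType)
    (m2 : {sigma_finite_measure set T2 -> \bar R}) (f : T1 -> T2 -> R) :
  measurable_fun setT (fun z : T1 * T2 => f z.1 z.2) ->
  (forall x y, 0 <= f x y) ->
  measurable_fun setT (fun x => \int[m2]_y f x y).
Proof.
move=> mf f0; apply: measurableT_comp => //=.
apply: (measurable_fun_fubini_tonelli_F (fun z => (f z.1 z.2)%:E)) => [|z].
  exact/measurable_EFinP.
by rewrite lee_fin.
Qed.

(** * Affine substitution in Lebesgue integrals *)

Section affine_change_of_variables.
Context (R : realType).
Implicit Types (f : R -> R) (s a : R).

Let aff s a := fun x : R => (s * x + a : measurableTypeR R).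

Let maff s a : measurable_fun [set: measurableTypeR R] (aff s a).
Proof. by apply: measurable_funD => //; exact: measurable_funM. Qed.

Let push s a : {measure set (measurableTypeR R) -> \bar R} :=
  measure_function_pushforward__canonical__measure_function_Measure
    lebesgue_measure (maff s a).

(** By uniqueness of Lebesgue measure it suffices to compare on half-open intervals. A negative [s]
    moves the open end to the other side, which leaves the length unchanged. *)
Lemma lebesgue_measure_affine s a (A : set R) : s != 0 -> measurable A ->
  lebesgue_measure A = mscale (NngNum (normr_ge0 s)) (push s a) A.
Proof.
move=> s0 mA; apply: lebesgue_measure_unique => //= _ [[u v]] _ <-.
rewrite /mscale/push/= /pushforward.
move: s0; rewrite neq_lt => /orP[s0|s0].
- have -> : aff s a @^-1` `]u, v] = [set` `[(v - a) / s, (u - a) / s[].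
    apply/seteqP; split => x /=; rewrite !in_itv/= /aff.
      rewrite ltr_ndivlMr// ler_ndivrMr// [x * s]mulrC -ltrBDr -lerBDr ?opprK.
      by move=> /andP[? ?]; apply/andP; split; lra.
    by rewrite ltr_ndivlMr// ler_ndivrMr// [x * s]mulrC => /andP[? ?]; apply/andP; split; lra.
  rewrite !lebesgue_measure_itv/= !lte_fin ltr_nM2r ?invr_lt0// ltrD2r -!EFinD.
  case: ifP => // _; last by rewrite mule0.
  by rewrite ltr0_norm// -EFinM; congr (_%:E); field; rewrite lt_eqF.
- have -> : aff s a @^-1` `]u, v] = [set` `](u - a) / s, (v - a) / s]].
    apply/seteqP; split => x /=; rewrite !in_itv/= /aff.
      by rewrite ltr_pdivrMr// ler_pdivlMr// [x * s]mulrC => /andP[? ?]; apply/andP; split; lra.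
    by rewrite ltr_pdivrMr// ler_pdivlMr// [x * s]mulrC => /andP[? ?]; apply/andP; split; lra.
  rewrite !lebesgue_measure_itv/= !lte_fin ltr_pM2r ?invr_gt0// ltrD2r -!EFinD.
  case: ifP => // _; last by rewrite mule0.
  by rewrite gtr0_norm// -EFinM; congr (_%:E); field; rewrite gt_eqF.
Qed.

Lemma integral_affine f s a : s != 0 -> measurable_fun setT f ->
  (forall x, 0 <= f x) ->
  (\int[leb]_x (f x)%:E = `|s|%:E * \int[leb]_x (f (s * x + a))%:E)%E.
Proof.
move=> s0 mf f0.
have := ge0_integral_pushforward (maff s a) lebesgue_measure measurableT
  (f := EFin \o f).
rewrite preimage_setT /= => <-.
- rewrite -(ge0_integral_mscale (push s a) measurableT (NngNum (normr_ge0 s)))//.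
  + apply: eq_measure_integral => //= A mA _; exact: lebesgue_measure_affine.
  + exact/measurable_EFinP.
  + by move=> x _; rewrite lee_fin.
- exact/measurable_EFinP.
- by move=> y _; rewrite lee_fin.
Qed.

Lemma Rint_affine f s a : s != 0 -> measurable_fun setT f ->
  (forall x, 0 <= f x) ->
  \int[leb]_x f x = `|s| * \int[leb]_x f (s * x + a).
Proof.
move=> s0 mf f0; rewrite /Rintegral (integral_affine a s0)//.
set I := (\int[_]_x _)%E; have : (0 <= I)%E by apply: integral_ge0 => x _; rewrite lee_fin.
(* An infinite integral gives the default value 0 of [fine] on both sides. *)
case: I => [r _ //|_|//]; rewrite mulr_infty gtr0_sg ?normr_gt0//.
by rewrite mul1e mulr0.
Qed.

Lemma L1_affine f s a : s != 0 -> (forall x, 0 <= f x) ->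
  L1 leb f -> L1 leb (fun x => f (s * x + a)).
Proof.
move=> s0 f0 lf; have mf := L1_meas lf.
apply: (@ge0_L1 _ _ _ _ _ (`|s|^-1 * \int[leb]_x f x)) => //.
  exact: (measurableT_comp mf (maff s a)).
rewrite EFinM -(L1_fineK lf) (@integral_affine f s a s0)// muleA -EFinM mulVf ?normr_eq0//.
by rewrite mul1e.
Qed.

End affine_change_of_variables.

(** * Taylor polynomials of the exponential *)

Section exponential.
Context (R : realType).
Implicit Types (x y z t c : R) (n N : nat).

Definition expT N z : R := \sum_(k < N) z ^+ k / k`!%:R.

Lemma expT_cvg z : expT n z @[n --> \oo] --> expR z.
Proof.
suff -> : expT^~ z = series (exp_coeff z) by exact: is_cvg_series_exp_coeff.
by apply/funext => n; rewrite /series/= big_mkord.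
Qed.

Lemma expT_le_expR N t : 0 <= t -> expT N t <= expR t.
Proof.
move=> t0; rewrite -(cvg_lim _ (@expT_cvg t))//.
apply: nondecreasing_cvgn_le; last by apply/cvg_ex; exists (expR t); exact: expT_cvg.
apply/nondecreasing_seqP => n.
by rewrite /expT big_ord_recr/= lerDl divr_ge0// exprn_ge0.
Qed.

(** Since [(N + k)! >= N! * k!], the tail is dominated term by term by [|z| ^ N / N!] times the
    series of [expR |z|]. In [expT], [N] counts terms, so the remainder starts at degree [N]. *)
Lemma expR_taylor N z :
  `|expR z - expT N z| <= `|z| ^+ N / N`!%:R * expR `|z|.
Proof.
set B := (X in _ <= X).
have HM M : `|expT (N + M) z - expT N z| <= B.
  rewrite /expT big_split_ord/= addrAC subrr add0r.
  apply: le_trans (ler_norm_sum _ _ _) _.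
  apply: (@le_trans _ _ (\sum_(k < M) `|z| ^+ N / N`!%:R * (`|z| ^+ k / k`!%:R))).
    apply: ler_sum => i _.
    rewrite normrM normfV normrX normr_nat /= exprD mulf_div.
    rewrite ler_wpM2l ?mulr_ge0 ?exprn_ge0//.
    rewrite lef_pV2 ?posrE ?mulr_gt0 ?ltr0n ?fact_gt0// -natrM ler_nat.
    have /bin_fact <- := leq_addr i N.
    by rewrite addKn leq_pmull// bin_gt0 leq_addr.
  rewrite -mulr_sumr ler_wpM2l ?divr_ge0 ?exprn_ge0//.
  exact: expT_le_expR.
have cvgN : `|expT (N + n) z - expT N z| @[n --> \oo] --> `|expR z - expT N z|.
  apply: cvg_norm; apply: cvgB; last exact: cvg_cst.
  have := @expT_cvg z; rewrite -(cvg_shiftn N).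
  by under eq_fun => n do rewrite addnC.
rewrite -(cvg_lim _ cvgN)//; apply: limr_le.
  by apply/cvg_ex; eexists; exact: cvgN.
by near=> n; exact: HM.
Unshelve. all: by end_near. Qed.

Lemma expr_le_expR n x : 0 <= x -> x ^+ n <= n`!%:R * expR x.
Proof.
move=> x0; rewrite mulrC -ler_pdivrMr ?ltr0n ?fact_gt0//.
apply: le_trans (expT_le_expR n.+1 x0).
rewrite /expT big_ord_recr/= lerDr sumr_ge0// => i _.
by rewrite divr_ge0 ?exprn_ge0.
Qed.

Lemma expT1 z : expT 1 z = 1.
Proof. by rewrite /expT big_ord_recl big_ord0 addr0/= expr0 divr1. Qed.

Lemma expT2 z : expT 2 z = 1 + z.
Proof.
by rewrite /expT !big_ord_recl big_ord0 addr0/= expr0 expr1 !divr1.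
Qed.

Lemma expT3 z : expT 3 z = 1 + z + z ^+ 2 / 2.
Proof.
by rewrite /expT !big_ord_recl big_ord0 addr0/= expr0 expr1 !divr1 addrA.
Qed.

End exponential.

(** * Gaussian smoothing *)

Section gaussian_density.
Context (R : realType).
Implicit Types (s r u w x y z h t m : R) (k : nat).

Definition gd s u : R := normal_pdf 0 s u.

Lemma normal_peakE s : 0 < s -> normal_peak s = normal_peak 1 / s.
Proof.
move=> s0; rewrite /normal_peak -mulrnAr sqrtrM ?sqr_ge0// sqrtr_sqr gtr0_norm//.
by rewrite expr1n mul1r invfM mulrC.
Qed.

Lemma normal_pdf_expR m s w : 0 < s ->
  normal_pdf m s w = normal_peak 1 / s * expR (- ((w - m) / s) ^+ 2 / 2).
Proof.
move=> s0; rewrite normal_pdfE ?gt_eqF// normal_peakE// /normal_fun.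
by congr (_ * expR _); field; rewrite gt_eqF.
Qed.

Lemma gdE s u : 0 < s -> gd s u = normal_peak 1 / s * expR (- (u / s) ^+ 2 / 2).
Proof. by move=> s0; rewrite /gd normal_pdf_expR// subr0. Qed.

Lemma gdN s u : 0 < s -> gd s (- u) = gd s u.
Proof. by move=> s0; rewrite !gdE// (mulNr u) sqrrN. Qed.

Lemma gd_sub s x w : 0 < s -> gd s (x - w) = normal_pdf x s w.
Proof. by move=> s0; rewrite gdE// normal_pdf_expR// -(opprB w x) (mulNr (w - x)) sqrrN. Qed.

Lemma gd_ge0 s u : 0 <= gd s u. Proof. exact: normal_pdf_ge0. Qed.

Lemma measurable_gd s : measurable_fun setT (gd s).
Proof. exact: measurable_normal_pdf. Qed.

Lemma L1_gd s x : 0 < s -> L1 leb (fun w => gd s (x - w)).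
Proof.
move=> s0; apply: eq_L1 (integrable_normal_pdf x s) => w.
by rewrite gd_sub.
Qed.

Lemma Rint_gd s x : 0 < s -> \int[leb]_w gd s (x - w) = 1.
Proof.
move=> s0; rewrite /Rintegral; under eq_integral => w _ do rewrite gd_sub//.
by rewrite integral_normal_pdf.
Qed.

(* Completing the square in [w]. *)
Lemma gd_mul s r x z w : 0 < s -> 0 < r ->
  let t := Num.sqrt (s ^+ 2 + r ^+ 2) in
  gd s (w - z) * gd r (x - w) = gd t (x - z) *
    normal_pdf ((z * r ^+ 2 + x * s ^+ 2) / t ^+ 2) (s * r / t) w.
Proof.
move=> s0 r0 t.
have t2 : t ^+ 2 = s ^+ 2 + r ^+ 2.
  by rewrite /t sqr_sqrtr// addr_ge0 ?sqr_ge0.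
have t0 : 0 < t by rewrite sqrtr_gt0 addr_gt0// exprn_gt0.
have [sn0 rn0 tn0] : [/\ s != 0, r != 0 & t != 0] by rewrite !gt_eqF.
rewrite !gdE// normal_pdf_expR ?divr_gt0 ?mulr_gt0//.
rewrite mulrACA -expRD [RHS]mulrACA -expRD; congr (_ * expR _).
  by field; rewrite sn0 rn0 tn0.
have <- : (z * r ^+ 2 + x * (t ^+ 2 - r ^+ 2)) / t ^+ 2 =
          (z * r ^+ 2 + x * s ^+ 2) / t ^+ 2 by rewrite t2 addrK.
have s2 : s ^+ 2 = t ^+ 2 - r ^+ 2 by rewrite t2 addrK.
have s2n0 : t ^+ 2 - r ^+ 2 != 0 by rewrite -s2 expf_neq0.
rewrite !(exprMn, exprVn) s2.
by field; rewrite s2n0 rn0 tn0.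
Qed.

Lemma gd_conv s r x z : 0 < s -> 0 < r ->
  \int[leb]_w (gd s (w - z) * gd r (x - w)) =
  gd (Num.sqrt (s ^+ 2 + r ^+ 2)) (x - z).
Proof.
move=> s0 r0; under eq_Rintegral => w _ do rewrite gd_mul//.
rewrite RintegralZl//; last exact: integrable_normal_pdf.
by rewrite /Rintegral integral_normal_pdf mulr1.
Qed.

(** With [z = u / s], the power is at most [k! * expR |z|], and [|z| - z ^ 2 / 2 <= 1 - z ^ 2 / 8]
    lets a density of twice the scale absorb it. The factor 2 is the ratio of the peaks. *)
Lemma expr_gd_le k s u : 0 < s ->
  `|u| ^+ k * gd s u <= (2 * k`!%:R * expR 1) * s ^+ k * gd (2 * s) u.
Proof.
move=> s0; rewrite !gdE ?mulr_gt0//.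
set z := u / s; have -> : u / (2 * s) = z / 2 by rewrite /z; field; rewrite gt_eqF.
have -> : `|u| = s * `|z|.
  by rewrite /z normrM normfV (gtr0_norm s0) mulrCA divff ?mulr1// gt_eqF.
have -> : (2 * k`!%:R * expR 1) * s ^+ k *
    (normal_peak 1 / (2 * s) * expR (- (z / 2) ^+ 2 / 2)) =
    s ^+ k * (normal_peak 1 / s) * (k`!%:R * expR (1 - (z / 2) ^+ 2 / 2)).
  by rewrite expRD mulNr; field; rewrite gt_eqF.
rewrite exprMn mulrACA ler_wpM2l//.
  by rewrite mulr_ge0 ?exprn_ge0 ?(ltW s0)// divr_ge0 ?normal_peak_ge0// ltW.
apply: (@le_trans _ _ (k`!%:R * expR `|z| * expR (- z ^+ 2 / 2))).
  by rewrite ler_wpM2r ?expR_ge0// expr_le_expR.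
rewrite -mulrA ler_wpM2l// -expRD ler_expR.
have -> : z ^+ 2 = `|z| ^+ 2 by rewrite -normrX ger0_norm ?sqr_ge0.
have -> : (z / 2) ^+ 2 = `|z| ^+ 2 / 4.
  by rewrite -normrX ger0_norm ?sqr_ge0//; field.
set t := `|z|; suff : 0 <= (t - 4 / 3) ^+ 2 by rewrite sqrrB; nra.
exact: sqr_ge0.
Qed.

Lemma L1_norm_gdX k s x : 0 < s -> L1 leb (fun w => `|x - w| ^+ k * gd s (x - w)).
Proof.
move=> s0.
apply: (L1_le _ _ (L1Z ((2 * k`!%:R * expR 1) * s ^+ k)
   (@L1_gd (2 * s) x _))) => [|w|]; last by rewrite mulr_gt0.
- apply: measurable_funM.
    apply: measurable_funX; apply: measurableT_comp => //.
    exact: measurable_funB.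
  apply: (measurableT_comp (measurable_gd s)); exact: measurable_funB.
- by rewrite ger0_norm ?expr_gd_le// mulr_ge0 ?exprn_ge0// gd_ge0.
Qed.

Lemma L1_gdX k s x : 0 < s -> L1 leb (fun w => (x - w) ^+ k * gd s (x - w)).
Proof.
move=> s0; apply: (L1_le _ _ (L1_norm_gdX k x s0)) => [|w].
- apply: measurable_funM.
    by apply: measurable_funX; exact: measurable_funB.
  apply: (measurableT_comp (measurable_gd s)); exact: measurable_funB.
- by rewrite normrM normrX (ger0_norm (gd_ge0 _ _)).
Qed.

Lemma Rint_norm_gdX_le k s x : 0 < s ->
  \int[leb]_w (`|x - w| ^+ k * gd s (x - w)) <= (2 * k`!%:R * expR 1) * s ^+ k.
Proof.
move=> s0; have s20 : 0 < 2 * s by rewrite mulr_gt0.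
apply: (@le_trans _ _ (\int[leb]_w
    ((2 * k`!%:R * expR 1) * s ^+ k * gd (2 * s) (x - w)))).
  apply: le_Rint; [exact: L1_norm_gdX|exact/L1Z/L1_gd|move=> w].
  exact: expr_gd_le.
by rewrite RintegralZl//; [rewrite Rint_gd// mulr1|exact: L1_gd].
Qed.

(* Comparing with the density of mean [h] gives [h * mean <= h ^+ 2 / 2] for all [h]. *)
Lemma Rint_gd_mean s x : 0 < s -> \int[leb]_w ((x - w) * gd s (x - w)) = 0.
Proof.
move=> s0; set m := LHS.
have L0 := L1_gd x s0.
have LX : L1 leb (fun w => (x - w) * gd s (x - w)).
  by have := L1_gdX 1 x s0; under eq_fun do rewrite expr1.
have H h : h * m <= h ^+ 2 / 2.
  suff : 1 + h / s ^+ 2 * m - h ^+ 2 / 2 / s ^+ 2 <= 1.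
    move=> E; rewrite -subr_ge0.
    have -> : h ^+ 2 / 2 - h * m = s ^+ 2 * (h ^+ 2 / 2 / s ^+ 2 - h / s ^+ 2 * m).
      by field; rewrite gt_eqF.
    by rewrite mulr_ge0 ?sqr_ge0//; lra.
  rewrite -[leRHS](Rint_gd (x - h) s0) -[X in X + _ - _](Rint_gd x s0) /m.
  rewrite -RintegralZl//.
  have -> : h ^+ 2 / 2 / s ^+ 2 = \int[leb]_w (h ^+ 2 / 2 / s ^+ 2 * gd s (x - w)).
    by rewrite RintegralZl// Rint_gd// mulr1.
  rewrite -RintegralD//; last exact: L1Z.
  rewrite -RintegralB//; [|by apply: L1D => //; exact: L1Z|exact: L1Z].
  apply: le_Rint => [||w].
  - by apply: L1B; [apply: L1D => //; exact: L1Z|exact: L1Z].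
  - exact: L1_gd.
  have -> : x - h - w = (x - w) - h by ring.
  set u := x - w; rewrite !gdE//.
  set c := normal_peak 1 / s.
  have c0 : 0 <= c by rewrite divr_ge0 ?normal_peak_ge0// ltW.
  have -> : - ((u - h) / s) ^+ 2 / 2 =
    (- (u / s) ^+ 2 / 2) + (h / s ^+ 2 * u - h ^+ 2 / 2 / s ^+ 2).
    by field; rewrite gt_eqF.
  rewrite expRD; set e := expR (- _ / _).
  have := expR_ge1Dx (h / s ^+ 2 * u - h ^+ 2 / 2 / s ^+ 2).
  set E := expR _ => HE.
  rewrite [leLHS](_ : _ = c * e * (1 + (h / s ^+ 2 * u - h ^+ 2 / 2 / s ^+ 2))); last by ring.
  by rewrite mulrA ler_wpM2l// mulr_ge0// expR_ge0.
apply/eqP; rewrite -sqrf_eq0 eq_le sqr_ge0 andbT.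
by have := H m; rewrite -expr2; lra.
Qed.

(* Comparing the densities of scales [s] and [a * s] for [a] on either side
   of [1] pins down the variance. *)
Lemma Rint_gd_var s x : 0 < s ->
  \int[leb]_w ((x - w) ^+ 2 * gd s (x - w)) = s ^+ 2.
Proof.
move=> s0; set v := LHS.
have L0 := L1_gd x s0.
have LX := L1_gdX 2 x s0.
pose mu := v / (2 * s ^+ 2).
(* Integrating [expR y >= 1 + y] for the quotient of the two densities. The inequality is an
   equality at [a = 1], so the two sides have the same derivative there, which forces
   [mu = 1 / 2]. *)
have H (a : R) : 0 < a -> 1 - (a ^- 2 - 1) * mu <= a.
  move=> a0; have as0 : 0 < a * s by rewrite mulr_gt0.
  have -> : (a ^- 2 - 1) * mu = (a ^- 2 - 1) / (2 * s ^+ 2) * v.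
    by rewrite /mu; field; rewrite !gt_eqF.
  rewrite -[X in X - _](Rint_gd x s0) /v -RintegralZl//.
  have Ea : \int[leb]_w (a * gd (a * s) (x - w)) = a.
    by rewrite RintegralZl ?Rint_gd ?mulr1//; exact: L1_gd.
  rewrite -[leRHS]Ea.
  rewrite -RintegralB//; last exact: L1Z.
  apply: le_Rint => [||w].
  - by apply: L1B => //; exact: L1Z.
  - exact/L1Z/L1_gd.
  set u := x - w; rewrite !gdE//.
  set c := normal_peak 1 / s.
  have c0 : 0 <= c by rewrite divr_ge0 ?normal_peak_ge0// ltW.
  have -> : - (u / (a * s)) ^+ 2 / 2 =
    (- (u / s) ^+ 2 / 2) + (- (a ^- 2 - 1) / (2 * s ^+ 2) * u ^+ 2).
    by field; rewrite !gt_eqF.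
  rewrite expRD; set e := expR (- _ ^+ _ / _).
  have := expR_ge1Dx (- (a ^- 2 - 1) / (2 * s ^+ 2) * u ^+ 2).
  set E := expR _ => HE.
  rewrite [leLHS](_ : _ = c * e * (1 + (- (a ^- 2 - 1) / (2 * s ^+ 2) * u ^+ 2)));
    last by field; rewrite !gt_eqF.
  rewrite [leRHS](_ : _ = c * e * E); last by rewrite /c; field; rewrite !gt_eqF.
  by rewrite ler_wpM2l// mulr_ge0// expR_ge0.
suff mu12 : mu = 1 / 2.
  have -> : v = mu * (2 * s ^+ 2) by rewrite /mu; field; rewrite gt_eqF.
  by rewrite mu12; field.
have H' (a : R) : 0 < a -> (1 - a) * a ^+ 2 <= (1 - a) * (1 + a) * mu.
  move=> a0; have := H a a0; rewrite lerBlDr -lerBlDl -(ler_pM2r (exprn_gt0 2 a0)).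
  by congr (_ <= _); field; rewrite gt_eqF.
apply/eqP; rewrite eq_le; apply/andP; split; apply/ler_addgt0Pr => e e0.
- set m := Num.min e 1.
  have m0 : 0 < m by rewrite lt_min e0 ltr01.
  have me : m <= e by rewrite ge_min lexx.
  have a0 : 0 < 1 + m / 2 by lra.
  have : 0 <= m / 2 * ((1 + m / 2) ^+ 2 - (2 + m / 2) * mu).
    by have := H' _ a0; lra.
  rewrite pmulr_rge0; last by rewrite divr_gt0.
  by rewrite leNgt => Hm; rewrite leNgt; apply/negP => ?; move/negP: Hm; apply; nra.
- set m := Num.min e 1.
  have m0 : 0 < m by rewrite lt_min e0 ltr01.
  have me : m <= e by rewrite ge_min lexx.
  have m1 : m <= 1 by rewrite ge_min lexx orbT.
  have a0 : 0 < 1 - m / 2 by lra.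
  have : 0 <= m / 2 * ((2 - m / 2) * mu - (1 - m / 2) ^+ 2).
    by have := H' _ a0; lra.
  rewrite pmulr_rge0; last by rewrite divr_gt0.
  by rewrite leNgt => Hm; rewrite leNgt; apply/negP => ?; move/negP: Hm; apply; nra.
Qed.

End gaussian_density.

Section gaussian_smoothing.
Context (R : realType).
Implicit Types (s r u w x y z h t m c : R) (F G D : R -> R).

Definition taylorC : R := 4 * expR 5.

Lemma taylorC_ge1 : 1 <= taylorC.
Proof. by have := expR_ge1Dx (5 : R); rewrite /taylorC; lra. Qed.

(** The error bound must have an integral over [z] of order [|h| ^ 3], uniformly in [h]; hence the
    two Gaussians on the right. The shifted one dominates the left-hand exponential when [|h| > 1];
    the one of scale 2 absorbs all polynomial and exponential growth in [|z|]. *)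
Lemma gauss_taylor z h :
  `|expR (- (z - h) ^+ 2 / 2) -
    expR (- z ^+ 2 / 2) * (1 + h * z + h ^+ 2 * (z ^+ 2 - 1) / 2)| <=
  taylorC * `|h| ^+ 3 * (expR (- (z / 2) ^+ 2 / 2) / 2 + expR (- (z - h) ^+ 2 / 2)).
Proof.
set t := `|z|; have t0 : 0 <= t by rewrite normr_ge0.
have tz : z ^+ 2 = t ^+ 2 by rewrite -normrX ger0_norm ?sqr_ge0.
set e := expR (- z ^+ 2 / 2); have e0 : 0 <= e by rewrite expR_ge0.
set f := expR (- (z - h) ^+ 2 / 2); have f0 : 0 <= f by rewrite expR_ge0.
set g := expR (- (z / 2) ^+ 2 / 2).
(* Because [2 * t + 2 - t ^ 2 / 2 <= 5 - t ^ 2 / 8]; this is the origin of the exponent 5 in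
   [taylorC]. *)
have eg : e * (2 * expR (2 * t + 2)) <= taylorC * (g / 2).
  have -> : taylorC * (g / 2) = 2 * expR (5 - (z / 2) ^+ 2 / 2).
    rewrite /g /taylorC expRB mulNr expRN; set E := expR _.
    by field; rewrite gt_eqF ?expR_gt0.
  rewrite mulrCA ler_wpM2l// -expRD ler_expR.
  have -> : (z / 2) ^+ 2 = t ^+ 2 / 4 by rewrite expr_div_n tz; field.
  rewrite tz; have := sqr_ge0 (t - 8 / 3); nra.
have h30 : 0 <= `|h| ^+ 3 by rewrite exprn_ge0.
have [h1|h1] := lerP `|h| 1; last first.
  apply: (le_trans (ler_normB _ _)); rewrite (ger0_norm f0).
  have h31 : 1 <= `|h| ^+ 3 by rewrite exprn_ege1// ltW.
  have -> : taylorC * `|h| ^+ 3 * (g / 2 + f) =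
     `|h| ^+ 3 * (taylorC * (g / 2)) + `|h| ^+ 3 * taylorC * f by ring.
  rewrite addrC lerD//; last first.
    rewrite ler_peMl// mulr_ege1//; exact: taylorC_ge1.
  rewrite normrM (ger0_norm e0).
  apply: le_trans _ (ler_wpM2l h30 eg).
  rewrite mulrCA ler_wpM2l//.
  have E1 : 1 + t + t ^+ 2 / 2 <= expR t.
    by rewrite -expT3; exact: expT_le_expR.
  have E2 : expR t <= expR (2 * t + 2) by rewrite ler_expR; lra.
  apply: (@le_trans _ _ (`|h| ^+ 3 * (1 + t + (t ^+ 2 + 1) / 2))); last first.
    by rewrite ler_wpM2l//; have := sqr_ge0 t; lra.
  have hle : `|h| <= `|h| ^+ 3.
    by rewrite -[leLHS]expr1 ler_weXn2l// ltW.
  have hle2 : `|h| ^+ 2 <= `|h| ^+ 3 by rewrite ler_weXn2l// ltW.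
  apply: (@le_trans _ _ (1 + `|h| * t + `|h| ^+ 2 * ((t ^+ 2 + 1) / 2))).
    apply: (le_trans (ler_normD _ _)); rewrite lerD//.
      by apply: (le_trans (ler_normD _ _)); rewrite normr1 normrM.
    rewrite -mulrA normrM normrX ler_wpM2l ?exprn_ge0//.
    rewrite normrM [X in _ * X]ger0_norm ?invr_ge0// ler_wpM2r ?invr_ge0//.
    by apply: (le_trans (ler_normB _ _)); rewrite normr1 normrX.
  rewrite !mulrDr mulr1 -!addrA lerD//.
  have q0 : 0 <= (t ^+ 2 + 1) / 2 by rewrite divr_ge0// addr_ge0// sqr_ge0.
  by have := ler_wpM2r t0 hle; have := ler_wpM2r q0 hle2; lra.
pose p := h * z - h ^+ 2 / 2.
have fE : f = e * expR p.
  by rewrite /f /e /p -expRD; congr expR; field.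
(* [expT 3 p] contains the whole of [p ^ 2 / 2]; the added polynomial removes its terms of degree
   above 2 in [h]. *)
have -> : f - e * (1 + h * z + h ^+ 2 * (z ^+ 2 - 1) / 2) =
    e * ((expR p - expT 3 p) + (h ^+ 4 / 8 - h ^+ 3 * z / 2)).
  by rewrite fE expT3 /p; field.
rewrite normrM (ger0_norm e0).
apply: (@le_trans _ _ (e * (`|h| ^+ 3 * (2 * expR (2 * t + 2))))); last first.
  rewrite mulrCA [leRHS]mulrAC -mulrA [leRHS]mulrA [leRHS]mulrC ler_wpM2l//.
  apply: (le_trans eg); rewrite ler_wpM2l//; last by rewrite lerDl.
  by apply: le_trans taylorC_ge1; lra.
rewrite ler_wpM2l//; apply: (le_trans (ler_normD _ _)).
have hh : `|h| ^+ 2 <= `|h| by rewrite expr2 ler_piMr.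
have ph : `|p| <= `|h| * (t + 1).
  apply: (le_trans (ler_normB _ _)); rewrite mulrDr mulr1 normrM lerD2l.
  rewrite normrM normrX (_ : `|2^-1| = 2^-1); last by rewrite ger0_norm.
  by have := normr_ge0 h; lra.
have pt : `|p| <= t + 1.
  by apply: (le_trans ph); rewrite ler_piMl// addr_ge0.
rewrite mulrDl mul1r mulrDr; apply: lerD.
  apply: (le_trans (expR_taylor 3 p)).
  have E : (t + 1) ^+ 3 <= 3`!%:R * expR (t + 1).
    by apply: expr_le_expR; rewrite addr_ge0.
  have -> : 2 * t + 2 = (t + 1) + (t + 1) by ring.
  rewrite expRD mulrA ler_pM ?expR_ge0 ?divr_ge0 ?exprn_ge0 ?ler_expR//.
  rewrite ler_pdivrMr// -mulrA [_ * 3`!%:R]mulrC.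
  apply: (@le_trans _ _ ((`|h| * (t + 1)) ^+ 3)).
    by rewrite lerXn2r// nnegrE mulr_ge0// addr_ge0.
  by rewrite exprMn ler_wpM2l.
apply: (@le_trans _ _ (`|h| ^+ 3 * (t + 1))).
  apply: (le_trans (ler_normB _ _)).
  rewrite (normrM (h ^+ 4)) (normrM (h ^+ 3 * z)) (normrM (h ^+ 3)) !normrX.
  rewrite (_ : `|8^-1| = 8^-1); last by rewrite ger0_norm.
  rewrite (_ : `|2^-1| = 2^-1); last by rewrite ger0_norm.
  rewrite -/t; have : `|h| ^+ 4 <= `|h| ^+ 3 by rewrite exprSr ler_piMr.
  have := mulr_ge0 h30 t0; lra.
rewrite ler_wpM2l//; apply: (@le_trans _ _ (expR t)).
  by rewrite addrC expR_ge1Dx.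
by rewrite ler_expR; lra.
Qed.

(** If [F] is the distribution function of [Z], this is that of [Z] plus an independent centred
    Gaussian of standard deviation [s]. *)
Definition conv F s x : R := \int[leb]_w (F w * gd s (x - w)).

Lemma measurable_gd_sub s x : measurable_fun setT (fun w => gd s (x - w)).
Proof. apply: (measurableT_comp (measurable_gd s)); exact: measurable_funB. Qed.

Lemma L1_conv F c s x : measurable_fun setT F -> (forall w, `|F w| <= c) ->
  0 < s -> L1 leb (fun w => F w * gd s (x - w)).
Proof. by move=> mF Fc s0; exact: (L1_bdd_mul (mu := lebesgue_measure) mF Fc (L1_gd x s0)). Qed.

Lemma conv_norm_le F c s x : measurable_fun setT F -> (forall w, `|F w| <= c) ->
  0 < s -> `|conv F s x| <= c.
Proof.
move=> mF Fc s0.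
apply: (@le_trans _ _ (\int[leb]_w (c * gd s (x - w)))).
  apply: normr_Rintegral_le.
  - by apply: measurable_funM => //; exact: measurable_gd_sub.
  - by move=> w; rewrite normrM (ger0_norm (gd_ge0 _ _)) ler_wpM2r ?gd_ge0.
  - exact/L1Z/L1_gd.
by rewrite RintegralZl//; [rewrite Rint_gd ?mulr1|exact: L1_gd].
Qed.

(** Smoothing at scale [s] gives any bounded function a third derivative of order [c / s ^ 3].
    Phrasing this as an expansion with existential coefficients avoids differentiating under the
    integral: it is [gauss_taylor] integrated against [D], and the 2 counts the two Gaussians of
    mass 1. *)
Lemma conv_taylor D c s x : measurable_fun setT D -> (forall w, `|D w| <= c) ->
  0 < s -> exists a b, forall y,
  `|conv D s (x - y) - (conv D s x + a * y + b * y ^+ 2)| <=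
  2 * taylorC * c / s ^+ 3 * `|y| ^+ 3.
Proof.
move=> mD Dc s0; have sn0 : s != 0 by rewrite gt_eqF.
have s20 : 0 < 2 * s by rewrite mulr_gt0.
have c0 : 0 <= c by apply: le_trans (Dc 0).
have ia k : L1 leb (fun w => D w * ((x - w) ^+ k * gd s (x - w))).
  exact: (L1_bdd_mul (mu := lebesgue_measure) mD Dc (L1_gdX k x s0)).
(* The coefficients integrate [D] against the first derivative, and half the second derivative, of
   the shifted density at [y = 0]. *)
pose a := \int[leb]_w (s ^- 2 * (D w * ((x - w) ^+ 1 * gd s (x - w)))).
pose b := \int[leb]_w (s ^- 4 / 2 * (D w * ((x - w) ^+ 2 * gd s (x - w))) -
  s ^- 2 / 2 * (D w * ((x - w) ^+ 0 * gd s (x - w)))).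
have la : L1 leb (fun w => s ^- 2 * (D w * ((x - w) ^+ 1 * gd s (x - w)))).
  exact: L1Z.
have lb : L1 leb (fun w => s ^- 4 / 2 * (D w * ((x - w) ^+ 2 * gd s (x - w))) -
  s ^- 2 / 2 * (D w * ((x - w) ^+ 0 * gd s (x - w)))).
  by apply: L1B; exact: L1Z.
exists a, b => y.
have l0 := L1_conv x mD Dc s0; have ly := L1_conv (x - y) mD Dc s0.
have lT := L1D (L1D l0 (L1Z y la)) (L1Z (y ^+ 2) lb).
have -> : conv D s x + a * y + b * y ^+ 2 = \int[leb]_w (D w * gd s (x - w) +
    y * (s ^- 2 * (D w * ((x - w) ^+ 1 * gd s (x - w)))) +
    y ^+ 2 * (s ^- 4 / 2 * (D w * ((x - w) ^+ 2 * gd s (x - w))) -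
      s ^- 2 / 2 * (D w * ((x - w) ^+ 0 * gd s (x - w))))).
  rewrite (RintegralD measurableT (L1D l0 (L1Z y la)) (L1Z (y ^+ 2) lb)).
  rewrite (RintegralD measurableT l0 (L1Z y la)).
  by rewrite (RintegralZl _ measurableT la) (RintegralZl _ measurableT lb)
    [a * _]mulrC [b * _]mulrC.
rewrite /conv -(RintegralB measurableT ly lT).
set K := taylorC * c / s ^+ 3 * `|y| ^+ 3.
have -> : 2 * taylorC * c / s ^+ 3 * `|y| ^+ 3 =
   \int[leb]_w (K * (gd (2 * s) (x - w) + gd s (x - y - w))).
  rewrite RintegralZl//; last by apply: L1D; exact: L1_gd.
  rewrite RintegralD//; [|exact: L1_gd..].
  by rewrite !Rint_gd// /K; ring.
apply: normr_Rintegral_le.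
- exact: L1_meas (L1B ly lT).
- move=> w; rewrite expr1 expr0 mul1r.
  have -> : x - y - w = (x - w) - y by ring.
  set u := x - w; rewrite !gdE//.
  set q := normal_peak 1; have q0 : 0 <= q / s.
    by rewrite divr_ge0 ?normal_peak_ge0// ltW.
  set z := u / s; set h := y / s.
  have -> : (u - y) / s = z - h by rewrite mulrBl.
  have -> : u / (2 * s) = z / 2 by rewrite /z; field.
  set E0 := expR (- z ^+ 2 / 2); set E1 := expR (- (z - h) ^+ 2 / 2).
  have -> : D w * (q / s * E1) - (D w * (q / s * E0) +
     y * (s ^- 2 * (D w * (u * (q / s * E0)))) +
     y ^+ 2 * (s ^- 4 / 2 * (D w * (u ^+ 2 * (q / s * E0))) -
       s ^- 2 / 2 * (D w * (q / s * E0)))) =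
     D w * (q / s * (E1 - E0 * (1 + h * z + h ^+ 2 * (z ^+ 2 - 1) / 2))).
    by rewrite /h /z; field.
  have -> : K * (q / (2 * s) * expR (- (z / 2) ^+ 2 / 2) + q / s * E1) =
    c * (q / s * (taylorC * `|h| ^+ 3 * (expR (- (z / 2) ^+ 2 / 2) / 2 + E1))).
    by rewrite /K /h normrM normfV (gtr0_norm s0); field.
  rewrite (normrM (D w)) (normrM (q / s)) (ger0_norm q0).
  apply: ler_pM => //; first exact: (mulr_ge0 q0 (normr_ge0 _)).
  by rewrite ler_wpM2l// gauss_taylor.
- by apply: L1Z; apply: L1D; exact: L1_gd.
Qed.

Lemma convB F G c s x : measurable_fun setT F -> (forall w, `|F w| <= c) ->
  measurable_fun setT G -> (forall w, `|G w| <= c) -> 0 < s ->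
  conv (fun w => F w - G w) s x = conv F s x - conv G s x.
Proof.
move=> mF Fc mG Gc s0; rewrite /conv -RintegralB//; last 2 first.
- exact: L1_conv Fc s0.
- exact: L1_conv Gc s0.
by apply: eq_Rint => w; rewrite mulrBl.
Qed.

Lemma convN F c s x : measurable_fun setT F -> (forall w, `|F w| <= c) -> 0 < s ->
  conv (fun w => - F w) s x = - conv F s x.
Proof.
move=> mF Fc s0; transitivity (-1 * conv F s x); last by rewrite mulN1r.
rewrite -(RintegralZl (-1) measurableT (L1_conv x mF Fc s0)).
by apply: eq_Rint => w; rewrite mulN1r mulNr.
Qed.

Lemma measurable_conv F s : measurable_fun setT F -> (forall w, 0 <= F w) ->
  measurable_fun setT (conv F s).
Proof.
move=> mF F0; apply: (@measurable_Rint _ _ _ _ _ lebesgue_measure (fun x w => F w * gd s (x - w))).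
  apply: measurable_funM; first exact: measurableT_comp.
  apply: (measurableT_comp (measurable_gd s)); exact: measurable_funB.
by move=> x w; rewrite mulr_ge0// gd_ge0.
Qed.

Lemma conv_conv F c s r x : measurable_fun setT F -> (forall w, 0 <= F w <= c) ->
  0 < s -> 0 < r -> conv (conv F s) r x = conv F (Num.sqrt (s ^+ 2 + r ^+ 2)) x.
Proof.
move=> mF Fc s0 r0; rewrite /conv.
have F0 w : 0 <= F w by case/andP: (Fc w).
have Fc' w : `|F w| <= c by rewrite ger0_norm//; case/andP: (Fc w).
have mgg (z : R) : measurable_fun setT (fun w => gd s (w - z)).
  apply: (measurableT_comp (measurable_gd s)); exact: measurable_funB.
have gdsub (z w : R) : gd s (w - z) = gd s (z - w) by rewrite -gdN// opprB.
transitivity (\int[leb]_w \int[leb]_z (gd r (x - w) * (F z * gd s (w - z)))).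
  by apply: eq_Rint => w; rewrite RintegralZl// 1?mulrC//; exact: L1_conv Fc' s0.
rewrite Rint_Tonelli.
- apply: eq_Rint => z; have <- := gd_conv x z s0 r0.
  have lgg : L1 leb (fun w => gd s (w - z) * gd r (x - w)).
    apply: (L1_bdd_mul (mu := lebesgue_measure) (mgg z) _ (L1_gd x r0) (c := normal_peak s)).
    by move=> w; rewrite ger0_norm ?gd_ge0// normal_pdf_ub// gt_eqF.
  rewrite -(RintegralZl (F z) measurableT lgg).
  by apply: eq_Rint => w; rewrite mulrC -mulrA.
- apply: measurable_funM.
    apply: (measurableT_comp (measurable_gd_sub r x)); exact: measurable_fst.
  apply: measurable_funM; first exact: measurableT_comp.
  apply: (measurableT_comp (measurable_gd s)); exact: measurable_funB.
- by move=> w z; rewrite !mulr_ge0// gd_ge0.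
- by move=> w; apply: L1Z; exact: L1_conv Fc' s0.
- move=> z /=.
  apply: (eq_L1 (mu := lebesgue_measure) (f := fun w => (F z * gd s (w - z)) * gd r (x - w))).
    by move=> w; rewrite mulrC.
  apply: (L1_bdd_mul (mu := lebesgue_measure) _ _ (L1_gd x r0) (c := c * normal_peak s)).
    by apply: measurable_funM => //; exact: mgg.
  move=> w; rewrite normrM ler_pM//.
  by rewrite ger0_norm ?gd_ge0// normal_pdf_ub// gt_eqF.
Qed.

End gaussian_smoothing.

(** * The normal distribution function as a smoothing *)

Section gaussian_cdf.
Context (R : realType).
Implicit Types (s r u w x y z h t m c : R) (F G D : R -> R).

(** The value at 0 is 1, so [heaviside (w - y)] is the indicator of [y <= w] and [heaviside] is the
    distribution function of the point mass at 0. *)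
Definition heaviside w : R := ((0 <= w)%R)%:R.

Lemma measurable_heaviside : measurable_fun setT heaviside.
Proof.
apply: nondecreasing_measurable => // a b ab; rewrite /heaviside ler_nat.
by case: (lerP 0 a) => //= a0; rewrite (le_trans a0 ab).
Qed.

Lemma heaviside01 w : 0 <= heaviside w <= 1.
Proof. by rewrite /heaviside; case: (0 <= w); rewrite ?lexx ?ler01. Qed.

Lemma norm_heaviside w : `|heaviside w| <= 1.
Proof. by case/andP: (heaviside01 w) => ? ?; rewrite ger0_norm. Qed.

Lemma conv_heaviside s x : 0 < s -> conv heaviside s x = Phi (x / s).
Proof.
move=> s0; have sn0 : - s != 0 by rewrite oppr_eq0 gt_eqF.
rewrite /conv (@Rint_affine _ _ (- s) x)//; last 2 first.
- by apply: measurable_funM; [exact: measurable_heaviside|exact: measurable_gd_sub].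
- by move=> w; rewrite mulr_ge0 ?gd_ge0//; case/andP: (heaviside01 w).
rewrite normrN gtr0_norm// -RintegralZl//; last first.
  apply: (@L1_affine _ (fun w => heaviside w * gd s (x - w))) => //.
    by move=> w; rewrite mulr_ge0 ?gd_ge0//; case/andP: (heaviside01 w).
  exact: L1_conv measurable_heaviside norm_heaviside s0.
have a1 : (Num.sqrt (pi *+ 2))^-1 = normal_peak 1 :> R.
  by rewrite /normal_peak expr1n mul1r.
rewrite /Phi a1.
have lG : L1 leb (fun t => gd 1 (0 - t)) by apply: L1_gd.
have -> : (fine (\int[leb]_(t in `]-oo, (x / s)]) (expR (- t ^+ 2 / 2))%:E)) =
    \int[leb]_(t in `]-oo, (x / s)]) expR (- t ^+ 2 / 2) by [].
have lE : leb.-integrable `]-oo, x / s] (EFin \o (fun t => expR (- t ^+ 2 / 2))).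
  apply: (@integrableS _ _ _ _ setT) => //.
  apply: eq_L1 (L1Z (normal_peak 1)^-1 lG) => t.
  by rewrite gdE// sub0r !divr1 sqrrN mulKf// gt_eqF// normal_peak_gt0 ?oner_neq0.
rewrite -(RintegralZl _ _ lE)// [RHS]Rintegral_mkcond; apply: eq_Rint => t.
rewrite patchE mem_setE in_itv/= /heaviside.
have -> : (0 <= - s * t + x) = (t <= x / s).
  by rewrite ler_pdivlMr//; apply/idP/idP; lra.
case: ifP => _; last by rewrite mul0r mulr0.
rewrite mul1r gdE// mulrA mulrCA mulfV ?mulr1 ?gt_eqF//.
by congr (_ * expR _); field; rewrite gt_eqF.
Qed.

(** The normal distribution function of standard deviation [s], in a form to which [conv_conv]
    applies directly: further smoothing just adds variances. *)
Definition Nd s x : R := conv heaviside s x.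

Lemma Nd_norm_le s x : 0 < s -> `|Nd s x| <= 1.
Proof. exact: conv_norm_le measurable_heaviside norm_heaviside. Qed.

Lemma Nd_ge0 s x : 0 <= Nd s x.
Proof.
by apply: Rintegral_ge0 => w _; rewrite mulr_ge0 ?gd_ge0//; case/andP: (heaviside01 w).
Qed.

Lemma Nd01 s x : 0 < s -> 0 <= Nd s x <= 1.
Proof.
by move=> s0; rewrite Nd_ge0/= (le_trans (ler_norm _))// Nd_norm_le.
Qed.

Lemma measurable_Nd s : measurable_fun setT (Nd s).
Proof.
apply: measurable_conv; first exact: measurable_heaviside.
by move=> w; case/andP: (heaviside01 w).
Qed.

Lemma conv_Nd s r x : 0 < s -> 0 < r ->
  conv (Nd s) r x = Nd (Num.sqrt (s ^+ 2 + r ^+ 2)) x.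
Proof. exact: conv_conv measurable_heaviside heaviside01. Qed.

Lemma normal_peak1_le1 : normal_peak 1 <= 1 :> R.
Proof.
rewrite /normal_peak expr1n mul1r.
have h : 1 <= Num.sqrt (pi *+ 2) :> R.
  rewrite -[leLHS]sqrtr1 ler_wsqrtr// -mulr_natr.
  by have := pi_ge2 R; lra.
by rewrite invf_le1// (lt_le_trans ltr01).
Qed.

(** After a translation the increment is the mass given to [[- x, - y[] by a density bounded by
    [1 / s]. *)
Lemma Nd_lipschitz s x y : 0 < s -> y <= x -> Nd s y <= Nd s x <= Nd s y + (x - y) / s.
Proof.
move=> s0 yx.
have NE u : Nd s u = \int[leb]_w (heaviside (w + u) * gd s (0 - w)) /\
    L1 leb (fun w => heaviside (w + u) * gd s (0 - w)).
  have E w : heaviside (w + u) * gd s (0 - w) =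
      (fun w => heaviside w * gd s (u - w)) (1 * w + u).
    by rewrite mul1r; congr (_ * gd s _); ring.
  have H0 w : 0 <= heaviside w * gd s (u - w).
    by rewrite mulr_ge0 ?gd_ge0//; case/andP: (heaviside01 w).
  have l1 := L1_conv u measurable_heaviside norm_heaviside s0.
  split.
    rewrite /Nd /conv (@Rint_affine _ _ 1 u)// ?normr1 ?mul1r.
      by apply: eq_Rint => w; rewrite E.
    exact: L1_meas l1.
  have l2 := L1_affine u (oner_neq0 R) H0 l1.
  by apply: eq_L1 l2 => w; rewrite E.
have [-> lx] := NE x; have [-> ly] := NE y.
apply/andP; split.
  apply: le_Rint => // w; rewrite ler_wpM2r ?gd_ge0// ler_nat.
  case: lerP => //= h; suff -> : 0 <= w + x by [].
  lra.
pose I : set (measurableTypeR R) := `[- x, - y[%classic.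
have lI1 : L1 leb (\1_I) by exact: integrable_indic_itv.
have lI := L1Z (normal_peak s) lI1.
have : \int[leb]_w (normal_peak s * \1_I w) <= (x - y) / s.
  rewrite (RintegralZl _ measurableT lI1).
  rewrite /Rintegral integral_indic//; last exact: measurable_itv.
  rewrite (setIT I)/= /I lebesgue_measure_itv/= lte_fin ltrN2.
  rewrite normal_peakE//; case: ltP => [_|xy] /=; last first.
    by rewrite mulr0 divr_ge0 ?subr_ge0// ltW.
  rewrite [leLHS](_ : _ = normal_peak 1 * ((x - y) / s)); last by field; rewrite gt_eqF.
  by rewrite ler_piMl ?normal_peak1_le1// divr_ge0 ?subr_ge0// ltW.
move=> h; apply: le_trans (lerD (lexx _) h).
rewrite -(RintegralD measurableT ly lI).
apply: le_Rint => //; first exact: L1D.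
move=> w; rewrite indicE mem_setE in_itv/= /heaviside.
have := gd_ge0 s (0 - w).
have : gd s (0 - w) <= normal_peak s by rewrite normal_pdf_ub// gt_eqF.
have -> : (- x <= w < - y) = (0 <= w + x) && ~~ (0 <= w + y).
  by rewrite -ltNge; congr andb; apply/idP/idP; lra.
case: (lerP 0 (w + x)) => ?; case: (lerP 0 (w + y)) => ? /=; try lra.
Qed.


Lemma NdE s x : 0 < s -> Nd s x = Phi (x / s).
Proof. exact: conv_heaviside. Qed.

End gaussian_cdf.

(* The law of [Y] under the probability of density [W] with respect to [mu];
   the tilted laws and the Gaussian laws are both of this form. *)
Record weighted_law d (T : measurableType d) (R : realType)
    (mu : {measure set T -> \bar R}) (W Y : T -> R) (v beta : R) : Prop := {
  wl_mW : measurable_fun setT W ;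
  wl_mY : measurable_fun setT Y ;
  wl_ge0 : forall t, 0 <= W t ;
  wl_L1 : L1 mu W ;
  wl_mass : \int[mu]_t W t = 1 ;
  wl_L1Y : L1 mu (fun t => W t * Y t) ;
  wl_mean : \int[mu]_t (W t * Y t) = 0 ;
  wl_L1Y2 : L1 mu (fun t => W t * Y t ^+ 2) ;
  wl_var : \int[mu]_t (W t * Y t ^+ 2) = v ;
  wl_L1Y3 : L1 mu (fun t => W t * `|Y t| ^+ 3) ;
  wl_third : \int[mu]_t (W t * `|Y t| ^+ 3) <= beta }.

Section weighted_laws.
Context d (T : measurableType d) (R : realType).
Implicit Types (mu : {measure set T -> \bar R}) (W Y : T -> R) (G : R -> R).

Definition cubic_at0 G (c0 a b B : R) :=
  forall y, `|G y - (c0 + a * y + b * y ^+ 2)| <= B * `|y| ^+ 3.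

(** The linear term has mean zero and the quadratic one depends on the variance alone. Two laws of
    the same variance thus share the main term [c0 + b * v] and differ only through their third
    moments. *)
Lemma weighted_law_cubic mu W Y v beta G c0 a b B :
  weighted_law mu W Y v beta -> measurable_fun setT G -> 0 <= B ->
  cubic_at0 G c0 a b B ->
  `|\int[mu]_t (W t * G (Y t)) - (c0 + b * v)| <= B * beta.
Proof.
case=> mW mY W0 lW W1 l1 E1 l2 E2 l3 E3 mG B0 GB.
pose p t := c0 * W t + a * (W t * Y t) + b * (W t * Y t ^+ 2).
have lp01 := L1D (L1Z c0 lW) (L1Z a l1).
have lp : L1 mu p := L1D lp01 (L1Z b l2).
have mWG : measurable_fun setT (fun t => W t * G (Y t)).
  by apply: measurable_funM => //; exact: measurableT_comp.
have H t : `|W t * G (Y t) - p t| <= B * (W t * `|Y t| ^+ 3).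
  have -> : W t * G (Y t) - p t = W t * (G (Y t) - (c0 + a * Y t + b * Y t ^+ 2)).
    by rewrite /p; ring.
  by rewrite normrM (ger0_norm (W0 t)) [leRHS]mulrCA ler_wpM2l.
have lG : L1 mu (fun t => W t * G (Y t)).
  have ld : L1 mu (fun t => W t * G (Y t) - p t).
    apply: L1_le H (L1Z B l3).
    by apply: measurable_funB => //; exact: L1_meas lp.
  by apply: eq_L1 (L1D ld lp) => t; rewrite subrK.
have -> : c0 + b * v = \int[mu]_t p t.
  rewrite (RintegralD measurableT lp01 (L1Z b l2)).
  rewrite (RintegralD measurableT (L1Z c0 lW) (L1Z a l1)).
  rewrite (RintegralZl _ measurableT lW) (RintegralZl _ measurableT l1).
  by rewrite (RintegralZl _ measurableT l2) W1 E1 E2 mulr1 mulr0 addr0.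
rewrite -(RintegralB measurableT lG lp).
apply: (@le_trans _ _ (\int[mu]_t (B * (W t * `|Y t| ^+ 3)))).
  by apply: normr_Rintegral_le H (L1Z B l3); exact: L1_meas (L1B lG lp).
by rewrite (RintegralZl _ measurableT l3) ler_wpM2l.
Qed.

End weighted_laws.

Definition gauss3C (R : realType) : R := 2 * 3`!%:R * expR 1.

Lemma gauss3C_ge0 (R : realType) : 0 <= gauss3C R.
Proof. by rewrite /gauss3C !mulr_ge0// expR_ge0. Qed.

(** The Gaussian variable is [x - w] rather than [w], so that averaging [conv F r (x - Y)] over it
    is literally a convolution evaluated at [x]. *)
Lemma weighted_law_gd (R : realType) (s x : R) : 0 < s ->
  weighted_law lebesgue_measure (fun w => gd s (x - w)) (fun w => x - w)
    (s ^+ 2) (gauss3C R * s ^+ 3).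
Proof.
move=> s0; split.
- exact: measurable_gd_sub.
- exact: measurable_funB.
- by move=> w; exact: gd_ge0.
- exact: L1_gd.
- exact: Rint_gd.
- by apply: (eq_L1 (mu := lebesgue_measure) _ (L1_gdX 1 x s0)) => w; rewrite expr1 mulrC.
- by rewrite -[RHS](Rint_gd_mean x s0); apply: eq_Rint => w; rewrite mulrC.
- by apply: (eq_L1 (mu := lebesgue_measure) _ (L1_gdX 2 x s0)) => w; rewrite mulrC.
- by rewrite -[RHS](Rint_gd_var x s0); apply: eq_Rint => w; rewrite mulrC.
- by apply: (eq_L1 (mu := lebesgue_measure) _ (L1_norm_gdX 3 x s0)) => w; rewrite mulrC.
- apply: le_trans (Rint_norm_gdX_le 3 x s0).
  by rewrite le_eqVlt; apply/orP; left; apply/eqP/eq_Rint => w; rewrite mulrC.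
Qed.

(** * From smoothed to unsmoothed distance *)

Section smoothing.
Context (R : realType).
Implicit Types (F G : R -> R).

(* Chebyshev: [G >= q - (q + De) ((c - w) / (2 e)) ^ 2] everywhere. *)
Lemma smoothing_local G De q c e M : measurable_fun setT G ->
  (forall w, `|G w| <= De) -> 0 < e -> 0 <= M ->
  (forall w, `|w - c| <= 2 * e -> q <= G w) ->
  conv G e c <= M -> q <= 4 / 3 * M + De / 3.
Proof.
move=> mG GDe e0 M0 Gq GM.
have De0 : 0 <= De by apply: le_trans (GDe 0).
have [qD|qD] := ltP (q + De) 0; first by lra.
have lX := L1_gdX 2 c e0; have l0 := L1_gd c e0.
pose k := (q + De) / (4 * e ^+ 2).
have k0 : 0 <= k by rewrite divr_ge0// mulr_ge0// sqr_ge0.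
(* The kernel has variance [e ^ 2], a quarter of the squared radius [(2 * e) ^ 2]. The bound
   rearranges to [3 / 4 * q <= M + De / 4]. *)
suff : q - (q + De) / 4 <= conv G e c by lra.
have -> : q - (q + De) / 4 =
    \int[leb]_w (q * gd e (c - w) - k * ((c - w) ^+ 2 * gd e (c - w))).
  rewrite (RintegralB measurableT (L1Z q l0) (L1Z k lX)).
  rewrite (RintegralZl _ measurableT l0) (RintegralZl _ measurableT lX).
  by rewrite Rint_gd// Rint_gd_var// /k; field; rewrite gt_eqF.
apply: le_Rint; [exact: L1B (L1Z q l0) (L1Z k lX)|exact: L1_conv GDe e0|move=> w].
rewrite mulrA -mulrBl ler_wpM2r ?gd_ge0//.
have [wc|wc] := lerP `|w - c| (2 * e).
  apply: le_trans (Gq _ wc); rewrite gerBl mulr_ge0// sqr_ge0//.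
apply: (@le_trans _ _ (- De)); last by have := GDe w; rewrite ler_norml => /andP[].
suff : (q + De) <= k * (c - w) ^+ 2 by lra.
rewrite /k mulrAC ler_pdivlMr ?mulr_gt0 ?exprn_gt0// ler_wpM2l//.
have -> : 4 * e ^+ 2 = (2 * e) ^+ 2 by ring.
rewrite -[leRHS]sqrrN opprB -[leRHS]ger0_norm ?sqr_ge0// normrX.
by rewrite lerXn2r ?nnegrE ?mulr_ge0 ?(ltW e0)//; exact: ltW.
Qed.

(** A positive discrepancy at [x] persists on [[x, x + 4e]], a negative one on [[x - 4e, x]]: [F] is
    monotone and [Nd s] moves by at most [4 * e / s]. The local lemma is applied at the midpoint of
    that interval. *)
Lemma smoothing F s e De M : {homo F : x y / x <= y} ->
  (forall w, `|F w - Nd s w| <= De) -> 0 < s -> 0 < e ->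
  (forall x, `|conv (fun w => F w - Nd s w) e x| <= M) ->
  forall x, `|F x - Nd s x| <= 4 / 3 * M + De / 3 + 4 * e / s.
Proof.
move=> Fm FDe s0 e0 HM x.
have mD : measurable_fun setT (fun w => F w - Nd s w).
  by apply: measurable_funB; [exact: nondecreasing_measurable|exact: measurable_Nd].
have M0 : 0 <= M by apply: le_trans (HM 0).
have es : 0 <= e / s by rewrite divr_ge0// ltW.
rewrite ler_norml; apply/andP; split.
- suff : - (F x - Nd s x) - 4 * e / s <= 4 / 3 * M + De / 3 by lra.
  apply: (@smoothing_local (fun w => - (F w - Nd s w)) De _ (x - 2 * e) e) => //.
  + exact: measurableT_comp.
  + by move=> w; rewrite normrN.
  + move=> w; rewrite ler_norml => /andP[w1 w2].
    have wx : w <= x by lra.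
    have /andP[_] := Nd_lipschitz s0 wx; have := Fm _ _ wx.
    have : (x - w) / s <= 4 * e / s by rewrite ler_wpM2r ?invr_ge0 ?(ltW s0)//; lra.
    by move: (Nd s w) (Nd s x) => a b; lra.
  + have := HM (x - 2 * e); rewrite ler_norml => /andP[+ _].
    by rewrite (convN (x - 2 * e) mD FDe e0) lerNl.
- suff : F x - Nd s x - 4 * e / s <= 4 / 3 * M + De / 3 by lra.
  apply: (@smoothing_local (fun w => F w - Nd s w) De _ (x + 2 * e) e) => //.
  + move=> w; rewrite ler_norml => /andP[w1 w2].
    have wx : x <= w by lra.
    have /andP[_] := Nd_lipschitz s0 wx; have := Fm _ _ wx.
    have : (w - x) / s <= 4 * e / s by rewrite ler_wpM2r ?invr_ge0 ?(ltW s0)//; lra.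
    by move: (Nd s w) (Nd s x) => a b; lra.
  + by have := HM (x + 2 * e); rewrite ler_norml => /andP[].
Qed.

(** [smoothing] bounds the distance in terms of any prior bound [De] on it. Taking for [De] the
    supremum, finite thanks to [c], gives [S <= A + S / 3]. *)
Lemma norm_bound_absorb (D : R -> R) A c : (forall x, `|D x| <= c) ->
  (forall De, (forall x, `|D x| <= De) -> forall x, `|D x| <= A + De / 3) ->
  forall x, `|D x| <= 3 / 2 * A.
Proof.
move=> Dc H x.
pose S := [set `|D y| | y in [set: R]].
have S0 : S !=set0 by exists `|D 0|; exists 0.
have hS : has_sup S by split => //; exists c => _ [y _ <-].
have ub y : `|D y| <= sup S by apply: ub_le_sup; [case: hS|exists y].
have : sup S <= A + sup S / 3.
  by apply: ge_sup => // _ [y _ <-]; exact: H.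
by have := ub x; lra.
Qed.

End smoothing.

(** * The Berry-Esseen bound *)

Section berry_esseen.
Context d (T : measurableType d) (R : realType).
Variable mu : {sigma_finite_measure set T -> \bar R}.
Implicit Types (W Y : T -> R) (F G : R -> R) (r s x b B : R).

(* If [F] is the distribution function of [Z], this is that of [Z + Y] with [Y]
   independent of [Z] and distributed according to the density [W]. *)
Definition wstep W Y F (w : R) : R := \int[mu]_t (W t * F (w - Y t)).

Definition cdf_like F := {homo F : x y / x <= y} /\ forall w, 0 <= F w <= 1.

Lemma cdf_like_heaviside : cdf_like (@heaviside R).
Proof.
split; last exact: heaviside01.
move=> a b ab; rewrite /heaviside ler_nat.
by case: (lerP 0 a) => //= a0; rewrite (le_trans a0 ab).
Qed.

Lemma cdf_like_meas F : cdf_like F -> measurable_fun setT F.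
Proof. by case=> Fm _; exact: nondecreasing_measurable. Qed.

Lemma cdf_like_norm F w : cdf_like F -> `|F w| <= 1.
Proof. by case=> _ F01; case/andP: (F01 w) => ? ?; rewrite ger0_norm. Qed.

Lemma L1_wstep W Y v beta F w : weighted_law mu W Y v beta -> cdf_like F ->
  L1 mu (fun t => W t * F (w - Y t)).
Proof.
move=> wl cF; have mF := cdf_like_meas cF.
have mFY : measurable_fun setT (fun t => F (w - Y t)).
  by apply: (measurableT_comp mF); apply: measurable_funB => //; exact: wl_mY wl.
have := L1_bdd_mul mFY (fun t => cdf_like_norm (w - Y t) cF) (wl_L1 wl).
by apply: eq_L1 => t; rewrite mulrC.
Qed.

Lemma cdf_like_wstep W Y v beta F : weighted_law mu W Y v beta -> cdf_like F ->
  cdf_like (wstep W Y F).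
Proof.
move=> wl cF; have W0 := wl_ge0 wl; split.
  move=> a b ab; apply: le_Rint; [exact: L1_wstep wl cF|exact: L1_wstep wl cF|].
  by move=> t; rewrite ler_wpM2l//; case: cF => + _; apply; rewrite lerD2r.
move=> w; apply/andP; split.
  by apply: Rintegral_ge0 => t _; rewrite mulr_ge0//; case: cF => _ /(_ (w - Y t)) /andP[].
rewrite -(wl_mass wl); apply: le_Rint; [exact: L1_wstep wl cF|exact: wl_L1 wl|].
by move=> t; rewrite ler_piMr//; case: cF => _ /(_ (w - Y t)) /andP[].
Qed.

Lemma conv_translate F r x a : measurable_fun setT F -> (forall w, 0 <= F w) ->
  \int[@lebesgue_measure R]_w (F (w - a) * gd r (x - w)) = conv F r (x - a).
Proof.
move=> mF F0.
have m1 : measurable_fun setT (fun w : R => F (w - a) * gd r (x - w)).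
  apply: measurable_funM; last exact: measurable_gd_sub.
  by apply: (measurableT_comp mF); exact: measurable_funB.
rewrite (Rint_affine a (oner_neq0 R) m1); last first.
  by move=> w; rewrite mulr_ge0 ?gd_ge0.
rewrite normr1 mul1r; apply: eq_Rint => w.
by rewrite mul1r addrK; congr (_ * gd _ _); ring.
Qed.

Lemma conv_wstep W Y v beta F r x : weighted_law mu W Y v beta -> cdf_like F ->
  0 < r -> conv (wstep W Y F) r x = \int[mu]_t (W t * conv F r (x - Y t)).
Proof.
move=> wl cF r0; have mF := cdf_like_meas cF.
have F0 w : 0 <= F w by case: cF => _ /(_ w) /andP[].
have W0 := wl_ge0 wl.
have lw w : L1 mu (fun t => W t * F (w - Y t)) := L1_wstep w wl cF.
have lc t : L1 leb (fun w => F (w - Y t) * gd r (x - w)).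
  apply: (L1_bdd_mul (mu := lebesgue_measure) _ _ (L1_gd x r0) (c := 1)).
    by apply: (measurableT_comp mF); exact: measurable_funB.
  by move=> w; exact: cdf_like_norm.
transitivity (\int[leb]_w \int[mu]_t (gd r (x - w) * (W t * F (w - Y t)))).
  apply: eq_Rint => w.
  by rewrite (RintegralZl (gd r (x - w)) measurableT (lw w)) mulrC.
rewrite Rint_Tonelli.
- apply: eq_Rint => t; rewrite -(conv_translate r x (Y t) mF F0).
  rewrite -(RintegralZl (W t) measurableT (lc t)).
  by apply: eq_Rint => w; rewrite mulrC mulrA.
- apply: measurable_funM.
    apply: (measurableT_comp (measurable_gd_sub r x)); exact: measurable_fst.
  apply: measurable_funM.
    apply: (measurableT_comp (wl_mW wl)); exact: measurable_snd.
  apply: (measurableT_comp mF); apply: measurable_funB => //.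
  apply: (measurableT_comp (wl_mY wl)); exact: measurable_snd.
- by move=> w t; rewrite !mulr_ge0// gd_ge0.
- by move=> w; exact: L1Z (lw w).
- move=> t; apply: (eq_L1 (mu := lebesgue_measure) _ (L1Z (W t) (lc t))) => w.
  by rewrite [gd _ _ * _]mulrC mulrA.
Qed.

(* Replacing one summand by a Gaussian of the same variance. *)
Lemma lindeberg_step W Y v b F r x c0 a a2 B :
  weighted_law mu W Y v (b * v) -> cdf_like F -> 0 <= v -> v <= b ^+ 2 -> 0 < b ->
  0 < r -> 0 <= B -> cubic_at0 (fun y => conv F r (x - y)) c0 a a2 B ->
  `|conv (wstep W Y F) r x - conv F (Num.sqrt (r ^+ 2 + v)) x| <=
  B * ((1 + gauss3C R) * (b * v)).
Proof.
move=> wl cF v0 vb b0 r0 B0 HB; have mF := cdf_like_meas cF.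
have F0 w : 0 <= F w by case: cF => _ /(_ w) /andP[].
have mG : measurable_fun setT (fun y : R => conv F r (x - y)).
  by apply: (measurableT_comp (measurable_conv r mF F0)); exact: measurable_funB.
have H1 := weighted_law_cubic wl mG B0 HB.
rewrite (conv_wstep _ wl cF r0).
set I := Rintegral _ _ _ in H1 *.
suff H2 : `|conv F (Num.sqrt (r ^+ 2 + v)) x - (c0 + a2 * v)| <=
    B * (gauss3C R * (b * v)).
  apply: le_trans (ler_distD (c0 + a2 * v) _ _) _.
  by rewrite (distrC (c0 + _)) mulrDl mul1r mulrDr lerD.
(* A Gaussian of variance 0 has no density, so the degenerate summand is treated apart, by the
   expansion at [y = 0]. *)
have [v_gt0|v_le0] := ltP 0 v; last first.
  have -> : v = 0 by apply/eqP; rewrite eq_le v0 v_le0.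
  rewrite addr0 !mulr0 addr0 sqrtr_sqr (gtr0_norm r0).
  by have := HB 0; rewrite subr0 normr0 !expr0n/= ?mulr0n !mulr0 !addr0.
have s0 : 0 < Num.sqrt v by rewrite sqrtr_gt0.
have := weighted_law_cubic (weighted_law_gd x s0) mG B0 HB.
rewrite sqr_sqrtr//.
have -> : \int[@lebesgue_measure R]_t (gd (Num.sqrt v) (x - t) * conv F r (x - (x - t))) =
    conv F (Num.sqrt (r ^+ 2 + v)) x.
  rewrite -[X in r ^+ 2 + X](sqr_sqrtr v0).
  case: (cF) => _ F01; rewrite -(conv_conv x mF F01 r0 s0).
  by apply: eq_Rint => w; rewrite subKr mulrC.
move=> /le_trans; apply; rewrite ler_wpM2l// ler_wpM2l ?gauss3C_ge0//.
(* The Gaussian third moment is of order [sqrt v * v], and [sqrt v <= b]. *)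
rewrite exprS sqr_sqrtr// ler_wpM2r//.
by rewrite -(ger0_norm (ltW b0)) -sqrtr_sqr ler_wsqrtr.
Qed.

Lemma cubic_bounded F r x : cdf_like F -> 0 < r -> exists a a2,
  cubic_at0 (fun y => conv F r (x - y)) (conv F r x) a a2 (2 * taylorC R / r ^+ 3).
Proof.
move=> cF r0.
have [a [a2 H]] := conv_taylor x (cdf_like_meas cF) (fun w => cdf_like_norm w cF) r0.
by exists a, a2 => y; have := H y; rewrite mulr1.
Qed.

(** Split [F] into [Nd s] and the error. The first is smoothed at the total scale
    [sqrt (s ^ 2 + r ^ 2)]; only the error, of size [De], pays the price [r ^ -3] of the small
    scale. *)
Lemma cubic_near_gaussian F s r x De : cdf_like F -> 0 < s -> 0 < r ->
  (forall w, `|F w - Nd s w| <= De) -> exists a a2,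
  cubic_at0 (fun y => conv F r (x - y)) (conv F r x) a a2
    (2 * taylorC R / Num.sqrt (s ^+ 2 + r ^+ 2) ^+ 3 + 2 * taylorC R * De / r ^+ 3).
Proof.
move=> cF s0 r0 HD.
have mF := cdf_like_meas cF.
have t0 : 0 < Num.sqrt (s ^+ 2 + r ^+ 2).
  by rewrite sqrtr_gt0 addr_gt0// exprn_gt0.
have mD : measurable_fun setT (fun w : R => F w - Nd s w).
  by apply: measurable_funB; [exact: mF|exact: measurable_Nd].
have [a [a2 H]] := conv_taylor x mD HD r0.
have [c [c2 H']] := cubic_bounded x cdf_like_heaviside t0.
exists (a + c), (a2 + c2) => y.
have E z : conv F r z = conv (fun w => F w - Nd s w) r z +
    conv (@heaviside R) (Num.sqrt (s ^+ 2 + r ^+ 2)) z.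
  rewrite (convB (c := 1) z mF _ (measurable_Nd s))//.
  - by rewrite (conv_Nd _ s0 r0) subrK.
  - by move=> w; exact: cdf_like_norm.
  - by move=> w; exact: Nd_norm_le.
have Hs := le_trans (ler_normD _ _) (lerD (H y) (H' y)).
rewrite [X in _ <= X * _]addrC [leRHS]mulrDl; apply: le_trans _ Hs; rewrite !E.
move: (conv (fun w => F w - Nd s w) r (x - y)) (conv (fun w => F w - Nd s w) r x).
move: (conv _ _ (x - y)) (conv _ _ x) => u1 u2 u3 u4.
by rewrite le_eqVlt; apply/orP; left; apply/eqP; congr `|_|; ring.
Qed.

End berry_esseen.

(** * Berry-Esseen by induction on the number of summands *)

Definition bergstromC (R : realType) : R := 4 * taylorC R * (1 + gauss3C R).

Lemma bergstromC_ge1 (R : realType) : 1 <= bergstromC R.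
Proof.
rewrite /bergstromC; have := taylorC_ge1 R; have := gauss3C_ge0 R => g0 t1.
by have := mulr_ge0 g0 (le_trans ler01 t1); lra.
Qed.

(** A discrete form of [d (r^-1) = - r^-3 / 2 * d (r ^ 2)]. The condition [v <= r ^ 2] keeps
    [r' <= 3 / 2 * r], so [r' * (r + r') <= 15 / 4 * r ^ 2]. *)
Lemma inv_cube_le_telescope (R : realType) (r r' v : R) : 0 < r -> 0 <= v ->
  v <= r ^+ 2 -> 0 < r' -> r' ^+ 2 = r ^+ 2 + v ->
  v / r ^+ 3 <= 4 * (r^-1 - r'^-1).
Proof.
move=> r0 v0 vr r'0 E.
have rr : r <= r' by rewrite -(ler_pXn2r (n := 2)) ?nnegrE ?(ltW r0) ?(ltW r'0)// E lerDl.
have r2 : r' <= 3 / 2 * r.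
  rewrite -(ler_pXn2r (n := 2)) ?nnegrE ?(ltW r'0) ?mulr_ge0 ?(ltW r0)//.
  rewrite E exprMn; have := sqr_ge0 r; lra.
have -> : 4 * (r^-1 - r'^-1) = 4 * (v / (r * r' * (r + r'))).
  have -> : v = r' ^+ 2 - r ^+ 2 by rewrite E addrC addKr.
  by field; rewrite !gt_eqF// addr_gt0.
rewrite mulrCA ler_wpM2l// ler_pdivlMr ?mulr_gt0 ?addr_gt0//.
rewrite mulrC ler_pdivrMr ?exprn_gt0//.
have h1 : r' * (r + r') <= (3 / 2 * r) * (r + 3 / 2 * r).
  by rewrite ler_pM ?addr_ge0 ?(ltW r0) ?(ltW r'0)// lerD2l.
have := ler_wpM2l (ltW r0) h1.
have -> : r * (3 / 2 * r * (r + 3 / 2 * r)) = 15 / 4 * r ^+ 3 by field.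
by have := exprn_gt0 3 r0; rewrite mulrA; lra.
Qed.

Section berry_esseen_induction.
Context d (T : measurableType d) (R : realType).
Variable mu : {sigma_finite_measure set T -> \bar R}.
Variables (N : nat) (b : R) (W Y : nat -> T -> R) (v : nat -> R) (F : nat -> R -> R).
Hypothesis b0 : 0 < b.
Hypothesis v0 : forall k, 0 <= v k.
Hypothesis vb : forall k, v k <= b ^+ 2.
Hypothesis wl : forall k, (k < N)%N -> weighted_law mu (W k) (Y k) (v k) (b * v k).
Hypothesis F0 : F 0%N = @heaviside R.
Hypothesis FS : forall k, (k < N)%N -> F k.+1 = wstep mu (W k) (Y k) (F k).

Let V n := \sum_(i < n) v i.
Let Q := bergstromC R.
(** [L] and [K] are chosen so that the induction closes. Smoothing at scale [e = L * b] leaves an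
    error [Q * (1 + 4 * K / L) * b / sg = 50 * Q * b / sg], and removing the smoothing gives [3 / 2
    * (4 / 3 * 50 + 4 * 16) * Q = 196 * Q = K]. *)
Let L := 16 * Q.
Let K := 196 * Q.
Let e := L * b.

Let Q1 : 1 <= Q := bergstromC_ge1 R.
Let Q0 : 0 < Q. Proof. exact: lt_le_trans ltr01 Q1. Qed.
Let e0 : 0 < e. Proof. by apply: mulr_gt0 => //; exact: mulr_gt0. Qed.
Let be2 : b ^+ 2 <= e ^+ 2.
Proof.
rewrite lerXn2r ?nnegrE ?(ltW b0) ?(ltW e0)// /e ler_peMl ?(ltW b0)//.
by rewrite /L; move: Q1; lra.
Qed.

Let VS k : V k.+1 = V k + v k. Proof. by rewrite /V big_ord_recr. Qed.


Let V_le k m : (k <= m)%N -> V k <= V m.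
Proof.
move=> /subnKC <-; elim: (m - k)%N => [|j IH]; first by rewrite addn0.
by rewrite addnS VS (le_trans IH)// lerDl.
Qed.

Let cF k : (k <= N)%N -> cdf_like (F k).
Proof.
elim: k => [_|k IH kN]; first by rewrite F0; exact: cdf_like_heaviside.
by rewrite FS//; apply: (cdf_like_wstep (wl kN)); exact/IH/ltnW.
Qed.

Section fixed_n.
Variable n : nat.
Hypothesis nN : (n <= N)%N.
Hypothesis Vn : 0 < V n.
Let sg := Num.sqrt (V n).
Hypothesis IH : forall k, (k < n)%N -> 0 < V k ->
  forall x, `|F k x - Nd (Num.sqrt (V k)) x| <= K * b / Num.sqrt (V k).

(** Standard deviation of the Gaussian part when the summands from [k] to [n - 1] have been
    replaced: their total variance plus that of the smoothing. *)
Let rho k := Num.sqrt (e ^+ 2 + (V n - V k)).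

Let sg0 : 0 < sg. Proof. by rewrite sqrtr_gt0. Qed.
Let sg2 : sg ^+ 2 = V n. Proof. by rewrite sqr_sqrtr// ltW. Qed.

Let rho_arg k : (k <= n)%N -> e ^+ 2 <= e ^+ 2 + (V n - V k).
Proof. by move=> kn; rewrite lerDl subr_ge0 V_le. Qed.

Let rho2 k : (k <= n)%N -> rho k ^+ 2 = e ^+ 2 + (V n - V k).
Proof. by move=> kn; rewrite sqr_sqrtr// (le_trans _ (rho_arg kn))// sqr_ge0. Qed.

Let rho0 k : (k <= n)%N -> 0 < rho k.
Proof.
by move=> kn; rewrite sqrtr_gt0 (lt_le_trans _ (rho_arg kn))// exprn_gt0.
Qed.

Let rhoS k : (k < n)%N -> rho k = Num.sqrt (rho k.+1 ^+ 2 + v k).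
Proof. by move=> kn; rewrite rho2// /rho VS; congr Num.sqrt; ring. Qed.

(** The two terms of [cubic_near_gaussian], with the induction hypothesis as [De]. The constant is 4
    instead of 2 because [V k >= V n / 4] only gives [sqrt (V k) >= sg / 2]. *)
Let step_coef k : R := 4 * taylorC R * (sg ^- 3 + K * b / sg / rho k.+1 ^+ 3).

Let K0 : 0 <= K. Proof. exact: mulr_ge0 _ (ltW Q0). Qed.
Let tC0 : 0 <= taylorC R. Proof. exact: le_trans ler01 (taylorC_ge1 R). Qed.

Let Kbs0 : 0 <= K * b / sg.
Proof. by apply: divr_ge0; [apply: mulr_ge0 K0 (ltW b0)|exact: ltW]. Qed.

Let step_coef_ge0 k : 0 <= step_coef k.
Proof.
apply: mulr_ge0; first exact: mulr_ge0.
apply: addr_ge0; first by rewrite invr_ge0 exprn_ge0// ltW.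
by apply: divr_ge0 => //; rewrite exprn_ge0// sqrtr_ge0.
Qed.

(* While less than a quarter of the variance is used up, the Gaussian part
   alone is smooth enough; afterwards the induction hypothesis applies. *)
Let step_cubic k x : (k < n)%N -> exists c a a2,
  cubic_at0 (fun y => conv (F k) (rho k.+1) (x - y)) c a a2 (step_coef k).
Proof.
move=> kn; have kN := leq_trans (ltnW kn) nN.
have r0 := rho0 kn; set r := rho k.+1 in r0 *.
have Kb0 : 0 <= K * b / sg / r ^+ 3.
  by apply: divr_ge0 => //; rewrite exprn_ge0// ltW.
have r2 : r ^+ 2 = e ^+ 2 + (V n - V k - v k) by rewrite rho2// VS; ring.
have vk := vb k.
have mono c a a2 B : B <= step_coef k ->
    cubic_at0 (fun y => conv (F k) r (x - y)) c a a2 B ->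
    cubic_at0 (fun y => conv (F k) r (x - y)) c a a2 (step_coef k).
  by move=> BB H y; apply: le_trans (H y) _; rewrite ler_wpM2r// exprn_ge0.
have [Vk|Vk] := ltP (V k) (V n / 4).
  have [a [a2 H]] := cubic_bounded x (cF kN) r0.
  exists (conv (F k) r x), a, a2; apply: mono H.
  rewrite /step_coef -/r.
  suff : (r ^+ 3)^-1 <= 2 * sg ^- 3.
    by move=> /(ler_wpM2l tC0); have := mulr_ge0 tC0 Kb0; lra.
  rewrite -[2]invrK -invfM lef_pV2 ?posrE ?mulr_gt0 ?exprn_gt0//.
  (* At least three quarters of the variance is left, and [(4 / 5) ^ 2 < 3 / 4] while
     [(4 / 5) ^ 3 > 1 / 2]. *)
  have sr : 4 / 5 * sg <= r.
    rewrite -(ler_pXn2r (n := 2)) ?nnegrE ?(ltW r0) ?mulr_ge0 ?(ltW sg0)//.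
    by rewrite exprMn sg2 r2; move: be2 vk Vk Vn; lra.
  have : (4 / 5 * sg) ^+ 3 <= r ^+ 3.
    by rewrite lerXn2r// nnegrE ?(ltW r0)// mulr_ge0// ltW.
  by rewrite exprMn; have := exprn_gt0 3 sg0; lra.
have Vk0 : 0 < V k by apply: lt_le_trans Vk; rewrite divr_gt0.
have sk0 : 0 < Num.sqrt (V k) by rewrite sqrtr_gt0.
have [a [a2 H]] := cubic_near_gaussian x (cF kN) sk0 r0 (IH kn Vk0).
exists (conv (F k) r x), a, a2; apply: mono H.
rewrite /step_coef -/r sqr_sqrtr ?(ltW Vk0)//.
have H1 : (Num.sqrt (V k + r ^+ 2) ^+ 3)^-1 <= sg ^- 3.
  rewrite lef_pV2 ?posrE ?exprn_gt0 ?sqrtr_gt0 ?addr_gt0 ?exprn_gt0//.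
  rewrite lerXn2r ?nnegrE ?sqrtr_ge0// ler_wsqrtr// r2.
  by move: be2 vk; lra.
have H2 : K * b / Num.sqrt (V k) <= 2 * (K * b / sg).
  rewrite mulrCA; apply: ler_wpM2l; first exact: mulr_ge0 K0 (ltW b0).
  rewrite -[2]invrK -invfM lef_pV2 ?posrE ?mulr_gt0//.
  rewrite -(ler_pXn2r (n := 2)) ?nnegrE ?sqrtr_ge0 ?mulr_ge0 ?(ltW sg0)//.
  by rewrite exprMn sg2 sqr_sqrtr ?(ltW Vk0)//; lra.
have r30 : 0 <= (r ^+ 3)^-1 by rewrite invr_ge0 exprn_ge0// ltW.
have H3 := ler_wpM2r r30 H2.
have := ler_wpM2l tC0 H1; have := ler_wpM2l tC0 H3.
have sg30 : 0 <= taylorC R * sg ^- 3 by rewrite mulr_ge0 ?invr_ge0 ?exprn_ge0 ?(ltW sg0).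
lra.
Qed.

(** The form is made for summation over [k]: the first terms add up to [V n / sg ^ 3 = 1 / sg], and
    the second ones telescope to at most [1 / e]. *)
Let step_bound k x : (k < n)%N ->
  `|conv (F k.+1) (rho k.+1) x - conv (F k) (rho k) x| <=
  Q * b * (v k / sg ^+ 3 + 4 * K * b / sg * ((rho k.+1)^-1 - (rho k)^-1)).
Proof.
move=> kn; have kN := leq_trans kn nN; have r0 := rho0 kn.
have [c [a [a2 H]]] := step_cubic x kn.
have := lindeberg_step (wl kN) (cF (ltnW kN)) (v0 k) (vb k) b0 r0 (step_coef_ge0 k) H.
rewrite -rhoS// -FS//; move=> /le_trans; apply.
have vr : v k <= rho k.+1 ^+ 2.
  by rewrite rho2// (le_trans (vb k))// (le_trans be2)// rho_arg.
have rE : rho k ^+ 2 = rho k.+1 ^+ 2 + v k.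
  by rewrite !rho2 ?(ltnW kn)// VS; ring.
have := inv_cube_le_telescope r0 (v0 k) vr (rho0 (ltnW kn)) rE.
have KQ : 0 <= Q * b * (K * b / sg).
  by apply: mulr_ge0 => //; exact: mulr_ge0 (ltW Q0) (ltW b0).
move=> /(ler_wpM2l KQ) H4.
have -> : step_coef k * ((1 + gauss3C R) * (b * v k)) =
   Q * b * (v k / sg ^+ 3) + Q * b * (K * b / sg) * (v k / rho k.+1 ^+ 3).
  rewrite /step_coef /Q /bergstromC; move: (rho k.+1) r0 => r r0.
  by field; rewrite !gt_eqF.
by rewrite mulrDr lerD2l (le_trans H4)// le_eqVlt; apply/orP; left; apply/eqP; ring.
Qed.

Let smoothed_bound x :
  `|conv (fun w => F n w - Nd sg w) e x| <= 50 * Q * b / sg.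
Proof.
have rn : rho n = e by rewrite /rho subrr addr0 sqrtr_sqr gtr0_norm.
have mF := cdf_like_meas (cF nN).
rewrite (convB (c := 1) x mF _ (measurable_Nd sg))//; last 2 first.
- by move=> w; apply: cdf_like_norm; exact: cF.
- by move=> w; exact: Nd_norm_le.
(* With every summand replaced, only Gaussians remain. So [conv (F k) (rho k)] interpolates between
   the smoothed normal law at [k = 0] and the smoothed [F n] at [k = n]. *)
have -> : conv (Nd sg) e x = conv (F 0%N) (rho 0%N) x.
  by rewrite (conv_Nd _ sg0 e0) F0 /rho sg2 /V big_ord0 subr0 addrC.
rewrite -[in conv (F n) e x]rn.
rewrite -(telescope_sumr (fun k => conv (F k) (rho k) x) (leq0n n)).
apply: le_trans (ler_norm_sum _ _ _) _.
rewrite big_mkord.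
apply: le_trans (ler_sum _ (fun (k : 'I_n) _ => step_bound x (ltn_ord k))) _.
rewrite -mulr_sumr big_split/= -mulr_suml -mulr_sumr.
have -> : \sum_(i < n) ((rho i.+1)^-1 - (rho i)^-1) = (rho n)^-1 - (rho 0%N)^-1.
  by rewrite -(telescope_sumr (fun k => (rho k)^-1) (leq0n n)) big_mkord.
rewrite -/(V n) -sg2 rn.
have KQ : 0 <= 4 * K * b / sg.
  have -> : 4 * K * b / sg = 4 * (K * b / sg) by ring.
  exact: mulr_ge0.
have -> : 50 * Q * b / sg = Q * b * (sg ^+ 2 / sg ^+ 3 + 4 * K * b / sg * e^-1).
  by rewrite /e /K /L; field; rewrite ?(gt_eqF Q0) ?(gt_eqF b0) ?(gt_eqF sg0).
apply: ler_wpM2l; first exact: mulr_ge0 (ltW Q0) (ltW b0).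
rewrite lerD2l; apply: ler_wpM2l => //.
by rewrite gerBl invr_ge0 ltW// rho0.
Qed.

Lemma berry_esseen_step x : `|F n x - Nd sg x| <= K * b / sg.
Proof.
have -> : K * b / sg = 3 / 2 * (4 / 3 * (50 * Q * b / sg) + 4 * e / sg).
  by rewrite /K /e /L; field; rewrite gt_eqF.
apply: (@norm_bound_absorb _ (fun x => F n x - Nd sg x) _ 2).
  move=> y; apply: (le_trans (ler_normB _ _)).
  by have := cdf_like_norm y (cF nN); have := Nd_norm_le y sg0; lra.
move=> De HDe y; have := smoothing (proj1 (cF nN)) HDe sg0 e0 smoothed_bound y.
by move=> /le_trans; apply; lra.
Qed.

End fixed_n.

Theorem berry_esseen n x : (n <= N)%N -> 0 < \sum_(i < n) v i ->
  `|F n x - Nd (Num.sqrt (\sum_(i < n) v i)) x| <=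
  196 * bergstromC R * b / Num.sqrt (\sum_(i < n) v i).
Proof.
elim/ltn_ind: n x => n IH x nN Vn; apply: berry_esseen_step => // k kn Vk y.
exact: IH (leq_trans (ltnW kn) nN) Vk.
Qed.

End berry_esseen_induction.

(** * Limit theorems and moments under Bernstein's condition *)

Section integral_limits.
Context d (T : measurableType d) (R : realType) (mu : {measure set T -> \bar R}).
Implicit Types (f : nat -> T -> R) (g h : T -> R).

Lemma Rint_monotone_limit f g B : (forall n, L1 mu (f n)) ->
  (forall n t, 0 <= f n t) -> (forall t, nondecreasing_seq (f^~ t)) ->
  (forall t, f n t @[n --> \oo] --> g t) -> measurable_fun setT g ->
  (forall n, \int[mu]_t f n t <= B) ->
  L1 mu g /\ \int[mu]_t g t <= B.
Proof.
move=> lf f0 fnd fg mg fB.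
have g0 t : 0 <= g t.
  rewrite -(cvg_lim _ (fg t))//; apply: limr_ge; last exact: nearW.
  by apply/cvg_ex; exists (g t); exact: fg.
have H : (\int[mu]_t (g t)%:E <= B%:E)%E.
  have -> : (\int[mu]_t (g t)%:E = \int[mu]_t (limn (fun n => (f n t)%:E)))%E.
    apply: eq_integral => t _; apply/esym/cvg_lim => //.
    by apply: cvg_EFin; [exact: nearW|exact: fg].
  rewrite monotone_convergence//.
  - apply: lime_le; last first.
      by apply: nearW => n; rewrite (L1_fineK (lf n)) lee_fin.
    apply: ereal_nondecreasing_is_cvgn => m n mn; apply: ge0_le_integral => //.
    + by move=> t _; rewrite lee_fin.
    + exact/measurable_EFinP/(L1_meas (lf m)).
    + exact/measurable_EFinP/(L1_meas (lf n)).
    + by move=> t _; rewrite lee_fin; exact: fnd.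
  - by move=> n; exact/measurable_EFinP/(L1_meas (lf n)).
  - by move=> n t _; rewrite lee_fin.
  - by move=> t _ m n mn; rewrite lee_fin; exact: fnd.
have lg := ge0_L1 mg g0 H; split => //.
by rewrite -lee_fin -(L1_fineK lg).
Qed.

Lemma Rint_dominated_limit_le f g h B : (forall n, measurable_fun setT (f n)) ->
  (forall n t, `|f n t| <= h t) -> L1 mu h ->
  (forall t, f n t @[n --> \oo] --> g t) -> measurable_fun setT g ->
  (forall n, \int[mu]_t f n t <= B) -> \int[mu]_t g t <= B.
Proof.
move=> mf fh lh fg mg fB.
have H1 n : measurable_fun setT (EFin \o f n) by exact/measurable_EFinP.
have H2 : measurable_fun setT (EFin \o g) by exact/measurable_EFinP.
have H3 : {ae mu, forall t, setT t -> (fun n => (f n t)%:E) n @[n --> \oo] --> (EFin \o g) t}.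
  by apply: aeW => t _; apply: cvg_EFin; [exact: nearW|exact: fg].
have H4 : {ae mu, forall t n, setT t -> (`|(f n t)%:E| <= (EFin \o h) t)%E}.
  by apply: aeW => t n _ /=; rewrite lee_fin.
have [lg _ cvgI] := dominated_convergence measurableT H1 H2 H3 lh H4.
rewrite -lee_fin -(L1_fineK lg) -(cvg_lim _ cvgI)//.
apply: lime_le; first by apply/cvg_ex; eexists; exact: cvgI.
apply: nearW => n /=; rewrite L1_fineK ?lee_fin//.
exact: L1_le (mf n) (fh n) lh.
Qed.

End integral_limits.

Lemma geometric_sum_le (R : realFieldType) (q : R) n : 0 <= q < 1 ->
  \sum_(k < n) q ^+ k <= (1 - q)^-1.
Proof.
move=> /andP[q0 q1]; have q1' : 0 < 1 - q by rewrite subr_gt0.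
rewrite -[leRHS]mul1r ler_pdivlMr//; have := subrX1 q n.
by have := exprn_ge0 n q0; lra.
Qed.

(** The moments are extended integrals, as in the theorem, and integrability of the powers is not
    assumed. It will come from the even powers, whose integrands are nonnegative; bounds on signed
    odd moments say nothing about [|X| ^ k] by themselves. *)
Record bernstein d (T : measurableType d) (R : realType) (P : probability T R)
    (X : T -> R) (eps v : R) : Prop := {
  bst_meas : measurable_fun setT X ;
  bst_eps : 0 < eps ;
  bst_mean : (\int[P]_t (X t)%:E = 0)%E ;
  bst_var : (\int[P]_t (X t ^+ 2)%:E = v%:E)%E ;
  bst_mom : forall k, (3 <= k)%N ->
    (`|\int[P]_t (X t ^+ k)%:E| <= (k`!%:R / 2 * eps ^+ (k - 2) * v)%:E)%E }.

Section bernstein_moments.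
Context d (T : measurableType d) (R : realType) (P : probability T R).
Variables (X : T -> R) (eps v : R).
Hypothesis B : bernstein P X eps v.

Let mX : measurable_fun setT X := bst_meas B.
Let e0 : 0 < eps := bst_eps B.

Let mXk k : measurable_fun setT (fun t => X t ^+ k).
Proof. exact: measurable_funX. Qed.

Lemma bernstein_var_ge0 : 0 <= v.
Proof.
by rewrite -lee_fin -(bst_var B); apply: integral_ge0 => t _; rewrite lee_fin sqr_ge0.
Qed.

Let v0 : 0 <= v := bernstein_var_ge0.

Lemma L1_prob_cst c : L1 P (fun=> c).
Proof. exact: finite_measure_integrable_cst. Qed.

Lemma Rint_prob_cst c : \int[P]_t c = c.
Proof. by rewrite Rintegral_cst//= (@probability_setT _ _ _ P)/= mulr1. Qed.

Let even_moment j : L1 P (fun t => X t ^+ (j.+1).*2) /\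
  \int[P]_t (X t ^+ (j.+1).*2) <= ((j.+1).*2)`!%:R / 2 * eps ^+ ((j.+1).*2 - 2) * v.
Proof.
set k := (j.+1).*2; set b := (X in _ <= X).
have X0 t : 0 <= X t ^+ k by rewrite exprn_even_ge0// /k odd_double.
have H : (\int[P]_t (X t ^+ k)%:E <= b%:E)%E.
  rewrite /b /k; case: (j) => [|i].
    by rewrite (bst_var B) lee_fin subnn expr0 mulr1 divff ?mul1r.
  by apply: le_trans (lee_abs _) _; apply: (bst_mom B); rewrite !doubleS.
have lk := ge0_L1 (mXk k) X0 H; split => //.
by rewrite -lee_fin -(L1_fineK lk).
Qed.

Lemma L1_abs_moment k : L1 P (fun t => `|X t| ^+ k).
Proof.
have [l _] := even_moment k.
have l1 := L1D (L1_prob_cst 1) l.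
apply: L1_le l1; first by apply: measurable_funX; exact: measurableT_comp.
move=> t; rewrite normrX normr_id.
have -> : X t ^+ (k.+1).*2 = `|X t| ^+ (k.+1).*2.
  by rewrite -normrX ger0_norm// exprn_even_ge0// odd_double.
have [x1|x1] := lerP `|X t| 1.
  by apply: (@le_trans _ _ 1); [exact: exprn_ile1|rewrite lerDl exprn_ge0].
apply: (@le_trans _ _ (`|X t| ^+ (k.+1).*2)); last by rewrite lerDr.
by rewrite ler_weXn2l// ?ltW//; rewrite -addnn; lia.
Qed.

(** An odd power [m + 1] lies between two even ones: [|X| ^ (m + 1) <= a / 2 * X ^ m + X ^ (m + 2) /
    (2 * a)]. The weight [a = (m + 1) * eps] balances the two bounds, and in all the factor [1 / 2]
    of Bernstein's condition is lost. *)
Lemma abs_moment_le k : (2 <= k)%N ->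
  \int[P]_t (`|X t| ^+ k) <= k`!%:R * eps ^+ (k - 2) * v.
Proof.
move=> k2; have [ek|ok] := boolP (odd k); last first.
  have kE : k = ((k./2).-1.+1).*2 by rewrite prednK ?even_halfK//; lia.
  have [_] := even_moment (k./2).-1; rewrite -kE => H.
  rewrite (eq_Rint _ (g := fun t => X t ^+ k)); last first.
    by move=> t; rewrite -normrX ger0_norm// exprn_even_ge0.
  apply: le_trans H _; rewrite ler_wpM2r// ler_wpM2r ?exprn_ge0 ?(ltW e0)//.
  by rewrite ler_pdivrMr// ler_peMr// ler1n.
have [j kE] : exists j, k = ((j.+1).*2).+1.
  exists (k./2).-1; have := odd_double_half k; rewrite ek; lia.
have [l1 H1] := even_moment j; have [l2 H2] := even_moment j.+1.
set m := (j.+1).*2 in kE l1 H1.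
have m2 : (2 <= m)%N by rewrite /m -addnn; lia.
have mE : (j.+2).*2 = m.+2 by rewrite /m !doubleS.
have om : ~~ odd m by rewrite /m odd_double.
rewrite mE in l2 H2; rewrite kE; clearbody m.
pose a := m.+1%:R * eps; have a0 : 0 < a by rewrite mulr_gt0.
have even_abs i t : ~~ odd i -> `|X t| ^+ i = X t ^+ i.
  by move=> oi; rewrite -normrX ger0_norm// exprn_even_ge0.
have Hp t : `|X t| ^+ m.+1 <= a / 2 * X t ^+ m + (2 * a)^-1 * X t ^+ m.+2.
  have om2 : ~~ odd m.+2 by rewrite /= negbK.
  rewrite -(even_abs m _ om) -(even_abs m.+2 _ om2).
  set y := `|X t|; have ym : 0 <= y ^+ m by rewrite exprn_ge0 // normr_ge0.
  have -> : a / 2 * y ^+ m + (2 * a)^-1 * y ^+ m.+2 =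
      (a / 2 + (2 * a)^-1 * y * y) * y ^+ m by rewrite !exprS; ring.
  rewrite exprS ler_wpM2r//.
  have -> : a / 2 + (2 * a)^-1 * y * y = y + (a - y) ^+ 2 / (2 * a).
    by field; rewrite gt_eqF.
  by rewrite lerDl; apply: divr_ge0 (sqr_ge0 _) (mulr_ge0 (ler0n _ 2) (ltW a0)).
apply: (le_trans (le_Rint (L1_abs_moment m.+1) (L1D (L1Z (a / 2) l1) (L1Z (2 * a)^-1 l2)) Hp)).
rewrite (RintegralD measurableT (L1Z (a / 2) l1) (L1Z (2 * a)^-1 l2)).
rewrite (RintegralZl _ measurableT l1) (RintegralZl _ measurableT l2).
have a20 : 0 <= a / 2 by rewrite divr_ge0// ltW.
have ia0 : 0 <= (2 * a)^-1.
  by rewrite invr_ge0; apply: mulr_ge0 (ler0n _ 2) (ltW a0).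
apply: (le_trans (lerD (ler_wpM2l a20 H1) (ler_wpM2l ia0 H2))).
rewrite (factS m.+1) (factS m) !natrM.
have -> : (m.+2 - 2 = (m - 2) + 2)%N by rewrite subnK// !subSS subn0.
have -> : (m.+1 - 2 = (m - 2) + 1)%N by rewrite addn1 subSn.
rewrite !exprD expr1; set F := (m`!)%:R; set E := eps ^+ (m - 2).
have -> : a / 2 * (F / 2 * E * v) + (2 * a)^-1 * (m.+2%:R * (m.+1%:R * F) / 2 * (E * eps ^+ 2) * v)
  = (m.+1%:R * F * E * eps * v) * (1 / 4 + m.+2%:R / (4 * m.+1%:R)).
  by rewrite /a; field; rewrite (gt_eqF e0) nat1r pnatr_eq0.
have -> : m.+1%:R * F * (E * eps) * v = m.+1%:R * F * E * eps * v by rewrite !mulrA.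
rewrite ler_piMr ?mulr_ge0 ?exprn_ge0 ?(ltW e0)//.
suff : m.+2%:R / (4 * m.+1%:R) <= 1 / 2 :> R by move: (m.+2%:R / (4 * m.+1%:R) : R) => z; lra.
rewrite ler_pdivrMr ?mulr_gt0// mulrA mul1r (_ : 2^-1 * 4 = 2); last by field.
by rewrite -natrM ler_nat; lia.
Qed.

Lemma L1_bernstein : L1 P X.
Proof.
apply: L1_le (L1_abs_moment 1) => // t; by rewrite expr1.
Qed.

Lemma Rint_bernstein : \int[P]_t X t = 0.
Proof. by rewrite /Rintegral (bst_mean B). Qed.

Lemma L1_bernstein_sqr : L1 P (fun t => X t ^+ 2).
Proof. by have [] := even_moment 0. Qed.

Lemma Rint_bernstein_sqr : \int[P]_t (X t ^+ 2) = v.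
Proof. by rewrite /Rintegral (bst_var B). Qed.

(** From [(E X^2)^2 <= E X^4 <= 12 * eps ^ 2 * v], where [12 = 4! / 2]; the first inequality is the
    nonnegativity of the variance of [X ^ 2]. *)
Lemma bernstein_var_le : v <= 12 * eps ^+ 2.
Proof.
have [l4 H4] := even_moment 1; rewrite /= in l4 H4.
have l2 := L1_bernstein_sqr.
have : 0 <= \int[P]_t (X t ^+ 4 + (- (2 * v) * X t ^+ 2 + v ^+ 2)).
  apply: Rintegral_ge0 => t _.
  have -> : X t ^+ 4 + (- (2 * v) * X t ^+ 2 + v ^+ 2) = (X t ^+ 2 - v) ^+ 2 by ring.
  exact: sqr_ge0.
have lc := L1_prob_cst (v ^+ 2).
have lz := L1Z (- (2 * v)) l2.
rewrite (RintegralD measurableT l4 (L1D lz lc)) (RintegralD measurableT lz lc).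
rewrite (RintegralZl _ measurableT l2) Rint_bernstein_sqr Rint_prob_cst => Hv.
have : v * v <= 12 * eps ^+ 2 * v.
  have : (4`!)%:R / 2 = 12 :> R by rewrite (_ : 4`! = 24)%N//; field.
  by move=> E; rewrite E in H4; nra.
have [v_gt0|] := ltP 0 v; first by rewrite ler_pM2r.
by move=> v_le0 _; rewrite (le_trans v_le0)// mulr_ge0// sqr_ge0.
Qed.

End bernstein_moments.

Lemma Rint_sum d (T : measurableType d) (R : realType)
    (mu : {measure set T -> \bar R}) (f : nat -> T -> R) n :
  (forall k, L1 mu (f k)) ->
  L1 mu (fun t => \sum_(k < n) f k t) /\
  \int[mu]_t (\sum_(k < n) f k t) = \sum_(k < n) \int[mu]_t f k t.
Proof.
move=> lf; elim: n => [|n [ln En]].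
  under [X in L1 _ X]eq_fun do rewrite big_ord0.
  under eq_Rintegral do rewrite big_ord0.
  by rewrite big_ord0 /Rintegral integral0; split => //; exact: integrable0.
under [X in L1 _ X]eq_fun do rewrite big_ord_recr/=.
under eq_Rintegral do rewrite big_ord_recr/=.
split; first exact: L1D.
by rewrite (RintegralD measurableT ln (lf n)) big_ord_recr/= En.
Qed.

(** * Exponential moments of one summand *)

Section exponential_moments.
Context d (T : measurableType d) (R : realType) (P : probability T R).
Variables (X : T -> R) (eps v lam : R).
Hypothesis B : bernstein P X eps v.
Hypothesis lam0 : 0 <= lam.
Let q := lam * eps.

Let mX : measurable_fun setT X := bst_meas B.
Let e0 : 0 < eps := bst_eps B.
Let v0 : 0 <= v := bernstein_var_ge0 B.
Let q0 : 0 <= q := mulr_ge0 lam0 (ltW e0).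
Let mZ : measurable_fun setT (fun t => `|X t|).
Proof. exact: measurableT_comp. Qed.

Let mexp (f : T -> R) : measurable_fun setT f ->
  measurable_fun setT (fun t => expR (lam * f t)).
Proof.
by move=> mf; apply: measurableT_comp => //; exact: measurable_funM.
Qed.

(** Monotone convergence along the exponential series reduces integrability and the bound to a
    numerical estimate on absolute moments. *)
Lemma abs_exp_moment j C : (forall n,
    \sum_(k < n) lam ^+ k / k`!%:R * \int[P]_t (`|X t| ^+ (k + j)) <= C) ->
  L1 P (fun t => `|X t| ^+ j * expR (lam * `|X t|)) /\
  \int[P]_t (`|X t| ^+ j * expR (lam * `|X t|)) <= C.
Proof.
move=> HC.
pose f n t := \sum_(k < n) lam ^+ k / k`!%:R * `|X t| ^+ (k + j).
have fE n t : f n t = `|X t| ^+ j * expT n (lam * `|X t|).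
  rewrite /f /expT mulr_sumr; apply: eq_bigr => k _.
  by rewrite exprD exprMn; ring.
have lk k : L1 P (fun t => lam ^+ k / k`!%:R * `|X t| ^+ (k + j)).
  exact: L1Z (L1_abs_moment B (k + j)).
apply: (@Rint_monotone_limit _ _ _ P f) => [n|n t|t|t||n].
- by have [] := Rint_sum n lk.
- by apply: sumr_ge0 => k _; rewrite mulr_ge0 ?divr_ge0 ?exprn_ge0.
- apply/nondecreasing_seqP => n; rewrite /f big_ord_recr/= lerDl.
  by rewrite mulr_ge0 ?divr_ge0 ?exprn_ge0.
- under eq_fun do rewrite fE; apply: cvgMl_tmp; exact: expT_cvg.
- by apply: measurable_funM; [exact: measurable_funX|exact: mexp].
- have [_ ->] := Rint_sum n lk; apply: le_trans (HC n).
  apply: ler_sum => k _.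
  by rewrite (RintegralZl _ measurableT (L1_abs_moment B (k + j))).
Qed.

Lemma L1_exp_abs : q < 1 -> L1 P (fun t => expR (lam * `|X t|)).
Proof.
move=> q1.
have [|l _] := @abs_exp_moment 0%N (1 + lam * \int[P]_t `|X t| +
    lam ^+ 2 * v * (1 - q)^-1).
  move=> n.
  have H k : 0 <= lam ^+ k / k`!%:R * \int[P]_t (`|X t| ^+ (k + 0)).
    apply: mulr_ge0; first by rewrite divr_ge0 ?exprn_ge0.
    by apply: Rintegral_ge0 => t _; exact: exprn_ge0.
  apply: (@le_trans _ _ (\sum_(k < n.+2) lam ^+ k / k`!%:R * \int[P]_t (`|X t| ^+ (k + 0)))).
    by rewrite 2!big_ord_recr/= -addrA lerDl addr_ge0.
  rewrite 2!big_ord_recl/= addrA lerD//.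
    rewrite /bump/= !addn0 expr0 fact0 divr1 mul1r lerD//.
      rewrite (eq_Rint _ (g := fun=> 1)); last by move=> t; rewrite expr0.
      by rewrite Rint_prob_cst.
    by rewrite expr1 factS fact0 muln1 divr1.
  apply: (@le_trans _ _ (lam ^+ 2 * v * \sum_(k < n) q ^+ k)); last first.
    rewrite ler_wpM2l ?mulr_ge0 ?exprn_ge0// geometric_sum_le//.
    by rewrite q0 q1.
  rewrite mulr_sumr; apply: ler_sum => k _.
  rewrite /bump/= !add1n addn0.
  have k2 : (2 <= k.+2)%N by [].
  have kf : 0 <= lam ^+ k.+2 / (k.+2)`!%:R by rewrite divr_ge0 ?exprn_ge0.
  apply: le_trans (ler_wpM2l kf (abs_moment_le B k2)) _.
  rewrite !subSS subn0 /q exprMn !exprS.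
  set F : R := ((k.+2)`!)%:R.
  have F0 : F != 0 by rewrite /F pnatr_eq0 -lt0n fact_gt0.
  by rewrite le_eqVlt; apply/orP; left; apply/eqP; field.
by apply: eq_L1 l => t; rewrite expr0 mul1r.
Qed.

(** [(k + 3)! <= 6 * 4 ^ k * k!] turns the series into a geometric one of ratio [4 * q <= 1 / 2],
    whose sum is at most 2. *)
Lemma abs3_exp_moment : q <= 8^-1 ->
  L1 P (fun t => `|X t| ^+ 3 * expR (lam * `|X t|)) /\
  \int[P]_t (`|X t| ^+ 3 * expR (lam * `|X t|)) <= 12 * eps * v.
Proof.
move=> q8; apply: abs_exp_moment => n.
apply: (@le_trans _ _ (6 * eps * v * \sum_(k < n) (4 * q) ^+ k)); last first.
  have -> : 12 * eps * v = 6 * eps * v * 2 by ring.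
  rewrite ler_wpM2l ?mulr_ge0 ?(ltW e0)//.
  have q4 : 0 <= 4 * q < 1.
    by apply/andP; split; [exact: mulr_ge0|move: q8; lra].
  apply: (le_trans (geometric_sum_le n q4)).
  rewrite -[leRHS]invrK lef_pV2 ?posrE ?invr_gt0//; move: q8; lra.
rewrite mulr_sumr; apply: ler_sum => k _.
have k2 : (2 <= k + 3)%N by rewrite addn3.
have kf : 0 <= lam ^+ k / k`!%:R by rewrite divr_ge0 ?exprn_ge0.
apply: le_trans (ler_wpM2l kf (abs_moment_le B k2)) _.
have -> : (k + 3 - 2 = k.+1)%N by rewrite addn3 !subSS subn0.
have fk : ((k + 3)`! <= 6 * 4 ^ k * k`!)%N.
  elim: (nat_of_ord k) => [//|i IH]; rewrite addSn factS expnS [i.+1`!]factS.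
  apply: (@leq_trans ((4 * i.+1) * (6 * 4 ^ i * i`!))%N); last by lia.
  by rewrite leq_mul// addn3; lia.
have -> : 6 * eps * v * (4 * q) ^+ k = lam ^+ k / k`!%:R *
    ((6 * 4 ^ k * k`!)%N%:R * eps ^+ k.+1 * v).
  rewrite !natrM natrX /q !exprMn exprS.
  have F0 : (k`!)%:R != 0 :> R by rewrite pnatr_eq0 -lt0n fact_gt0.
  by field.
rewrite ler_wpM2l// ler_wpM2r// ler_wpM2r ?exprn_ge0 ?(ltW e0)//.
by rewrite ler_nat.
Qed.

Lemma L1_mgf : q < 1 -> L1 P (fun t => expR (lam * X t)).
Proof.
move=> q1; apply: L1_le (L1_exp_abs q1); first exact: mexp.
by move=> t; rewrite ger0_norm ?expR_ge0// ler_expR ler_wpM2l// ler_norm.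
Qed.

Lemma mgf_ge1 : q < 1 -> 1 <= \int[P]_t expR (lam * X t).
Proof.
move=> q1; have lX := L1_bernstein B.
have l1 := L1D (L1_prob_cst P 1) (L1Z lam lX).
have <- : \int[P]_t (1 + lam * X t) = 1.
  rewrite (RintegralD measurableT (L1_prob_cst P 1) (L1Z lam lX)).
  by rewrite (RintegralZl _ measurableT lX) (Rint_bernstein B) mulr0 addr0 Rint_prob_cst.
by apply: le_Rint => //; [exact: L1_mgf|move=> t; exact: expR_ge1Dx].
Qed.

(** The Gaussian exponent requires the factor [1 / 2] that absolute moments lose. So the signed
    moments are summed, and [expR (lam * |X|)] dominates the partial sums to justify the passage to
    the limit. *)
Lemma mgf_le : q < 1 ->
  \int[P]_t expR (lam * X t) <= expR (lam ^+ 2 * v / (2 * (1 - q))).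
Proof.
move=> q1; apply: le_trans (expR_ge1Dx _).
pose f n t := \sum_(k < n) lam ^+ k / k`!%:R * X t ^+ k.
have fE n t : f n t = expT n (lam * X t).
  by rewrite /f /expT; apply: eq_bigr => k _; rewrite exprMn; ring.
have lXk k : L1 P (fun t => X t ^+ k).
  apply: L1_le (L1_abs_moment B k); first exact: measurable_funX.
  by move=> t; rewrite normrX.
have lk k : L1 P (fun t => lam ^+ k / k`!%:R * X t ^+ k) := L1Z _ (lXk k).
apply: (@Rint_dominated_limit_le _ _ _ P (fun n => f n.+2) _ _ _ _ _ (L1_exp_abs q1)).
- by move=> n; have [/L1_meas] := Rint_sum n.+2 lk.
- move=> n t; rewrite fE.
  have -> : lam * `|X t| = `|lam * X t| by rewrite normrM ger0_norm.
  apply: le_trans (expT_le_expR n.+2 (normr_ge0 _)).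
  apply: le_trans (ler_norm_sum _ _ _) _; apply: ler_sum => k _.
  by rewrite normrM normrX normfV normr_nat.
- move=> t; under eq_fun do rewrite fE.
  by have := @expT_cvg _ (lam * X t); rewrite -(cvg_shiftn 2); under eq_fun do rewrite addn2.
- exact: mexp.
move=> n; have [_ ->] := Rint_sum n.+2 lk.
rewrite 2!big_ord_recl/= /bump/=.
rewrite !(RintegralZl _ measurableT (lXk _)).
rewrite expr0 fact0 divr1 mul1r.
have -> : \int[P]_t (X t ^+ 0) = 1.
  by rewrite (eq_Rint _ (g := fun=> 1)) ?Rint_prob_cst// => t; rewrite expr0.
have -> : \int[P]_t (X t ^+ (1 + 0)) = 0.
  by rewrite -[RHS](Rint_bernstein B); apply: eq_Rint => t; rewrite expr1.
rewrite mulr0 add0r lerD2l.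
apply: (@le_trans _ _ (lam ^+ 2 * v / 2 * \sum_(k < n) q ^+ k)); last first.
  have -> : lam ^+ 2 * v / (2 * (1 - q)) = lam ^+ 2 * v / 2 * (1 - q)^-1.
    by rewrite invfM mulrA.
  rewrite ler_wpM2l ?divr_ge0 ?mulr_ge0 ?exprn_ge0// geometric_sum_le//.
  by rewrite q0 q1.
rewrite mulr_sumr; apply: ler_sum => k _; rewrite !add1n.
rewrite (RintegralZl _ measurableT (lXk _)).
have F0 : (k.+2`!)%:R != 0 :> R by rewrite pnatr_eq0 -lt0n fact_gt0.
have kf : 0 <= lam ^+ k.+2 / (k.+2)`!%:R by rewrite divr_ge0 ?exprn_ge0.
have H : \int[P]_t (X t ^+ k.+2) <= (k.+2)`!%:R / 2 * eps ^+ k * v.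
  case: (nat_of_ord k) => [|i].
    by rewrite (Rint_bernstein_sqr B) expr0 mulr1 divff// mul1r.
  have k3 : (3 <= i.+3)%N by [].
  have := bst_mom B k3; rewrite (L1_fineK (lXk _)) !subSS subn0 lee_fin.
  by apply: le_trans; exact: ler_norm.
apply: le_trans (ler_wpM2l kf H) _.
rewrite /q exprMn !exprS; set F : R := _%:R in F0 *.
by rewrite le_eqVlt; apply/orP; left; apply/eqP; field.
Qed.

End exponential_moments.

(** * The tilted law *)

Section tilted_law.
Context d (T : measurableType d) (R : realType) (P : probability T R).
Variables (X : T -> R) (eps v lam : R).

Definition mgf : R := \int[P]_t expR (lam * X t).
Definition tilt t : R := expR (lam * X t) / mgf.
Definition tilted_mean : R := \int[P]_t (tilt t * X t).
Definition tilted_var : R := \int[P]_t (tilt t * (X t - tilted_mean) ^+ 2).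

Hypothesis B : bernstein P X eps v.
Hypothesis lam0 : 0 <= lam.
Let q := lam * eps.
Hypothesis q64 : q <= 64^-1.

Let mX : measurable_fun setT X := bst_meas B.
Let e0 : 0 < eps := bst_eps B.
Let v0 : 0 <= v := bernstein_var_ge0 B.
Let q0 : 0 <= q := mulr_ge0 lam0 (ltW e0).
Let q1 : q < 1. Proof. by move: q64; lra. Qed.
Let q8 : q <= 8^-1. Proof. by move: q64; lra. Qed.
Let E t : R := expR (lam * X t).
Let Ea t : R := expR (lam * `|X t|).
Let mE : measurable_fun setT E.
Proof. by apply: measurableT_comp => //; exact: measurable_funM. Qed.
Let E_ge0 t : 0 <= E t. Proof. exact: expR_ge0. Qed.
Let E_le t : E t <= Ea t.
Proof. by rewrite ler_expR ler_wpM2l// ler_norm. Qed.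
Let lamX_abs t : `|lam * X t| = lam * `|X t|.
Proof. by rewrite normrM (ger0_norm lam0). Qed.
Let Ea_abs t : Ea t = expR `|lam * X t|.
Proof. by rewrite lamX_abs. Qed.

Let l3a : L1 P (fun t => `|X t| ^+ 3 * Ea t) := (abs3_exp_moment B lam0 q8).1.
Let E3a : \int[P]_t (`|X t| ^+ 3 * Ea t) <= 12 * eps * v :=
  (abs3_exp_moment B lam0 q8).2.

Let lXE j : (j <= 3)%N -> L1 P (fun t => `|X t| ^+ j * E t).
Proof.
move=> j3; apply: L1_le (L1D (L1_exp_abs B lam0 q1) l3a).
  apply: measurable_funM => //; apply: measurable_funX; exact: measurableT_comp.
move=> t; rewrite ger0_norm; last by rewrite mulr_ge0// exprn_ge0.
rewrite -[X in X + _]mul1r -mulrDl ler_pM ?exprn_ge0//.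
have [x1|x1] := lerP `|X t| 1.
  by apply: (@le_trans _ _ 1); [exact: exprn_ile1|rewrite lerDl exprn_ge0].
apply: (@le_trans _ _ (`|X t| ^+ 3)); last by rewrite lerDr.
by rewrite ler_weXn2l// ltW.
Qed.

Let lE : L1 P E := L1_mgf B lam0 q1.
Let l1 : L1 P (fun t => E t * X t).
Proof.
apply: L1_le (lXE (isT : (1 <= 3)%N)); first exact: measurable_funM.
by move=> t; rewrite normrM (ger0_norm (E_ge0 t)) expr1 mulrC.
Qed.
Let l2 : L1 P (fun t => E t * X t ^+ 2).
Proof.
apply: L1_le (lXE (isT : (2 <= 3)%N)).
  by apply: measurable_funM => //; exact: measurable_funX.
by move=> t; rewrite normrM normrX (ger0_norm (E_ge0 t)) mulrC.
Qed.
Let l3 : L1 P (fun t => E t * `|X t| ^+ 3).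
Proof. by apply: eq_L1 (lXE (leqnn 3)) => t; rewrite mulrC. Qed.

Let p1 := \int[P]_t (E t * X t).
Let p2 := \int[P]_t (E t * X t ^+ 2).
Let p3 := \int[P]_t (E t * `|X t| ^+ 3).

(** The Taylor remainder is [lam ^ 2 / 2 * |X| ^ 3 * expR (lam * |X|)], and [abs3_exp_moment]
    integrates it to [6 * q * (lam * v)]. The bound [p2_bd] uses one order less. *)
Let p1_bd : `|p1 - lam * v| <= 6 * q * (lam * v).
Proof.
have lX := L1_bernstein B; have lX2 := L1_bernstein_sqr B.
have lz := L1D lX (L1Z lam lX2).
have -> : lam * v = \int[P]_t (X t + lam * X t ^+ 2).
  rewrite (RintegralD measurableT lX (L1Z lam lX2)) (RintegralZl _ measurableT lX2).
  by rewrite (Rint_bernstein B) (Rint_bernstein_sqr B) add0r.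
rewrite -(RintegralB measurableT l1 lz).
apply: (@le_trans _ _ (\int[P]_t (lam ^+ 2 / 2 * (`|X t| ^+ 3 * Ea t)))).
  apply: normr_Rintegral_le (L1Z _ l3a); first exact: L1_meas (L1B l1 lz).
  move=> t.
  have -> : E t * X t - (X t + lam * X t ^+ 2) = X t * (E t - expT 2 (lam * X t)).
    by rewrite expT2; ring.
  rewrite normrM; apply: (le_trans (ler_wpM2l (normr_ge0 _) (expR_taylor 2 _))).
  rewrite -Ea_abs lamX_abs exprMn.
  by rewrite le_eqVlt; apply/orP; left; apply/eqP; rewrite (_ : 2`!%:R = 2)//; field.
rewrite (RintegralZl _ measurableT l3a).
have l20 : 0 <= lam ^+ 2 / 2 by rewrite divr_ge0// sqr_ge0.
apply: (le_trans (ler_wpM2l l20 E3a)).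
have -> : \int[P]_t (X t + lam * X t ^+ 2) = lam * v.
  rewrite (RintegralD measurableT lX (L1Z lam lX2)) (RintegralZl _ measurableT lX2).
  by rewrite (Rint_bernstein B) (Rint_bernstein_sqr B) add0r.
by rewrite le_eqVlt; apply/orP; left; apply/eqP; rewrite /q; field.
Qed.

Let p2_bd : `|p2 - v| <= 12 * q * v.
Proof.
have lX2 := L1_bernstein_sqr B.
rewrite -[X in _ - X](Rint_bernstein_sqr B) -(RintegralB measurableT l2 lX2).
apply: (@le_trans _ _ (\int[P]_t (lam * (`|X t| ^+ 3 * Ea t)))).
  apply: normr_Rintegral_le (L1Z _ l3a); first exact: L1_meas (L1B l2 lX2).
  move=> t.
  have -> : E t * X t ^+ 2 - X t ^+ 2 = X t ^+ 2 * (E t - expT 1 (lam * X t)).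
    by rewrite expT1; ring.
  rewrite normrM; apply: (le_trans (ler_wpM2l (normr_ge0 _) (expR_taylor 1 _))).
  rewrite -Ea_abs lamX_abs normrX.
  by rewrite le_eqVlt; apply/orP; left; apply/eqP; rewrite (_ : 1`!%:R = 1)//; field.
rewrite (RintegralZl _ measurableT l3a); apply: (le_trans (ler_wpM2l lam0 E3a)).
by rewrite le_eqVlt; apply/orP; left; apply/eqP; rewrite /q; ring.
Qed.

Let p3_bd : p3 <= 12 * eps * v.
Proof.
apply: le_trans E3a; apply: le_Rint => // t.
by rewrite mulrC ler_wpM2l ?exprn_ge0.
Qed.

Let lv2 : lam ^+ 2 * v <= 12 * q ^+ 2.
Proof.
have := ler_wpM2l (sqr_ge0 lam) (bernstein_var_le B).
by rewrite /q exprMn; lra.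
Qed.

Let M1 : 1 <= mgf := mgf_ge1 B lam0 q1.
Let M0 : 0 < mgf := lt_le_trans ltr01 M1.
(** The exponent in [mgf_le] is of order [q ^ 2] by [lv2], hence at most [q / 10] here; then
    [expR y <= 1 / (1 - y)]. *)
Let Mq : mgf <= 1 + q.
Proof.
have := mgf_le B lam0 q1; rewrite -/q -/mgf.
set y := lam ^+ 2 * v / _.
have y10 : y <= q / 10.
  rewrite /y ler_pdivrMr; last by move: q1; lra.
  apply: (le_trans lv2); move: q0 q64; nra.
have := expR_ge1Dx (- y); rewrite expRN.
have ey := expR_gt0 y; set z := expR y in ey *.
move=> h1 h2; apply: (le_trans h2).
have : (1 - y) * z <= 1.
  by have := ler_wpM2r (ltW ey) h1; rewrite mulVf ?gt_eqF.
have hq : 0 <= (q / 10 - y) * z by rewrite mulr_ge0 ?(ltW ey)// subr_ge0.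
move: q0 q64 => ? ? h3; have : (1 - q / 10) * z <= 1 by lra.
have q10 : 0 < 1 - q / 10 by lra.
rewrite mulrC -ler_pdivlMr// => /le_trans; apply.
by rewrite ler_pdivrMr//; nra.
Qed.

Let rescale (f : T -> R) : L1 P (fun t => E t * f t) ->
  L1 P (fun t => tilt t * f t) /\
  \int[P]_t (tilt t * f t) = (\int[P]_t (E t * f t)) / mgf.
Proof.
move=> l; have C t : mgf^-1 * (E t * f t) = tilt t * f t.
  by rewrite /tilt -/(E t) mulrA [_^-1 * _]mulrC.
split; first exact: eq_L1 C (L1Z mgf^-1 l).
by rewrite [RHS]mulrC -(RintegralZl _ measurableT l); apply: eq_Rint => t; rewrite C.
Qed.

Let m := tilted_mean.
Let s := tilted_var.

Let mE1 : m = p1 / mgf. Proof. exact: (rescale l1).2. Qed.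

Lemma tilted_mean_ge0 : 0 <= tilted_mean.
Proof.
rewrite -/m mE1 divr_ge0 ?(ltW M0)//.
have lv : 0 <= lam * v by rewrite mulr_ge0.
have := p1_bd; rewrite ler_norml => /andP[+ _].
have : 6 * q * (lam * v) <= 1 * (lam * v) by rewrite ler_wpM2r//; move: q64; lra.
lra.
Qed.

Lemma tilted_mean_le : tilted_mean <= lam * v * (1 + 6 * q).
Proof.
have m0 := tilted_mean_ge0.
have := p1_bd; rewrite ler_norml => /andP[_ h].
suff : m <= p1 by rewrite -/m; lra.
have -> : p1 = m * mgf by rewrite mE1 divfK// gt_eqF.
by rewrite ler_peMr.
Qed.

Let m_le : m <= 2 * (lam * v).
Proof.
apply: (le_trans tilted_mean_le); rewrite [leRHS]mulrC ler_wpM2l ?mulr_ge0//.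
by move: q64; lra.
Qed.

Let m2_le : m ^+ 2 <= 6 * q * v.
Proof.
have m0 : 0 <= m := tilted_mean_ge0.
have lv : 0 <= lam * v by rewrite mulr_ge0.
have h : m ^+ 2 <= (2 * (lam * v)) ^+ 2 by rewrite lerXn2r// nnegrE// mulr_ge0.
apply: (le_trans h).
have -> : (2 * (lam * v)) ^+ 2 = 4 * (lam ^+ 2 * v) * v by ring.
rewrite ler_wpM2r//; apply: le_trans (ler_wpM2l (ler0n _ 4) lv2) _.
by move: q0 q64; nra.
Qed.

Let tl0 : L1 P tilt /\ \int[P]_t tilt t = 1.
Proof.
have l : L1 P (fun t => E t * 1) by apply: eq_L1 lE => t; rewrite mulr1.
have [k e] := rescale l; split; first by apply: eq_L1 k => t; rewrite mulr1.
rewrite (eq_Rint _ (g := fun t => tilt t * 1)); last by move=> t; rewrite mulr1.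
rewrite e (eq_Rint _ (g := E)); last by move=> t; rewrite mulr1.
by rewrite divff// gt_eqF.
Qed.

Let tl1 := rescale l1.
Let tl2 := rescale l2.
Let tl3 := rescale l3.

Let tilt_ge0 t : 0 <= tilt t. Proof. by rewrite divr_ge0// ltW. Qed.

Let lvar : L1 P (fun t => tilt t * (X t - m) ^+ 2) /\ s = p2 / mgf - m ^+ 2.
Proof.
have C t : tilt t * X t ^+ 2 + (- (2 * m) * (tilt t * X t) + m ^+ 2 * tilt t) =
    tilt t * (X t - m) ^+ 2 by ring.
have lz := L1D (L1Z (- (2 * m)) tl1.1) (L1Z (m ^+ 2) tl0.1).
have lq := L1D tl2.1 lz; split; first exact: eq_L1 C lq.
have -> : s = \int[P]_t (tilt t * X t ^+ 2 +
    (- (2 * m) * (tilt t * X t) + m ^+ 2 * tilt t)).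
  by apply: eq_Rint => t; rewrite C.
rewrite (RintegralD measurableT tl2.1 lz).
rewrite (RintegralD measurableT (L1Z (- (2 * m)) tl1.1) (L1Z (m ^+ 2) tl0.1)).
rewrite (RintegralZl _ measurableT tl1.1) (RintegralZl _ measurableT tl0.1).
rewrite tl0.2 tl2.2 -/p2 -/tilted_mean -/m; ring.
Qed.

(** The 19 is made of 12 from [p2_bd], 1 from dividing by [mgf <= 1 + q], and 6 from the squared
    mean. *)
Lemma tilted_var_ge : v * (1 - 19 * q) <= tilted_var.
Proof.
rewrite -/s lvar.2.
have := p2_bd; rewrite ler_norml => /andP[h _].
have : v * (1 - 13 * q) <= p2 / mgf.
  rewrite ler_pdivlMr//.
  have h1 : v * (1 - 13 * q) * mgf <= v * (1 - 13 * q) * (1 + q).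
    by rewrite ler_wpM2l// mulr_ge0//; move: q64; lra.
  apply: (le_trans h1).
  have : 0 <= v * q ^+ 2 by rewrite mulr_ge0// sqr_ge0.
  lra.
by move: m2_le; lra.
Qed.

Let s_half : v <= 2 * s.
Proof.
have := tilted_var_ge; rewrite -/s.
have : 0 <= v * (64^-1 - q) by rewrite mulr_ge0// subr_ge0.
have : 0 <= v * q by rewrite mulr_ge0.
lra.
Qed.

Lemma tilted_var_ge0 : 0 <= tilted_var.
Proof. by move: s_half v0; rewrite /s; lra. Qed.

(** Far from sharp: Berry-Esseen takes one [b] for both the standard deviations and the third
    moments, and the latter dictate 104. *)
Lemma tilted_var_le : tilted_var <= (104 * eps) ^+ 2.
Proof.
rewrite -/s lvar.2.
have := p2_bd; rewrite ler_norml => /andP[_ h].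
have p20 : 0 <= p2 by apply: Rintegral_ge0 => t _; rewrite mulr_ge0// sqr_ge0.
have h1 : p2 / mgf <= p2 by rewrite ler_pdivrMr// ler_peMr.
have h2 : 0 <= v * (64^-1 - q) by rewrite mulr_ge0// subr_ge0.
have := bernstein_var_le B; have := sqr_ge0 m; have := sqr_ge0 eps; rewrite exprMn.
lra.
Qed.

(** By [(x + m) ^ 3 <= 4 * (x ^ 3 + m ^ 3)] with bounds [12 * eps * v] and [eps * v] for the two
    parts, one gets [52 * eps * v]; the passage from [v] to the tilted variance doubles it. *)
Let lthird : L1 P (fun t => tilt t * `|X t - m| ^+ 3) /\
  \int[P]_t (tilt t * `|X t - m| ^+ 3) <= 104 * eps * s.
Proof.
have m0 : 0 <= m := tilted_mean_ge0.
have C t : `|tilt t * `|X t - m| ^+ 3| <=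
    4 * (tilt t * `|X t| ^+ 3) + (4 * m ^+ 3) * tilt t.
  have -> : 4 * (tilt t * `|X t| ^+ 3) + 4 * m ^+ 3 * tilt t =
     tilt t * (4 * (`|X t| ^+ 3 + m ^+ 3)) by ring.
  rewrite normrM (ger0_norm (tilt_ge0 t)) ler_wpM2l// normrX normr_id.
  have h : `|X t - m| <= `|X t| + m by rewrite (le_trans (ler_normB _ _))// (ger0_norm m0).
  have x0 := normr_ge0 (X t); set x := `|X t| in h x0 *.
  apply: (@le_trans _ _ ((x + m) ^+ 3)).
    by rewrite lerXn2r// nnegrE// addr_ge0.
  have : 0 <= (x + m) * (x - m) ^+ 2 by apply: mulr_ge0 (addr_ge0 x0 m0) (sqr_ge0 _).
  lra.
have mt : measurable_fun setT (fun t => tilt t * `|X t - m| ^+ 3).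
  apply: measurable_funM; first exact: L1_meas tl0.1.
  apply: measurable_funX; apply: measurableT_comp => //; exact: measurable_funB.
have lz := L1D (L1Z 4 tl3.1) (L1Z (4 * m ^+ 3) tl0.1).
have l := L1_le mt C lz; split => //.
apply: le_trans (le_Rint l lz (fun t => le_trans (ler_norm _) (C t))) _.
rewrite (RintegralD measurableT (L1Z 4 tl3.1) (L1Z (4 * m ^+ 3) tl0.1)).
rewrite (RintegralZl _ measurableT tl3.1) (RintegralZl _ measurableT tl0.1).
rewrite tl0.2 tl3.2 -/p3 mulr1.
have p30 : 0 <= p3 by apply: Rintegral_ge0 => t _; rewrite mulr_ge0// exprn_ge0.
have h1 : p3 / mgf <= 12 * eps * v.
  by apply: le_trans p3_bd; rewrite ler_pdivrMr// ler_peMr.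
have h2 : m ^+ 3 <= eps * v.
  have me : m <= eps.
    apply: (le_trans m_le).
    have := ler_wpM2l lam0 (bernstein_var_le B).
    have : 0 <= eps * (64^-1 - q) by rewrite mulr_ge0 ?(ltW e0)// subr_ge0.
    by move: e0; rewrite /q; lra.
  rewrite exprS ler_pM ?sqr_ge0//; apply: (le_trans m2_le).
  have : 0 <= v * (64^-1 - q) by rewrite mulr_ge0// subr_ge0.
  by move: v0; lra.
have := ler_wpM2l (ltW e0) s_half.
lra.
Qed.

Lemma tilted_weighted_law :
  weighted_law P tilt (fun t => X t - tilted_mean) tilted_var (104 * eps * tilted_var).
Proof.
have lc : L1 P (fun t => tilt t * (X t - m)).
  by apply: eq_L1 (L1B tl1.1 (L1Z m tl0.1)) => t; ring.
split.
- exact: L1_meas tl0.1.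
- exact: measurable_funB.
- exact: tilt_ge0.
- exact: tl0.1.
- exact: tl0.2.
- exact: lc.
- rewrite (eq_Rint _ (g := fun t => tilt t * X t - m * tilt t));
    last by move=> t; rewrite -/m; ring.
  rewrite (RintegralB measurableT tl1.1 (L1Z m tl0.1)) (RintegralZl _ measurableT tl0.1).
  by rewrite tl0.2 mulr1 subrr.
- exact: lvar.1.
- by [].
- exact: lthird.1.
- exact: lthird.2.
Qed.

End tilted_law.

Lemma measure_rectangles_unique d1 d2 (T1 : measurableType d1)
    (T2 : measurableType d2) (R : realType)
    (m m' : {measure set (T1 * T2) -> \bar R}) : (m setT < +oo)%E ->
  (forall A C, measurable A -> measurable C -> m (A `*` C) = m' (A `*` C)) ->
  forall Z, measurable Z -> m Z = m' Z.
Proof.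
move=> mfin E Z mZ.
pose G : set (set (T1 * T2)) :=
  [set D | exists A, measurable A /\ exists C, measurable C /\ D = A `*` C].
apply: (measure_unique G (fun=> setT)) => //.
- rewrite measurable_prod_measurableType //; congr (<<s _ >>).
  rewrite predeqE; split => [[A mA [C mC <-]]|[A [mA [C [mC ->]]]]].
    by exists A; split => //; exists C.
  by exists A => //; exists C.
- move=> _ _ [X1 [mX1 [X2 [mX2 ->]]]] [Y1 [mY1 [Y2 [mY2 ->]]]].
  rewrite -setXI; exists (X1 `&` Y1); split; first exact: measurableI.
  by exists (X2 `&` Y2); split => //; exact: measurableI.
- by move=> _; exists setT; split => //; exists setT; rewrite setXTT.
- by rewrite bigcup_const//; exists 0%N.
- by move=> _ [A [mA [C [mC ->]]]]; exact: E.
Qed.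

(** * Sums of independent variables *)

Section independent_pair.
Context d (T : measurableType d) (R : realType) (P : probability T R).
Implicit Types (U V : T -> R).

Definition indep_pair U V := forall A C : set R, measurable A -> measurable C ->
  P (U @^-1` A `&` V @^-1` C) = (P (U @^-1` A) * P (V @^-1` C))%E.

(** Independence says that the joint law of [(U, V)] and the product of the marginals agree on
    rectangles, hence everywhere; then Tonelli. *)
Lemma indep_integral U V (h : R * R -> \bar R) : measurable_fun setT U ->
  measurable_fun setT V -> indep_pair U V -> measurable_fun setT h ->
  (forall z, 0 <= h z)%E ->
  (\int[P]_t h (U t, V t) = \int[P]_t \int[P]_u h (U u, V t))%E.
Proof.
move=> mU mV UV mh h0.
have mUV : measurable_fun setT (fun t => (U t, V t)).
  exact: measurable_fun_pair.
pose Um : {mfun T >-> R} := HB.pack U (isMeasurableFun.Build _ _ _ _ U mU).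
pose Vm : {mfun T >-> R} := HB.pack V (isMeasurableFun.Build _ _ _ _ V mV).
pose LU : probability R R := distribution P Um.
pose LV : probability R R := distribution P Vm.
pose LUV : {measure set (R * R) -> \bar R} :=
  measure_function_pushforward__canonical__measure_function_Measure P mUV.
have prodE Z : measurable Z -> (LU \x LV)%E Z = LUV Z.
  apply: product_measure_unique => A C mA mC.
  exact: UV.
have mLU y : measurable_fun setT (fun x => h (x, y)).
  exact: measurableT_comp.
transitivity (\int[LUV]_z h z)%E.
  by rewrite ge0_integral_pushforward// => z _.
transitivity (\int[(LU \x LV)%E]_z h z)%E.
  by apply: eq_measure_integral => Z mZ _; apply/esym; exact: prodE.
rewrite fubini_tonelli2//.
rewrite /fubini_G ge0_integral_pushforward//; last 2 first.
- exact: measurable_fun_fubini_tonelli_G.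
- by move=> y _; apply: integral_ge0.
apply: eq_integral => t _ /=.
by rewrite ge0_integral_pushforward// => z _.
Qed.

End independent_pair.

Section independent_sequence.
Context d (T : measurableType d) (R : realType) (P : probability T R).
Variables (n : nat) (X : nat -> T -> R).
Hypothesis mX : forall k, measurable_fun setT (X k).
Hypothesis indX : forall A : nat -> set R, (forall k, measurable (A k)) ->
  P (\bigcap_(i in `I_n) (X i @^-1` A i)) = (\prod_(i < n) P (X i @^-1` A i))%E.

Definition psum (k : nat) (t : T) : R := \sum_(i < k) X i t.

Lemma measurable_psum k : measurable_fun setT (psum k).
Proof. exact: measurable_sum. Qed.

Let mpre (f : T -> R) (A : set R) : measurable_fun setT f -> measurable A ->
  measurable (f @^-1` A).
Proof. by move=> mf mA; rewrite -[X in measurable X]setTI; exact: mf. Qed.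

Let tail k (A : nat -> set R) : set T :=
  \bigcap_(i in [set i | (k <= i < n)%N]) (X i @^-1` A i).

Let mtail k (A : nat -> set R) : (forall i, measurable (A i)) ->
  measurable (tail k A).
Proof.
by move=> mA; apply: bigcap_measurableType => i _; exact: mpre.
Qed.

Let tailS k A : (k < n)%N -> tail k A = X k @^-1` A k `&` tail k.+1 A.
Proof.
move=> kn; apply/seteqP; split => t /=.
  move=> H; split; first by apply: (H k); rewrite /= leqnn.
  by move=> i /= /andP[ki inn]; apply: H; rewrite /= (ltnW ki).
move=> [H1 H2] i /= /andP[]; rewrite leq_eqVlt => /predU1P[<-//|ki inn].
by apply: H2; rewrite /= ki.
Qed.

Let PE k (A : nat -> set R) : (k <= n)%N -> (forall i, measurable (A i)) ->
  P (tail k A) = (\prod_(k <= i < n) P (X i @^-1` A i))%E.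
Proof.
move=> kn mA.
pose A' i := if (i < k)%N then setT else A i.
have mA' i : measurable (A' i) by rewrite /A'; case: ifP.
have -> : tail k A = \bigcap_(i in `I_n) (X i @^-1` A' i).
  apply/seteqP; split => t /= H i /=.
    by move=> inn; rewrite /A'; case: ltnP => //= ki; apply: H; rewrite /= ki.
  by move=> /andP[ki inn]; have := H i inn; rewrite /A' ltnNge ki.
rewrite indX// -(big_mkord xpredT (fun i => P (X i @^-1` A' i))).
rewrite (@big_cat_nat _ _ _ k)//= big_nat big1 ?mul1e.
  by apply: eq_big_nat => i /andP[ki _]; rewrite /A' ltnNge ki.
by move=> i /andP[_ ik]; rewrite /A' ik preimage_setT probability_setT.
Qed.

Let tail_split k (B2 : set R) C : (k < n)%N -> measurable B2 ->
  (forall i, measurable (C i)) ->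
  P (X k @^-1` B2 `&` tail k.+1 C) = (P (X k @^-1` B2) * P (tail k.+1 C))%E.
Proof.
move=> kn mB2 mC.
pose C' i := if i == k then B2 else C i.
have mC' i : measurable (C' i) by rewrite /C'; case: ifP.
have C'C i : (k.+1 <= i)%N -> C' i = C i.
  by move=> ki; rewrite /C' ifF//; apply/negbTE; rewrite neq_ltn ki orbT.
have tE : tail k.+1 C' = tail k.+1 C.
  by apply: eq_bigcapr => i /= /andP[ki _]; rewrite C'C.
have C'k : C' k = B2 by rewrite /C' eqxx.
have := tailS C' kn; rewrite tE C'k => <-.
rewrite (PE (ltnW kn) mC') big_ltn// C'k -(PE kn mC'); congr (_ * P _)%E.
exact: tE.
Qed.

Let tail_setT k : tail k (fun=> setT) = setT.
Proof. by apply/seteqP; split => // t _ i _. Qed.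

Let pair_of_tail k : (k < n)%N ->
  (forall (A : set R) (C : nat -> set R), measurable A -> (forall i, measurable (C i)) ->
   P (psum k @^-1` A `&` tail k C) = (P (psum k @^-1` A) * P (tail k C))%E) ->
  indep_pair P (psum k) (X k).
Proof.
move=> kn IH B1 B2 mB1 mB2.
pose C' i := if i == k then B2 else setT.
have mC' i : measurable (C' i) by rewrite /C'; case: ifP.
have tE : tail k C' = X k @^-1` B2.
  rewrite tailS// {1}/C' eqxx (_ : tail k.+1 C' = setT) ?setIT//.
  rewrite -(tail_setT k.+1).
  apply: eq_bigcapr => i /= /andP[ki _]; rewrite /C' ifF//.
  by apply/negbTE; rewrite neq_ltn ki orbT.
by have := IH B1 C' mB1 mC'; rewrite tE.
Qed.

(** The induction has to carry all the remaining variables, not just the next one. For an event [D]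
    about the variables after [k], the measures [Z -> P (f in Z, D)] and [Z -> P D * P (f in Z)],
    with [f = (psum k, X k)], agree on rectangles, hence on the set where the sum of the coordinates
    lies in [A]. *)
Let psum_tail k : (k <= n)%N -> forall (A : set R) (C : nat -> set R),
  measurable A -> (forall i, measurable (C i)) ->
  P (psum k @^-1` A `&` tail k C) = (P (psum k @^-1` A) * P (tail k C))%E.
Proof.
elim: k => [_|k IH kn] A C mA mC.
  have [A0|A0] := pselect (A 0).
    have -> : psum 0 @^-1` A = setT.
      by apply/seteqP; split => // t _ /=; rewrite /psum big_ord0.
    by rewrite setTI probability_setT mul1e.
  have -> : psum 0 @^-1` A = set0.
    by apply/seteqP; split => // t /=; rewrite /psum big_ord0.
  by rewrite set0I measure0 mul0e.
have kn' := ltnW kn.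
set D := tail k.+1 C.
have mD : measurable D by exact: mtail.
have PDE : P D = (fine (P D))%:E by rewrite fineK// fin_num_measure.
pose f t := (psum k t, X k t).
have mf : measurable_fun setT f by apply: measurable_fun_pair => //; exact: measurable_psum.
have rectD (B1 B2 : set R) : measurable B1 -> measurable B2 ->
    P (psum k @^-1` B1 `&` X k @^-1` B2 `&` D) =
    (P (psum k @^-1` B1) * P (X k @^-1` B2) * P D)%E.
  move=> mB1 mB2.
  pose C' i := if i == k then B2 else C i.
  have mC' i : measurable (C' i) by rewrite /C'; case: ifP.
  have tE : tail k C' = X k @^-1` B2 `&` D.
    rewrite tailS// /C' eqxx; congr (_ `&` _).
    apply: eq_bigcapr => i /= /andP[ki _]; rewrite ifF//.
    by apply/negbTE; rewrite neq_ltn ki orbT.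
  have := IH kn' B1 C' mB1 mC'; rewrite tE setIA => ->.
  by rewrite tail_split// muleA.
have rectT := pair_of_tail kn (IH kn').
have D0 : 0 <= fine (P D) by rewrite fine_ge0.
pose m1 : {measure set (R * R) -> \bar R} :=
  measure_function_pushforward__canonical__measure_function_Measure
    (measure_function_mrestr__canonical__measure_function_Measure P mD) mf.
pose m2 : {measure set (R * R) -> \bar R} :=
  mscale (NngNum D0)
    (measure_function_pushforward__canonical__measure_function_Measure P mf).
have mZ : measurable [set z : R * R | A (z.1 + z.2)].
  rewrite -[X in measurable X]setTI.
  by apply: (measurable_funD (measurable_fst) (measurable_snd)).
have m1E Z : m1 Z = P (f @^-1` Z `&` D) by [].
have m2E Z : m2 Z = (P D * P (f @^-1` Z))%E by rewrite {1}PDE.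
have m1fin : (m1 setT < +oo)%E.
  by rewrite m1E preimage_setT setTI ltey_eq fin_num_measure.
have m12 (B1 B2 : set R) : measurable B1 -> measurable B2 ->
    m1 (B1 `*` B2) = m2 (B1 `*` B2).
  move=> mB1 mB2; rewrite m1E m2E muleC.
  transitivity (P (psum k @^-1` B1 `&` X k @^-1` B2) * P D)%E => //.
  by rewrite rectT//; exact: rectD.
have := measure_rectangles_unique m1fin m12 mZ.
rewrite m1E m2E [RHS]muleC.
suff -> : psum k.+1 @^-1` A = f @^-1` [set z | A (z.1 + z.2)] by [].
by apply/seteqP; split => t; rewrite /= /psum big_ord_recr.
Qed.

Lemma psum_indep k : (k < n)%N -> indep_pair P (psum k) (X k).
Proof. by move=> kn; apply: pair_of_tail => //; exact/psum_tail/ltnW. Qed.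

End independent_sequence.

(** * Exponential weights against distribution functions *)

Section exponential_weight.
Context (R : realType).
Variable lam : R.
Hypothesis lam0 : 0 < lam.

Let ed := exponential_pdf lam.

Let med : measurable_fun setT ed.
Proof. exact: measurable_exponential_pdf. Qed.

Let ed0 w : 0 <= ed w. Proof. by apply: exponential_pdf_ge0; exact: ltW. Qed.

Lemma L1_exponential_pdf : L1 leb (exponential_pdf lam).
Proof.
apply: (@ge0_L1 _ _ _ lebesgue_measure _ 1) => //.
by rewrite integral_exponential_pdf.
Qed.

Lemma Rint_exponential_pdf : \int[leb]_w exponential_pdf lam w = 1.
Proof. by rewrite /Rintegral integral_exponential_pdf. Qed.

Lemma Rint_exponential_tail u : 0 <= u ->
  \int[leb]_w (exponential_pdf lam w * heaviside (w - u)) = expR (- lam * u).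
Proof.
move=> u0.
have mh : measurable_fun setT (fun w : R => ed w * heaviside (w - u)).
  apply: measurable_funM => //; apply: (measurableT_comp (@measurable_heaviside R)).
  exact: measurable_funB.
rewrite (Rint_affine u (oner_neq0 R) mh); last first.
  by move=> w; rewrite mulr_ge0//; case/andP: (heaviside01 (w - u)).
rewrite normr1 mul1r.
transitivity (expR (- lam * u) * \int[leb]_w exponential_pdf lam w); last first.
  by rewrite Rint_exponential_pdf mulr1.
rewrite -(RintegralZl (expR (- lam * u)) measurableT L1_exponential_pdf).
apply: eq_Rint => w; rewrite mul1r addrK /heaviside /ed.
have [w0|w0] := lerP 0 w; last by rewrite mulr0 lt0_exponential_pdf ?mulr0.
rewrite mulr1 !exponential_pdfE ?addr_ge0// mulrCA -expRD.
by congr (_ * expR _); ring.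
Qed.

(* Integration by parts against the exponential density. *)
Lemma exponential_layers d (T : measurableType d)
    (mu : {sigma_finite_measure set T -> \bar R}) (W S : T -> R) a :
  measurable_fun setT S -> (forall t, 0 <= W t) -> L1 mu W ->
  \int[mu]_t (W t * (expR (- lam * (S t - a)) * (1 - heaviside (a - S t)))) =
  \int[leb]_w (ed w * (\int[mu]_t (W t * heaviside (a + w - S t)) -
    \int[mu]_t (W t * heaviside (a - S t)))).
Proof.
move=> mS W0 lW; have mW := L1_meas lW.
have mhS (b : R) : measurable_fun setT (fun t => heaviside (b - S t)).
  apply: (measurableT_comp (@measurable_heaviside R)); exact: measurable_funB.
have lh b : L1 mu (fun t => W t * heaviside (b - S t)).
  have := L1_bdd_mul (mhS b) (fun t => norm_heaviside (b - S t)) lW.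
  by apply: eq_L1 => t; rewrite mulrC.
have ldiff w : L1 mu (fun t => W t * heaviside (a + w - S t) - W t * heaviside (a - S t)).
  exact: L1B.
have hm (x y : R) : x <= y -> heaviside x <= heaviside y.
  by case: (cdf_like_heaviside R) => + _; apply.
(* For fixed [t], the integral over [w] is the exponential mass of [w >= S t - a] if [S t > a], and
   0 otherwise. Monotonicity of [heaviside] makes the kernel nonnegative, as Tonelli requires. *)
pose K t w := ed w * (heaviside (a + w - S t) - heaviside (a - S t)).
have K0 t w : 0 <= K t w.
  rewrite /K; have [w0|w0] := lerP 0 w; last first.
    by rewrite /ed lt0_exponential_pdf// mul0r.
  by rewrite mulr_ge0// subr_ge0 hm// lerD2r lerDl.
have KE t w : K t w = ed w * heaviside (a + w - S t) - ed w * heaviside (a - S t).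
  by rewrite /K mulrBr.
have m1 (b : R) : measurable_fun setT (fun w : R => heaviside (a + w - b)).
  apply: (measurableT_comp (@measurable_heaviside R)); apply: measurable_funB => //.
  exact: measurable_funD.
have le1 b : L1 leb (fun w => ed w * heaviside (a + w - b)).
  have := L1_bdd_mul (mu := lebesgue_measure) (m1 b)
    (fun w => norm_heaviside (a + w - b)) L1_exponential_pdf.
  by apply: eq_L1 => w; rewrite mulrC.
have le2 b : L1 leb (fun w => ed w * b).
  by apply: (eq_L1 (mu := lebesgue_measure) _ (L1Z b L1_exponential_pdf)) => w; rewrite mulrC.
have lK t : L1 leb (K t).
  apply: (eq_L1 (mu := lebesgue_measure) _ (L1B (le1 (S t)) (le2 (heaviside (a - S t))))) => w.
  by rewrite KE.
have inner t : \int[leb]_w K t w =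
    expR (- lam * (S t - a)) * (1 - heaviside (a - S t)).
  have [aS|Sa] := ltP a (S t).
    have -> : heaviside (a - S t) = 0 by rewrite /heaviside subr_ge0 leNgt aS.
    have Sa0 : 0 <= S t - a by rewrite subr_ge0 ltW.
    rewrite subr0 mulr1 -(Rint_exponential_tail Sa0).
    apply: eq_Rint => w; rewrite /K.
    have -> : heaviside (a - S t) = 0 by rewrite /heaviside subr_ge0 leNgt aS.
    by rewrite subr0; congr (_ * heaviside _); ring.
  have -> : heaviside (a - S t) = 1 by rewrite /heaviside subr_ge0 Sa.
  rewrite subrr mulr0 (eq_Rint _ (g := fun=> 0)); last first.
    move=> w; rewrite /K.
    have -> : heaviside (a - S t) = 1 by rewrite /heaviside subr_ge0 Sa.
    have [w0|w0] := lerP 0 w; last by rewrite /ed lt0_exponential_pdf// mul0r.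
    have -> : heaviside (a + w - S t) = 1.
      by rewrite /heaviside addrAC addr_ge0// subr_ge0.
    by rewrite subrr mulr0.
  by rewrite /Rintegral integral0.
transitivity (\int[mu]_t \int[leb]_w (W t * K t w)).
  by apply: eq_Rint => t; rewrite (RintegralZl (W t) measurableT (lK t)) inner.
rewrite Rint_Tonelli.
- apply: eq_Rint => w.
  rewrite -(RintegralB measurableT (lh (a + w)) (lh a)).
  rewrite -(RintegralZl (ed w) measurableT (ldiff w)).
  by apply: eq_Rint => t; rewrite /K; ring.
- apply: measurable_funM.
    by apply: (measurableT_comp mW); exact: measurable_fst.
  apply: measurable_funM.
    by apply: (measurableT_comp med); exact: measurable_snd.
  apply: measurable_funB.
    apply: (measurableT_comp (@measurable_heaviside R)); apply: measurable_funB.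
      by apply: measurable_funD => //; exact: measurable_snd.
    by apply: (measurableT_comp mS); exact: measurable_fst.
  apply: (measurableT_comp (mhS a)); exact: measurable_fst.
- by move=> t w; rewrite mulr_ge0.
- by move=> t; exact: L1Z.
- move=> w; apply: eq_L1 (L1Z (ed w) (ldiff w)) => t.
  by rewrite /K; ring.
Qed.

(** In the layer formula the distribution functions enter only through their increments from [a] to
    [a + w], each off by at most [2 * De]. As the exponential density has mass 1, the error does not
    depend on [lam]. *)
Lemma exponential_comparison d d' (T : measurableType d) (T' : measurableType d')
    (mu : {sigma_finite_measure set T -> \bar R})
    (mu' : {sigma_finite_measure set T' -> \bar R}) (W S : T -> R) (W' S' : T' -> R) a De :
  measurable_fun setT S -> (forall t, 0 <= W t) -> L1 mu W ->
  measurable_fun setT S' -> (forall t, 0 <= W' t) -> L1 mu' W' ->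
  (forall w, `|\int[mu]_t (W t * heaviside (w - S t)) -
    \int[mu']_t (W' t * heaviside (w - S' t))| <= De) ->
  \int[mu]_t (W t * (expR (- lam * (S t - a)) * (1 - heaviside (a - S t)))) <=
  \int[mu']_t (W' t * (expR (- lam * (S' t - a)) * (1 - heaviside (a - S' t)))) + 2 * De.
Proof.
move=> mS W0 lW mS' W'0 lW' H.
rewrite !exponential_layers//.
pose G w := \int[mu]_t (W t * heaviside (w - S t)).
pose G' w := \int[mu']_t (W' t * heaviside (w - S' t)).
have lG d1 (T1 : measurableType d1) (m : {sigma_finite_measure set T1 -> \bar R})
    (V U : T1 -> R) b : measurable_fun setT U -> (forall t, 0 <= V t) -> L1 m V ->
    L1 leb (fun w => ed w * (\int[m]_t (V t * heaviside (a + w - U t)) - b)).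
  move=> mU V0 lV.
  have mhU (x : R) : measurable_fun setT (fun t => heaviside (x - U t)).
    apply: (measurableT_comp (@measurable_heaviside R)); exact: measurable_funB.
  have lh x : L1 m (fun t => V t * heaviside (x - U t)).
    have := L1_bdd_mul (mhU x) (fun t => norm_heaviside (x - U t)) lV.
    by apply: eq_L1 => t; rewrite mulrC.
  pose g w := \int[m]_t (V t * heaviside (a + w - U t)).
  have mg : measurable_fun setT g.
    apply: nondecreasing_measurable => // x y xy; apply: le_Rint => // t.
    rewrite ler_wpM2l//; case: (cdf_like_heaviside R) => + _; apply.
    by rewrite lerD2r lerD2l.
  have gb w : `|g w - b| <= \int[m]_t V t + `|b|.
    apply: (le_trans (ler_normB _ _)); rewrite lerD2r ger0_norm; last first.
      by apply: Rintegral_ge0 => t _; rewrite mulr_ge0//; case/andP: (heaviside01 (a + w - U t)).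
    apply: le_Rint => // t; rewrite ler_piMr//.
    by case/andP: (heaviside01 (a + w - U t)).
  have mgb : measurable_fun setT (fun w => g w - b) by exact: measurable_funB.
  have := L1_bdd_mul (mu := lebesgue_measure) mgb gb L1_exponential_pdf.
  by apply: eq_L1 => w; rewrite mulrC.
have l1 := lG _ _ _ _ _ (G a) mS W0 lW.
have l2 := lG _ _ _ _ _ (G' a) mS' W'0 lW'.
have l3 := L1Z (2 * De) L1_exponential_pdf.
have -> : 2 * De = \int[leb]_w (2 * De * exponential_pdf lam w).
  by rewrite (RintegralZl _ measurableT L1_exponential_pdf) Rint_exponential_pdf mulr1.
rewrite -(RintegralD measurableT l2 l3).
apply: le_Rint => //; first exact: L1D.
move=> w; rewrite -/ed [2 * De * _]mulrC -mulrDr ler_wpM2l//.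
change (G (a + w) - G a <= G' (a + w) - G' a + 2 * De).
have Ha : `|G a - G' a| <= De := H a.
have Hw : `|G (a + w) - G' (a + w)| <= De := H (a + w).
move: Ha Hw; rewrite !ler_norml.
by move: (G a) (G' a) (G (a + w)) (G' (a + w)) => *; lra.
Qed.

End exponential_weight.

Definition mills (R : realType) (t : R) : R := expR (t ^+ 2 / 2) * (1 - Phi t).

Section gaussian_tilt.
Context (R : realType).
Implicit Types (s w a lam : R).

Lemma Rint_heaviside_gd s w x : 0 < s ->
  \int[@lebesgue_measure R]_u (heaviside (w + u) * gd s (x - u)) = Nd s (x + w).
Proof.
move=> s0; have := conv_translate s x (- w) (@measurable_heaviside R).
rewrite opprK /Nd => <-; last by move=> u; case/andP: (heaviside01 u).
by apply: eq_Rint => u; rewrite (addrC w).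
Qed.

(** Completing the square: the weight moves the mean of the Gaussian by [m = lam * s ^ 2], leaving a
    plain tail beyond [a / s + lam * s]. *)
Lemma gaussian_exponential_tail s lam a : 0 < s ->
  \int[@lebesgue_measure R]_u (gd s (0 - u) *
    (expR (- lam * (- u - a)) * (1 - heaviside (a - - u)))) =
  expR (- (a / s) ^+ 2 / 2) * mills (a / s + lam * s).
Proof.
move=> s0; set m := lam * s ^+ 2.
set c := expR (lam * a + lam ^+ 2 * s ^+ 2 / 2).
have E u : gd s (0 - u) * (expR (- lam * (- u - a)) * (1 - heaviside (a - - u))) =
    c * (gd s (m - u) - heaviside (a + u) * gd s (m - u)).
  rewrite opprK !gdE// mulrA.
  have -> : normal_peak 1 / s * expR (- ((0 - u) / s) ^+ 2 / 2) *
      expR (- lam * (- u - a)) =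
      c * (normal_peak 1 / s * expR (- ((m - u) / s) ^+ 2 / 2)).
    rewrite -mulrA -expRD mulrCA -expRD; congr (_ * expR _).
    by rewrite /m; field; rewrite gt_eqF.
  by ring.
have l1 := L1_gd m s0.
have l2 : L1 leb (fun u => heaviside (a + u) * gd s (m - u)).
  apply: (L1_bdd_mul (mu := lebesgue_measure) _ (fun u => norm_heaviside (a + u)) l1).
  apply: (measurableT_comp (@measurable_heaviside R)); exact: measurable_funD.
have l3 := L1B l1 l2.
transitivity (\int[@lebesgue_measure R]_u
    (c * (gd s (m - u) - heaviside (a + u) * gd s (m - u)))).
  by apply: eq_Rint => u; exact: E.
rewrite (RintegralZl c measurableT l3) (RintegralB measurableT l1 l2).
rewrite Rint_gd// Rint_heaviside_gd// NdE//.
have -> : (m + a) / s = a / s + lam * s by rewrite /m; field; rewrite gt_eqF.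
rewrite /mills mulrA -expRD; congr (expR _ * _).
by field; rewrite gt_eqF.
Qed.

End gaussian_tilt.

(** * The sum under the tilted law *)

Section tilted_sums.
Context d (T : measurableType d) (R : realType) (P : probability T R).
Variables (n : nat) (X : nat -> T -> R) (eps lam : R) (v : nat -> R).
Hypothesis B : forall k, bernstein P (X k) eps (v k).
Hypothesis indX : forall A : nat -> set R, (forall k, measurable (A k)) ->
  P (\bigcap_(i in `I_n) (X i @^-1` A i)) = (\prod_(i < n) P (X i @^-1` A i))%E.
Hypothesis lam0 : 0 <= lam.
Hypothesis q1 : lam * eps < 1.

Let mX k : measurable_fun setT (X k) := bst_meas (B k).

Definition prod_mgf k : R := \prod_(i < k) mgf P (X i) lam.
Definition sum_mean k : R := \sum_(i < k) tilted_mean P (X i) lam.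
Definition sum_tilt k t : R := expR (lam * psum X k t) / prod_mgf k.
Definition tilted_cdf k w : R :=
  \int[P]_t (sum_tilt k t * heaviside (w - (psum X k t - sum_mean k))).

Let mgf0 k : 0 < mgf P (X k) lam.
Proof. exact: lt_le_trans ltr01 (mgf_ge1 (B k) lam0 q1). Qed.

Let prod_mgf0 k : 0 < prod_mgf k.
Proof. by apply: prodr_gt0. Qed.

Let mpsum k : measurable_fun setT (psum X k).
Proof. exact: measurable_psum. Qed.

Let tilt_ge0 k t : 0 <= sum_tilt k t.
Proof. by rewrite divr_ge0 ?expR_ge0// ltW. Qed.

Let mtilt k : measurable_fun setT (sum_tilt k).
Proof.
apply: measurable_funM => //; apply: measurableT_comp => //.
exact: measurable_funM.
Qed.

Let tilt_step k t : sum_tilt k.+1 t = sum_tilt k t * tilt P (X k) lam t.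
Proof.
rewrite /sum_tilt /tilt /psum /prod_mgf !big_ord_recr/= mulrDr expRD.
by rewrite mulf_div.
Qed.

Lemma sum_tilt_mass k : (k <= n)%N ->
  L1 P (sum_tilt k) /\ \int[P]_t sum_tilt k t = 1.
Proof.
elim: k => [_|k IH kn].
  have E t : 1 = sum_tilt 0 t.
    by rewrite /sum_tilt /psum /prod_mgf !big_ord0 mulr0 expR0 divr1.
  split; first exact: eq_L1 E (L1_prob_cst P 1).
  by rewrite -(eq_Rint _ E) Rint_prob_cst.
have [lk ek] := IH (ltnW kn).
have ind := psum_indep mX indX kn.
have lt : L1 P (tilt P (X k) lam).
  by apply: eq_L1 (L1Z (mgf P (X k) lam)^-1 (L1_mgf (B k) lam0 q1)) => t; rewrite mulrC.
pose h (z : R * R) : \bar R :=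
  (expR (lam * z.1) / prod_mgf k * (expR (lam * z.2) / mgf P (X k) lam))%:E.
have mh : measurable_fun setT h.
  apply/measurable_EFinP; apply: measurable_funM; apply: measurable_funM => //;
    apply: measurableT_comp => //; exact: measurable_funM.
have h0 z : (0 <= h z)%E.
  by rewrite lee_fin !mulr_ge0 ?expR_ge0 ?invr_ge0 ?(ltW (mgf0 _)) ?(ltW (prod_mgf0 _)).
have := indep_integral (mpsum k) (mX k) ind mh h0.
rewrite /h/=.
have Ein t : (\int[P]_u ((expR (lam * psum X k u) / prod_mgf k) *
     (expR (lam * X k t) / mgf P (X k) lam))%:E = (tilt P (X k) lam t)%:E)%E.
  have l := L1Z (tilt P (X k) lam t) lk.
  transitivity (\int[P]_u (tilt P (X k) lam t * sum_tilt k u)%:E)%E.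
    by apply: eq_integral => u _; rewrite mulrC.
  by rewrite (L1_fineK l) (RintegralZl _ measurableT lk) ek mulr1.
rewrite (eq_integral _ _ (fun t _ => Ein t)).
have -> : (\int[P]_t (tilt P (X k) lam t)%:E = 1%:E)%E.
  rewrite (L1_fineK lt); congr (_%:E).
  rewrite /tilt -[RHS](divff (lt0r_neq0 (mgf0 k))) [RHS]mulrC.
  rewrite -(RintegralZl _ measurableT (L1_mgf (B k) lam0 q1)).
  by apply: eq_Rint => t; rewrite mulrC.
move=> H.
have H' : (\int[P]_t (sum_tilt k.+1 t)%:E = 1%:E)%E.
  by rewrite -H; apply: eq_integral => t _; rewrite tilt_step.
have H1 : (\int[P]_t (sum_tilt k.+1 t)%:E <= 1%:E)%E by rewrite H'.
have l := ge0_L1 (mtilt k.+1) (tilt_ge0 k.+1) H1.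
by split => //; rewrite /Rintegral H'.
Qed.

Lemma tilted_cdf0 : tilted_cdf 0 = @heaviside R.
Proof.
apply/funext => w; rewrite /tilted_cdf.
transitivity (\int[P]_t heaviside w); last exact: Rint_prob_cst.
apply: eq_Rint => t; rewrite /sum_tilt /psum /prod_mgf /sum_mean !big_ord0.
by rewrite mulr0 expR0 divr1 mul1r !subr0.
Qed.

(** The tilt of a sum is the product of the tilts, so independence survives it and the first [k]
    variables can be integrated out. This is the recursion that the Berry-Esseen section expects. *)
Lemma tilted_cdfS k : (k < n)%N -> tilted_cdf k.+1 =
  wstep P (tilt P (X k) lam) (fun t => X k t - tilted_mean P (X k) lam) (tilted_cdf k).
Proof.
move=> kn; apply/funext => w; rewrite /tilted_cdf /wstep.
have [lk ek] := sum_tilt_mass (ltnW kn).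
have ind := psum_indep mX indX kn.
pose mk := tilted_mean P (X k) lam.
pose h (z : R * R) : \bar R := (expR (lam * z.1) / prod_mgf k *
  (expR (lam * z.2) / mgf P (X k) lam) *
  heaviside (w - (z.2 - mk) - (z.1 - sum_mean k)))%:E.
have mh : measurable_fun setT h.
  apply/measurable_EFinP; apply: measurable_funM.
    apply: measurable_funM; apply: measurable_funM => //;
    apply: measurableT_comp => //; exact: measurable_funM.
  apply: (measurableT_comp (@measurable_heaviside R)); apply: measurable_funB.
    by apply: measurable_funB => //; apply: measurable_funB.
  exact: measurable_funB.
have hv0 z : 0 <= heaviside z :> R by case/andP: (heaviside01 z).
have h0 z : (0 <= h z)%E.
  rewrite lee_fin mulr_ge0// !mulr_ge0 ?expR_ge0 ?invr_ge0 ?(ltW (mgf0 _))//.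
  exact: ltW.
have := indep_integral (mpsum k) (mX k) ind mh h0.
rewrite /h/= => H; rewrite /Rintegral; congr fine.
transitivity (\int[P]_t (expR (lam * psum X k t) / prod_mgf k *
    (expR (lam * X k t) / mgf P (X k) lam) *
    heaviside (w - (X k t - mk) - (psum X k t - sum_mean k)))%:E)%E.
  apply: eq_integral => t _; congr (_%:E); rewrite tilt_step; congr (_ * heaviside _).
  by rewrite /psum /sum_mean !big_ord_recr/= -/mk; ring.
rewrite H; apply: eq_integral => t _.
have mH : measurable_fun setT (fun u =>
    heaviside (w - (X k t - mk) - (psum X k u - sum_mean k))).
  apply: (measurableT_comp (@measurable_heaviside R)); apply: measurable_funB => //.
  exact: measurable_funB.
have l : L1 P (fun u => sum_tilt k u *
    heaviside (w - (X k t - mk) - (psum X k u - sum_mean k))).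
  have := L1_bdd_mul mH (fun u => norm_heaviside _) lk.
  by apply: eq_L1 => u; rewrite mulrC.
rewrite -(RintegralZl (tilt P (X k) lam t) measurableT l).
rewrite -(L1_fineK (L1Z (tilt P (X k) lam t) l)).
by apply: eq_integral => u _; congr (_%:E); rewrite /sum_tilt /tilt -/mk; ring.
Qed.

Hypothesis q64 : lam * eps <= 64^-1.

Definition sum_var : R := \sum_(i < n) tilted_var P (X i) lam.
Let s := Num.sqrt sum_var.
Let b := 104 * eps.

Lemma tilted_cdf_normal w : (0 < n)%N -> 0 < sum_var ->
  `|tilted_cdf n w - Nd s w| <= 196 * bergstromC R * b / s.
Proof.
move=> n0 sv; have e0 : 0 < eps := bst_eps (B 0).
have b0 : 0 < b by rewrite mulr_gt0.
apply: (@berry_esseen _ _ _ P n b (fun k => tilt P (X k) lam)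
  (fun k t => X k t - tilted_mean P (X k) lam)
  (fun k => tilted_var P (X k) lam) tilted_cdf b0) => //.
- by move=> k; apply: (tilted_var_ge0 (B k)).
- by move=> k; apply: (tilted_var_le (B k)).
- by move=> k _; apply: (tilted_weighted_law (B k)).
- exact: tilted_cdf0.
- by move=> k kn; exact: tilted_cdfS.
Qed.

(** Undoing the tilt: the three exponentials cancel pointwise, and [1 - heaviside (a - psum X n t)]
    is the indicator of the event. *)
Lemma probability_gt a : (P [set t | (a < psum X n t)%R] =
  (prod_mgf n * expR (- lam * a) *
   \int[P]_t (sum_tilt n t * (expR (- lam * (psum X n t - a)) *
     (1 - heaviside (a - psum X n t)))))%:E)%E.
Proof.
set A := [set t | _].
have mA : measurable A.
  rewrite -[X in measurable X]setTI /A.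
  have -> : [set t | (a < psum X n t)%R] = psum X n @^-1` `]a, +oo[.
    by apply/seteqP; split => t /=; rewrite in_itv/= andbT.
  exact: (mpsum n).
have lA : L1 P (\1_A) by exact: integrable_indic.
have -> : P A = (\int[P]_t \1_A t)%:E.
  by rewrite -(L1_fineK lA) integral_indic// setIT.
congr (_%:E).
set c := prod_mgf n * _.
pose g t := sum_tilt n t * (expR (- lam * (psum X n t - a)) * (1 - heaviside (a - psum X n t))).
have E t : c * g t = \1_A t.
  have tA : (t \in A) = ~~ (psum X n t <= a).
    by rewrite -ltNge; apply/idP/idP; rewrite /A inE.
  rewrite /c /g /sum_tilt indicE tA /heaviside subr_ge0.
  have -> : prod_mgf n * expR (- lam * a) * (expR (lam * psum X n t) / prod_mgf n *
     (expR (- lam * (psum X n t - a)) * (1 - (psum X n t <= a)%R%:R))) =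
     expR (- lam * a) * expR (lam * psum X n t) * expR (- lam * (psum X n t - a)) *
     (1 - (psum X n t <= a)%R%:R).
    by field; rewrite gt_eqF.
  rewrite -!expRD (_ : _ + _ + _ = 0); last by ring.
  by rewrite expR0 mul1r; case: (psum X n t <= a)%R; rewrite ?subrr ?subr0.
have c0 : c != 0 by rewrite gt_eqF// mulr_gt0// expR_gt0.
have lg : L1 P g.
  by apply: eq_L1 (L1Z c^-1 lA) => t; rewrite -E mulKf.
by rewrite -(RintegralZl c measurableT lg); apply: eq_Rint => t; rewrite E.
Qed.

Lemma chernoff_sum a : (P [set t | (a < psum X n t)%R] <=
  (prod_mgf n * expR (- lam * a))%:E)%E.
Proof.
have [l e] := sum_tilt_mass (leqnn n).
rewrite probability_gt lee_fin -[leRHS]mulr1 ler_wpM2l//.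
  by rewrite mulr_ge0 ?expR_ge0// ltW.
rewrite -[leRHS]e; have K01 t : 0 <= expR (- lam * (psum X n t - a)) *
    (1 - heaviside (a - psum X n t)) <= 1.
  rewrite /heaviside subr_ge0; case: (lerP (psum X n t) a) => h.
    by rewrite subrr mulr0 lexx ler01.
  rewrite subr0 mulr1 expR_ge0/=.
  by rewrite -[leRHS]expR0 ler_expR mulNr oppr_le0 mulr_ge0// subr_ge0 ltW.
apply: le_Rint => //; last first.
  by move=> t; rewrite ler_piMr//; case/andP: (K01 t).
have mK : measurable_fun setT (fun t => expR (- lam * (psum X n t - a)) *
    (1 - heaviside (a - psum X n t))).
  apply: measurable_funM.
    apply: measurableT_comp => //; apply: measurable_funM => //; exact: measurable_funB.
  apply: measurable_funB => //; apply: (measurableT_comp (@measurable_heaviside R)).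
  exact: measurable_funB.
have Kn t : `|expR (- lam * (psum X n t - a)) * (1 - heaviside (a - psum X n t))| <= 1.
  by case/andP: (K01 t) => k0 k1; rewrite ger0_norm.
by apply: eq_L1 (L1_bdd_mul mK Kn l) => t; rewrite mulrC.
Qed.

(** The tilted sum, centred at its mean, is replaced by a Gaussian of the same variance. The factor
    [expR (- (a' / s) ^+ 2 / 2)] which then appears is bounded by 1. *)
Lemma tail_bound a : (0 < n)%N -> 0 < sum_var ->
  (P [set t | (a < psum X n t)%R] <= (prod_mgf n * expR (- lam * a) *
    (mills ((a - sum_mean n) / s + lam * s) + 2 * (196 * bergstromC R * b / s)))%:E)%E.
Proof.
move=> n0 sv; have s0 : 0 < s by rewrite sqrtr_gt0.
set De := 196 * bergstromC R * b / s.
have H w : `|tilted_cdf n w - Nd s w| <= De by exact: tilted_cdf_normal.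
have De0 : 0 <= De by apply: le_trans (H 0).
set a' := a - sum_mean n.
have [lW eW] := sum_tilt_mass (leqnn n).
rewrite probability_gt lee_fin ler_wpM2l//.
  by rewrite mulr_ge0 ?expR_ge0// ltW.
pose S t := psum X n t - sum_mean n.
have mS : measurable_fun setT S by exact: measurable_funB.
have SE t : psum X n t - a = S t - a' by rewrite /S /a'; ring.
have SE' t : a - psum X n t = a' - S t by rewrite /S /a'; ring.
have -> : \int[P]_t (sum_tilt n t * (expR (- lam * (psum X n t - a)) *
     (1 - heaviside (a - psum X n t)))) =
   \int[P]_t (sum_tilt n t * (expR (- lam * (S t - a')) * (1 - heaviside (a' - S t)))).
  by apply: eq_Rint => t; rewrite SE SE'.
have gm : expR (- (a' / s) ^+ 2 / 2) * mills (a' / s + lam * s) <= mills (a' / s + lam * s).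
  rewrite ler_piMl//.
    rewrite /mills mulr_ge0 ?expR_ge0// subr_ge0.
    have := Nd01 ((a' / s + lam * s) * s) s0; rewrite NdE// mulfK ?gt_eqF//.
    by case/andP.
  by rewrite -[leRHS]expR0 ler_expR mulNr oppr_le0 divr_ge0// sqr_ge0.
(* There is no exponential density of rate 0; without a tilt, Berry-Esseen applies directly to the
   tail. *)
have := lam0; rewrite le_eqVlt => /predU1P[lamE|lam_gt0].
  have := H a'; rewrite NdE// ler_norml => /andP[h _].
  have -> : \int[P]_t (sum_tilt n t * (expR (- lam * (S t - a')) * (1 - heaviside (a' - S t)))) =
      1 - tilted_cdf n a'.
    transitivity (\int[P]_t sum_tilt n t - tilted_cdf n a'); last by rewrite eW.
    have mh : measurable_fun setT (fun t => heaviside (a' - S t)).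
      apply: (measurableT_comp (@measurable_heaviside R)); exact: measurable_funB.
    have lh : L1 P (fun t => sum_tilt n t * heaviside (a' - S t)).
      have := L1_bdd_mul mh (fun t => norm_heaviside _) lW.
      by apply: eq_L1 => t; rewrite mulrC.
    rewrite -(RintegralB measurableT lW lh).
    by apply: eq_Rint => t; rewrite -lamE oppr0 mul0r expR0 mul1r mulrBr mulr1.
  apply: le_trans (lerD gm (lexx _)).
  rewrite -lamE mul0r addr0 /mills mulrA -expRD.
  by rewrite mulNr addNr expR0 mul1r; lra.
pose S' (u : R) : R := - u.
have mS' : measurable_fun setT S' by exact: measurable_funN.
have := @exponential_comparison R lam lam_gt0 _ _ _ _ P lebesgue_measure
   (sum_tilt n) S (fun u => gd s (0 - u)) S' a' De mS (tilt_ge0 n) lW mS'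
   (fun u => gd_ge0 s (0 - u)) (L1_gd 0 s0).
move=> cmp; apply: (le_trans (cmp _)).
  move=> w; have := H w; congr (`|_ - _| <= _).
  rewrite -[w in Nd s w]add0r -(Rint_heaviside_gd w 0 s0).
  by apply: eq_Rint => u; rewrite /S' opprK mulrC.
rewrite lerD2r; apply: le_trans gm; rewrite -(gaussian_exponential_tail lam a' s0).
exact: lexx.
Qed.

End tilted_sums.

(** * The Mills ratio *)

Section mills_ratio.
Context (R : realType).
Implicit Types (t u w : R).

Let mk t u : R := expR (t * u) * (1 - heaviside u).

Let mk01 t u : 0 <= t -> 0 <= mk t u <= 1.
Proof.
move=> t0; rewrite /mk /heaviside; have [u0|u0] := lerP 0 u.
  by rewrite subrr mulr0 lexx ler01.
rewrite subr0 mulr1 expR_ge0/= -expR0 ler_expR.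
by rewrite mulr_ge0_le0// ltW.
Qed.

Let measurable_mk t : measurable_fun setT (mk t).
Proof.
apply: measurable_funM.
  by apply: measurableT_comp => //; exact: measurable_funM.
by apply: measurable_funB => //; exact: measurable_heaviside.
Qed.

Let L1_mk t : 0 <= t -> L1 leb (fun u => mk t u * gd 1 (0 - u)).
Proof.
move=> t0; apply: (L1_bdd_mul (mu := lebesgue_measure) (measurable_mk t)
  (c := 1) _ (L1_gd 0 ltr01)) => u.
by case/andP: (mk01 u t0) => ? ?; rewrite ger0_norm.
Qed.

(** The case of unit variance and threshold 0 above exhibits [mills] as the Laplace transform of
    half a Gaussian, so that its bounds can be proved on the integrand. *)
Let millsE t : mills t = \int[@lebesgue_measure R]_u (mk t u * gd 1 (0 - u)).
Proof.
have := gaussian_exponential_tail t 0 (@ltr01 R).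
rewrite mul0r expr0n oppr0 mul0r expR0 mul1r add0r mulr1 => <-.
apply: eq_Rint => u; rewrite mulrC /mk.
by congr (expR _ * (1 - heaviside _) * _); ring.
Qed.

Definition mills_lower : R := normal_peak 1 * expR (- 2).

Lemma mills_lower_gt0 : 0 < mills_lower.
Proof. by rewrite mulr_gt0 ?expR_gt0// normal_peak_gt0 ?oner_neq0. Qed.

(** Keep only [u] in [[- 1 / (1 + t), 0[]: there [t * u >= - 1] and [u ^ 2 <= 1], so the integrand
    stays above [mills_lower]. *)
Lemma mills_ge t : 0 <= t -> mills_lower <= mills t * (1 + t).
Proof.
move=> t0; have t1 : 0 < 1 + t by rewrite ltr_wpDr.
rewrite -ler_pdivrMr// millsE.
pose I : set (measurableTypeR R) := `[- (1 + t)^-1, 0[%classic.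
have it0 : 0 < (1 + t)^-1 by rewrite invr_gt0.
have lI : L1 leb (\1_I) by exact: integrable_indic_itv.
have -> : mills_lower / (1 + t) = \int[@lebesgue_measure R]_u (mills_lower * \1_I u).
  rewrite (RintegralZl _ measurableT lI); congr (_ * _).
  rewrite /Rintegral integral_indic//; last exact: measurable_itv.
  by rewrite (setIT I)/= /I lebesgue_measure_itv/= lte_fin oppr_lt0 it0/= ?add0r ?opprK.
apply: le_Rint => //; [exact: L1Z|exact: L1_mk|move=> u].
have [uI|uI] := boolP (u \in I); last first.
  rewrite indicE (negbTE uI) mulr0 mulr_ge0 ?gd_ge0//.
  by case/andP: (mk01 u t0).
rewrite indicE uI mulr1; move: uI; rewrite /I mem_setE in_itv/= => /andP[u1 u0].
rewrite /mk /heaviside (leNgt 0 u) u0 subr0 mulr1 gdE// !divr1 sub0r sqrrN.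
rewrite /mills_lower mulrCA ler_wpM2l ?normal_peak_ge0// -expRD ler_expR.
have h1 : - 1 <= t * u.
  have : - t / (1 + t) <= t * u by rewrite mulNr -mulrN ler_wpM2l.
  apply: le_trans; rewrite mulNr lerN2 ler_pdivrMr// mul1r lerDr//.
have it1 : (1 + t)^-1 <= 1 by rewrite invf_le1// lerDl.
have : u ^+ 2 <= 1.
  rewrite -sqrrN expr_le1//; last by rewrite oppr_ge0 ltW.
  by rewrite lerNl; apply: le_trans u1; rewrite lerN2.
lra.
Qed.

Lemma mills_le t t0 : 0 <= t0 -> t0 <= t -> mills t <= mills t0.
Proof.
move=> t00 t0t; rewrite !millsE; apply: le_Rint.
- by apply: L1_mk; exact: le_trans t0t.
- exact: L1_mk.
move=> u; rewrite ler_wpM2r ?gd_ge0// /mk /heaviside.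
have [u0|u0] := lerP 0 u; first by rewrite subrr !mulr0.
by rewrite subr0 !mulr1 ler_expR ler_wnM2r// ltW.
Qed.

(** The derivative of [mills] is of order [(1 + t) ^ -2]. With [y = - u] and [rho = 1 + t], the
    integrand of the difference is at most [expR 1 * (t0 - t) * y * expR (- rho * y)]; spending half
    of the exponential on the factor [y] leaves a multiple of the density of rate [rho / 2]. *)
Lemma mills_increment t t0 : 0 <= t -> t <= t0 ->
  mills t <= mills t0 + 4 * expR 1 * (t0 - t) / (1 + t) ^+ 2.
Proof.
move=> tge0 tt0; have t00 := le_trans tge0 tt0.
set rho := 1 + t; have rho0 : 0 < rho by rewrite /rho ltr_wpDr.
have r2 : 0 < rho / 2 by rewrite divr_gt0.
pose e u := exponential_pdf (rho / 2) (-1 * u + 0).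
have me0 w : 0 <= exponential_pdf (rho / 2) w.
  by apply: exponential_pdf_ge0; exact: ltW.
have n1 : (-1 : R) != 0 by rewrite oppr_eq0 oner_neq0.
have le : L1 leb e := L1_affine 0 n1 me0 (L1_exponential_pdf r2).
have ie : \int[@lebesgue_measure R]_u e u = 1.
  rewrite -(Rint_exponential_pdf r2).
  by rewrite (Rint_affine 0 n1 (measurable_exponential_pdf (rho / 2)) me0) normrN1 mul1r.
set c := 4 * expR 1 * (t0 - t) / rho ^+ 2.
have c0 : 0 <= c by rewrite divr_ge0 ?sqr_ge0// !mulr_ge0 ?expR_ge0// subr_ge0.
have -> : c = \int[@lebesgue_measure R]_u (c * e u).
  by rewrite (RintegralZl _ measurableT le) ie mulr1.
rewrite !millsE -(RintegralD measurableT (L1_mk t00) (L1Z c le)).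
apply: le_Rint; [exact: L1_mk|exact: L1D (L1_mk t00) (L1Z c le)|move=> u].
rewrite -lerBlDl -mulrBl /mk -mulrBl /heaviside.
have [u0|u0] := lerP 0 u.
  by rewrite subrr mulr0 mul0r; exact: mulr_ge0 c0 (me0 _).
rewrite subr0 mulr1.
set y := - u; have y0 : 0 < y by rewrite oppr_gt0.
have -> : u = - y by rewrite /y opprK.
have -> : e (- y) = rho / 2 * expR (- (rho / 2) * y).
  by rewrite /e exponential_pdfE mulN1r opprK addr0// ltW.
have h1 : expR (t * - y) - expR (t0 * - y) <= (t0 - t) * y * expR (- t * y).
  have -> : t0 * - y = - t * y + - ((t0 - t) * y) by ring.
  have -> : t * - y = - t * y by ring.
  rewrite expRD -{1}[expR (- t * y)]mulr1 -mulrBr mulrC ler_wpM2r ?expR_ge0//.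
  by have := expR_ge1Dx (- ((t0 - t) * y)); lra.
have h2 : gd 1 (0 + y) <= expR 1 * expR (- y).
  rewrite gdE// !divr1 add0r -expRD.
  apply: (@le_trans _ _ (1 * expR (- y ^+ 2 / 2))).
    by rewrite ler_wpM2r ?expR_ge0// normal_peak1_le1.
  rewrite mul1r ler_expR; have := sqr_ge0 (y - 1); lra.
have ht : 0 <= (t0 - t) * y * expR (- t * y).
  by rewrite !mulr_ge0 ?expR_ge0 ?(ltW y0)// subr_ge0.
apply: (@le_trans _ _ ((t0 - t) * y * expR (- t * y) * (expR 1 * expR (- y)))).
  apply: (@le_trans _ _ ((t0 - t) * y * expR (- t * y) * gd 1 (0 + y))).
    by rewrite ler_wpM2r ?gd_ge0.
  by rewrite ler_wpM2l.
have -> : (t0 - t) * y * expR (- t * y) * (expR 1 * expR (- y)) =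
   expR 1 * (t0 - t) * (y * expR (- rho * y)).
  have -> : expR (- rho * y) = expR (- t * y) * expR (- y).
    by rewrite -expRD; congr expR; rewrite /rho; ring.
  by ring.
have -> : c * (rho / 2 * expR (- (rho / 2) * y)) =
   expR 1 * (t0 - t) * (2 / rho * expR (- (rho / 2) * y)).
  by rewrite /c; field; rewrite gt_eqF.
rewrite ler_wpM2l ?mulr_ge0 ?expR_ge0 ?subr_ge0//.
have -> : - rho * y = - (rho / 2) * y + - (rho / 2 * y) by field.
rewrite expRD mulrCA mulrC ler_wpM2r ?expR_ge0//.
rewrite expRN ler_pdivrMr ?expR_gt0//.
have := expR_ge1Dx (rho / 2 * y); set E := expR _ => hE.
have -> : y = 2 / rho * (rho / 2 * y) by field; rewrite gt_eqF.
by rewrite ler_wpM2l ?divr_ge0 ?(ltW rho0)//; lra.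
Qed.

Lemma mills_Phi t : 1 - Phi t = expR (- t ^+ 2 / 2) * mills t.
Proof. by rewrite /mills mulrA -expRD mulNr addNr expR0 mul1r. Qed.

End mills_ratio.

Lemma expRN_le_ratio (R : realType) (D r : R) : 0 < D <= 1 -> 0 < r ->
  expR (- (D / r ^+ 2)) <= r / D.
Proof.
move=> /andP[D0 D1] r0; have r2 : 0 < r ^+ 2 by rewrite exprn_gt0.
have y0 : 0 < D / r ^+ 2 by rewrite divr_gt0.
rewrite expRN; apply: (@le_trans _ _ (1 + D / r ^+ 2)^-1).
  rewrite lef_pV2 ?posrE ?expR_gt0 ?addr_gt0//; exact: expR_ge1Dx.
have -> : r / D = (D / r)^-1 by rewrite invf_div.
rewrite lef_pV2 ?posrE ?divr_gt0 ?addr_gt0//.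
have -> : 1 + D / r ^+ 2 = (r ^+ 2 + D) / r ^+ 2 by field; rewrite gt_eqF.
have -> : D / r = D * r / r ^+ 2 by field; rewrite gt_eqF.
rewrite ler_wpM2r ?invr_ge0 ?(ltW r2)//.
have := sqr_ge0 (r - 1); have := mulr_ge0 (ltW r0) (ltW r0).
have : 0 <= (1 - D) * r by rewrite mulr_ge0 ?subr_ge0// ltW.
rewrite expr2; move: D0; nra.
Qed.

(** * The choice of the tilt *)

Section saddle_point.
Context (R : realType).
Variables (delta x r : R).
Hypothesis delta01 : 0 < delta <= 1.
Hypothesis x0 : 0 <= x.
Hypothesis r0 : 0 < r.

Let kap := 1 + delta.
Let w := Num.sqrt (1 + 2 * kap * (x * r)).
Let xt := 2 * x / (1 + w).
Let l := xt / w.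
Let q := l * r.

Let d0 : 0 < delta. Proof. by case/andP: delta01. Qed.
Let d1 : delta <= 1. Proof. by case/andP: delta01. Qed.
Let k0 : 0 < kap. Proof. by rewrite /kap; move: d0; lra. Qed.

Let y0 : 0 <= 2 * kap * (x * r).
Proof. by apply: mulr_ge0; apply: mulr_ge0 => //; exact: ltW. Qed.

Let w2 : w ^+ 2 = 1 + 2 * kap * (x * r).
Proof. by rewrite sqr_sqrtr// addr_ge0. Qed.

Let w1 : 1 <= w. Proof. by rewrite -[leLHS]sqrtr1 ler_wsqrtr// lerDl. Qed.
Let w0 : 0 < w. Proof. exact: lt_le_trans w1. Qed.
Let ww0 : 0 < 1 + w. Proof. by rewrite addr_gt0. Qed.

Let xt0 : 0 <= xt. Proof. by rewrite divr_ge0 ?mulr_ge0// ltW. Qed.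
Let xE : x = xt * (1 + w) / 2.
Proof. by rewrite /xt; field; rewrite gt_eqF. Qed.

Let krxt : kap * r * xt = w - 1.
Proof.
have -> : kap * r * xt = (w ^+ 2 - 1) / (1 + w).
  by rewrite w2 /xt; field; rewrite gt_eqF.
by field; rewrite gt_eqF.
Qed.

Lemma saddle_ge0 : 0 <= l. Proof. by rewrite divr_ge0// ltW. Qed.
Let q0 : 0 <= q. Proof. by rewrite mulr_ge0 ?saddle_ge0// ltW. Qed.

Let kq : kap * q = 1 - w^-1.
Proof.
have -> : kap * q = (kap * r * xt) / w by rewrite /q /l; ring.
by rewrite krxt; field; rewrite gt_eqF.
Qed.

Let wkq : w = 1 + kap * q * w.
Proof. by rewrite kq; field; rewrite gt_eqF. Qed.

Let q_le_kq : q <= kap * q.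
Proof. by rewrite ler_peMl// /kap lerDl ltW. Qed.

Lemma saddle_lt1 : q < 1.
Proof.
apply: (le_lt_trans q_le_kq); rewrite kq.
by rewrite gtrBl invr_gt0.
Qed.

(** The definition of [w] amounts to [1 - kap * q = 1 / w]. Hence [(w - delta * q) * (1 - q)] equals
    1 plus nonnegative terms, so [1 / (1 - q)] may be replaced by [w - delta * q]; the part in [w]
    yields exactly [- xt ^ 2 / 2]. *)
Lemma saddle_exponent :
  l ^+ 2 / (2 * (1 - q)) - l * x <= - xt ^+ 2 / 2 - delta * l ^+ 2 * q / 2.
Proof.
have q1 : 0 < 1 - q by rewrite subr_gt0 saddle_lt1.
have -> : - xt ^+ 2 / 2 = l ^+ 2 * w / 2 - l * x.
  by rewrite xE /l; field; rewrite gt_eqF.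
suff : l ^+ 2 / (2 * (1 - q)) <= l ^+ 2 / 2 * (w - delta * q) by lra.
have -> : l ^+ 2 / (2 * (1 - q)) = l ^+ 2 / 2 * (1 - q)^-1.
  by rewrite invfM mulrA.
rewrite ler_wpM2l ?divr_ge0 ?sqr_ge0//.
rewrite -[leLHS]mul1r ler_pdivrMr//.
have -> : (w - delta * q) * (1 - q) =
    (w - kap * q * w) + (delta * q * (w - 1) + delta * q ^+ 2) by rewrite /kap; ring.
rewrite {1}wkq addrK lerDl; apply: addr_ge0; apply: mulr_ge0.
- exact: mulr_ge0 (ltW d0) q0.
- by rewrite subr_ge0.
- exact: ltW.
- exact: sqr_ge0.
Qed.

Lemma saddle_le : l <= x.
Proof.
rewrite xE /l ler_pdivrMr//.
have h : 0 <= xt * (w - 1) by rewrite mulr_ge0// subr_ge0.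
have h2 : 0 <= xt * (w - 1) * w by rewrite mulr_ge0// ltW.
have h3 : 0 <= xt * (w - 1) * (w + 2) by rewrite mulr_ge0// addr_ge0// ltW.
lra.
Qed.

Lemma saddle_ge : xt * (1 - 2 * q) <= l.
Proof.
rewrite /l ler_wpM2l//.
have -> : w^-1 = 1 - kap * q by rewrite kq; lra.
by rewrite lerD2l lerN2 ler_wpM2r// /kap; move: d1; lra.
Qed.

Lemma saddle_ratio_le : q <= xt * r.
Proof. by rewrite /q ler_wpM2r ?(ltW r0)// ler_pdivrMr// ler_peMr. Qed.

End saddle_point.

(** * Assembling the two regimes *)

Section large_deviations.
Context (R : realType).
Variable delta : R.
Hypothesis delta01 : 0 < delta <= 1.

(** The value of [delta / 2 * q ^ 3] at the threshold [q = 1 / 100]. *)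
Let D : R := delta / 2 / 10 ^+ 6.
(** First the cost of moving the Mills ratio from [t] to [xt], then the Berry-Esseen error, with 208
    instead of 104 since [sigma <= 2 * s]. *)
Let tiltC : R := 132 * (4 * expR 1) + 2 * (196 * bergstromC R * 208).

Definition large_deviationC : R :=
  (D * mills_lower R)^-1 + tiltC / mills_lower R.

Let D0 : 0 < D. Proof. by case/andP: delta01 => ? _; rewrite !divr_gt0 ?exprn_gt0. Qed.
Let D1 : D <= 1. Proof. by case/andP: delta01 => ? ?; rewrite /D; lra. Qed.
Let tiltC0 : 0 <= tiltC.
Proof.
have b0 : 0 <= bergstromC R := le_trans ler01 (bergstromC_ge1 R).
apply: addr_ge0; first by apply: mulr_ge0 => //; apply: mulr_ge0 => //; exact: expR_ge0.
by apply: mulr_ge0 => //; apply: mulr_ge0 => //; exact: mulr_ge0.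
Qed.

Section fixed_sum.
Context d (T : measurableType d) (P : probability T R).
Variables (n : nat) (X : nat -> T -> R) (eps sigma : R) (v : nat -> R) (x : R).
Hypothesis B : forall k, bernstein P (X k) eps (v k).
Hypothesis indX : forall A : nat -> set R, (forall k, measurable (A k)) ->
  P (\bigcap_(i in `I_n) (X i @^-1` A i)) = (\prod_(i < n) P (X i @^-1` A i))%E.
Hypothesis sg0 : 0 < sigma.
Hypothesis sgE : sigma ^+ 2 = \sum_(i < n) v i.
Hypothesis x0 : 0 <= x.

Let r := eps / sigma.
Let xt := 2 * x / (1 + Num.sqrt (1 + 2 * (1 + delta) * (x * r))).
Let l := xt / Num.sqrt (1 + 2 * (1 + delta) * (x * r)).
Let q := l * r.
Let lam := l / sigma.

Let e0 : 0 < eps := bst_eps (B 0).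
Let r0 : 0 < r. Proof. exact: divr_gt0. Qed.
Let xt0 : 0 <= xt.
Proof. by rewrite divr_ge0 ?mulr_ge0// addr_ge0// sqrtr_ge0. Qed.
Let l0 : 0 <= l := saddle_ge0 delta01 x0 r0.
Let lam0 : 0 <= lam. Proof. by rewrite divr_ge0// ltW. Qed.
Let q0 : 0 <= q. Proof. by apply: mulr_ge0 => //; exact: ltW. Qed.
Let qE : lam * eps = q. Proof. by rewrite /lam /q /r mulrAC mulrA. Qed.
Let q1 : lam * eps < 1. Proof. by rewrite qE; exact: saddle_lt1. Qed.
Let lamsg : lam * sigma = l. Proof. by rewrite /lam divfK// gt_eqF. Qed.

Let m1 : 0 < mills_lower R := mills_lower_gt0 R.
Let Pxt0 : 0 <= 1 - Phi xt.
Proof.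
have := Nd01 xt (@ltr01 R); rewrite NdE// divr1 => /andP[_].
by rewrite subr_ge0.
Qed.

Let base : prod_mgf P X lam n * expR (- lam * (x * sigma)) <=
  expR (- xt ^+ 2 / 2 - delta * l ^+ 2 * q / 2).
Proof.
apply: (@le_trans _ _ (expR (l ^+ 2 / (2 * (1 - q))) * expR (- (l * x)))).
  have -> : - lam * (x * sigma) = - (l * x) by rewrite -lamsg; ring.
  rewrite ler_wpM2r ?expR_ge0// -lamsg exprMn sgE mulr_sumr mulr_suml.
  rewrite expR_sum /prod_mgf; apply: ler_prod => i _; apply/andP; split.
    by rewrite (le_trans ler01)//; exact: mgf_ge1 (B i) lam0 q1.
  by have := mgf_le (B i) lam0 q1; rewrite qE.
by rewrite -expRD ler_expR; exact: saddle_exponent.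
Qed.

(* The slack given by [delta] beats the factor [r] away from the origin. *)
Let far : 100^-1 <= q ->
  prod_mgf P X lam n * expR (- lam * (x * sigma)) <= expR (- xt ^+ 2 / 2) * (r / D).
Proof.
move=> q100; apply: (le_trans base); rewrite expRD ler_wpM2l ?expR_ge0//.
have DD : 0 < D <= 1 by rewrite D0 D1.
apply: le_trans (expRN_le_ratio DD r0); rewrite ler_expR lerN2.
have -> : delta * l ^+ 2 * q / 2 = delta / 2 * q ^+ 3 / r ^+ 2.
  by rewrite /q; field; rewrite gt_eqF.
rewrite ler_wpM2r ?invr_ge0 ?sqr_ge0// /D.
have d2 : 0 <= delta / 2 by case/andP: delta01 => ? _; rewrite divr_ge0// ltW.
apply: ler_wpM2l => //.
have -> : (10 ^+ 6)^-1 = 100^-1 ^+ 3 :> R by rewrite exprVn; congr (_^-1); ring.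
by rewrite lerXn2r ?nnegrE// invr_ge0.
Qed.

Let near : q < 100^-1 -> exists2 t, mills t <= mills xt + 132 * (4 * expR 1) * r &
  (P [set t | (x * sigma < psum X n t)%R] <=
   (expR (- xt ^+ 2 / 2) * (mills t + 2 * (196 * bergstromC R * 208 * r)))%:E)%E.
Proof.
move=> q100.
have q64 : lam * eps <= 64^-1 by rewrite qE; move: q100; lra.
have n0 : (0 < n)%N.
  rewrite lt0n; apply/eqP => nE; move: sgE; rewrite nE big_ord0 => /eqP.
  by rewrite sqrf_eq0 gt_eqF.
have vg : sigma ^+ 2 * (1 - 19 * q) <= sum_var P n X lam.
  rewrite sgE mulr_suml; apply: ler_sum => i _; rewrite -qE.
  exact: tilted_var_ge (B i) lam0 q64.
have q19 : 0 < 1 - 19 * q by move: q100; lra.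
have sv : 0 < sum_var P n X lam.
  by apply: lt_le_trans vg; rewrite mulr_gt0// exprn_gt0.
set s := Num.sqrt (sum_var P n X lam).
have s0 : 0 < s by rewrite sqrtr_gt0.
(* A square root of a number in [[0, 1]] is at least that number, so the bound on the variance
   passes to the deviation unchanged. *)
have sg : sigma * (1 - 19 * q) <= s.
  rewrite -(ler_pXn2r (n := 2)) ?nnegrE ?(ltW s0) ?mulr_ge0 ?(ltW sg0) ?(ltW q19)//.
  rewrite sqr_sqrtr ?(ltW sv)//; apply: le_trans vg.
  rewrite exprMn ler_wpM2l ?sqr_ge0// expr2 ler_piMr ?(ltW q19)//.
  by move: q0; lra.
have s2 : sigma <= 2 * s.
  have : 0 <= sigma * (100^-1 - q) by rewrite mulr_ge0 ?(ltW sg0)// subr_ge0 ltW.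
  by move: sg sg0; lra.
have ml : sum_mean P X lam n <= lam * sigma ^+ 2 * (1 + 6 * q).
  rewrite sgE -mulrA mulr_suml mulr_sumr; apply: ler_sum => i _; rewrite -qE mulrA.
  exact: tilted_mean_le (B i) lam0 q64.
pose t := (x * sigma - sum_mean P X lam n) / s + lam * s.
have lq0 : 0 <= l * q by rewrite mulr_ge0.
(* The mean may exceed [sigma * l] by a relative [6 * q], which division by [s] at most doubles; the
   deviation [s] costs 19 more. The step from [l] to [xt] adds 2, hence the 33 below. *)
have t1 : l * (1 - 31 * q) <= t.
  have h1 : - (12 * (l * q)) <= (x * sigma - sum_mean P X lam n) / s.
    rewrite ler_pdivlMr//.
    have : lam * sigma ^+ 2 * (1 + 6 * q) = sigma * (l + 6 * (l * q)) by rewrite -lamsg; ring.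
    have lx : 0 <= sigma * (x - l).
      by rewrite mulr_ge0 ?(ltW sg0)// subr_ge0; exact: saddle_le.
    have := ler_wpM2l lq0 s2; move: ml; lra.
  have h2 : l * (1 - 19 * q) <= lam * s.
    have -> : l * (1 - 19 * q) = lam * (sigma * (1 - 19 * q)) by rewrite -lamsg mulrA.
    by rewrite ler_wpM2l.
  by rewrite /t; lra.
have lxt : xt * (1 - 2 * q) <= l := saddle_ge delta01 x0 r0.
have q31 : 0 <= 1 - 31 * q by move: q100; lra.
have t2 : xt * (1 - 33 * q) <= t.
  have := ler_wpM2r q31 lxt.
  have : 0 <= xt * q ^+ 2 by rewrite mulr_ge0// sqr_ge0.
  by move: t1; lra.
have t_half : xt / 2 <= t.
  have : 0 <= xt * (100^-1 - q) by rewrite mulr_ge0// subr_ge0 ltW.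
  by move: t2 xt0; lra.
have t0 : 0 <= t by apply: le_trans t_half; rewrite divr_ge0.
have e10 : 0 <= 4 * expR 1 :> R by apply: mulr_ge0 => //; exact: expR_ge0.
exists t.
  (* Past [xt] the ratio only decreases. Otherwise [xt - t <= 33 * q * xt <= 33 * r * xt ^ 2], and
     [xt <= 2 * (1 + t)] turns 33 into 132. *)
  have [tx|xt_le] := lerP t xt; last first.
    apply: (le_trans (mills_le xt0 (ltW xt_le))); rewrite lerDl.
    by apply: mulr_ge0 (ltW r0); exact: mulr_ge0.
  apply: (le_trans (mills_increment t0 tx)); rewrite lerD2l.
  have t10 : 0 < 1 + t by rewrite ltr_wpDr.
  rewrite ler_pdivrMr ?exprn_gt0//.
  have -> : 132 * (4 * expR 1) * r * (1 + t) ^+ 2 =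
     4 * expR 1 * (132 * r * (1 + t) ^+ 2) by ring.
  rewrite ler_wpM2l//.
  have h1 : xt - t <= 33 * (xt * r) * xt.
    have := ler_wpM2r xt0 (saddle_ratio_le delta01 x0 r0); rewrite -/xt -/l -/q.
    by move: t2; lra.
  apply: (le_trans h1).
  have : xt ^+ 2 <= 4 * (1 + t) ^+ 2.
    have -> : 4 * (1 + t) ^+ 2 = (2 * (1 + t)) ^+ 2 by ring.
    rewrite lerXn2r ?nnegrE ?mulr_ge0 ?(ltW t10)//; move: t_half; lra.
  by move=> /(ler_wpM2l (ltW r0)); lra.
apply: (le_trans (tail_bound B indX lam0 q1 q64 (x * sigma) n0 sv)).
rewrite lee_fin -/s -/t.
have mt0 : 0 <= mills t.
  have := mills_ge t0 => h; have : 0 < mills t * (1 + t) by apply: lt_le_trans h.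
  by rewrite pmulr_lgt0 ?ltr_wpDr// => /ltW.
have b0 : 0 <= 196 * bergstromC R :> R.
  by apply: mulr_ge0 => //; exact: le_trans ler01 (bergstromC_ge1 R).
have h : 196 * bergstromC R * (104 * eps) / s <= 196 * bergstromC R * 208 * r.
  rewrite -(mulrA (196 * bergstromC R) (104 * eps)).
  rewrite -(mulrA (196 * bergstromC R) 208); apply: ler_wpM2l => //.
  rewrite ler_pdivrMr// /r.
  have -> : 208 * (eps / sigma) * s = 104 * eps * (2 * s / sigma) by ring.
  rewrite ler_peMr//; first by rewrite mulr_ge0// ltW.
  by rewrite ler_pdivlMr// mul1r.
apply: ler_pM.
- apply: mulr_ge0; last exact: expR_ge0.
  by apply: prodr_ge0 => i _; rewrite (le_trans ler01)//; exact: mgf_ge1 (B i) lam0 q1.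
- rewrite addr_ge0// mulr_ge0// divr_ge0 ?(ltW s0)// mulr_ge0// mulr_ge0// ltW//.
- apply: (le_trans base); rewrite ler_expR gerBl.
  case/andP: delta01 => dl _.
  by rewrite divr_ge0// mulr_ge0// mulr_ge0 ?sqr_ge0// ltW.
- by rewrite lerD2l ler_wpM2l.
Qed.

(** Both regimes leave an excess of the form [c * r * expR (- xt ^ 2 / 2)]; [mills_ge] makes it
    relative to [1 - Phi xt] at the price of [(1 + xt) / mills_lower]. *)
Lemma large_deviation_sum :
  (P [set t | (x * sigma < psum X n t)%R] <=
   ((1 - Phi xt) * (1 + large_deviationC * (1 + xt) * r))%:E)%E.
Proof.
have xt1 : 0 < 1 + xt by rewrite ltr_wpDr.
have mx := mills_ge xt0.
have r1 : r <= r * (mills xt * (1 + xt) / mills_lower R).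
  by rewrite ler_peMr ?(ltW r0)// ler_pdivlMr// mul1r.
have E (c : R) : 0 <= c -> c * r * expR (- xt ^+ 2 / 2) <=
    (1 - Phi xt) * (c / mills_lower R * (1 + xt) * r).
  move=> c0; rewrite mills_Phi.
  have ex : 0 <= c * expR (- xt ^+ 2 / 2) by rewrite mulr_ge0// expR_ge0.
  by have := ler_wpM2l ex r1; lra.
have C1 : 0 <= D^-1 by rewrite invr_ge0 ltW.
have mono (c : R) : c <= large_deviationC ->
    (1 - Phi xt) * (c * (1 + xt) * r) <= (1 - Phi xt) * (large_deviationC * (1 + xt) * r).
  by move=> cC; rewrite ler_wpM2l// ler_wpM2r ?(ltW r0)// ler_wpM2r// ltW.
have c1 : D^-1 / mills_lower R <= large_deviationC.
  by rewrite /large_deviationC (invfM D) lerDl divr_ge0// ltW.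
have c2 : tiltC / mills_lower R <= large_deviationC.
  by rewrite /large_deviationC lerDr invr_ge0 mulr_ge0 ?ltW.
have [qf|qn] := lerP 100^-1 q.
  apply: (le_trans (chernoff_sum B indX lam0 q1 (x * sigma))).
  rewrite lee_fin; apply: (le_trans (far qf)).
  rewrite (mulrDr (1 - Phi xt)) mulr1.
  have := le_trans (E _ C1) (mono _ c1); move: Pxt0; lra.
have [t ht Ht] := near qn; apply: (le_trans Ht); rewrite lee_fin.
rewrite (mulrDr (1 - Phi xt)) mulr1.
have := le_trans (E _ tiltC0) (mono _ c2).
have := ler_wpM2l (expR_ge0 (- xt ^+ 2 / 2)) ht.
by rewrite -[X in _ <= X + _]/(1 - Phi xt) [X in _ <= X + _]mills_Phi /tiltC; lra.
Qed.

End fixed_sum.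
End large_deviations.

Lemma bernstein0 d (T : measurableType d) (R : realType) (P : probability T R)
  (eps : R) : 0 < eps -> bernstein P (fun=> 0) eps 0.
Proof.
move=> e0; split=> //.
- by rewrite integral0_eq.
- by rewrite integral0_eq// => t _; rewrite expr2 mulr0.
- move=> k k3; rewrite integral0_eq ?abse0 ?mulr0// => t _.
  by rewrite expr0n gtn_eqF//; apply: leq_trans k3.
Qed.

Theorem theorem1 (R : realType) (delta : R) :
  0 < delta <= 1 ->
  exists C : R,
  forall (n : nat) (d : measure_display) (T : measurableType d)
    (P : probability T R) (xi : 'I_n -> {RV P >-> R}) (eps sigma : R),
    independent_RVs xi ->
    (forall i, ('E_P[xi i] = 0)%E) ->
    0 < eps ->
    (forall i (k : nat), (3 <= k)%N ->
       (`| 'E_P[fun w => (xi i w ^+ k)%R] | <=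
        (k`!%:R / 2 * eps ^+ (k - 2))%:E * 'E_P[fun w => (xi i w ^+ 2)%R])%E) ->
    0 < sigma ->
    (sigma ^+ 2)%:E = (\sum_(i < n) 'E_P[fun w => (xi i w ^+ 2)%R])%E ->
    forall x : R, 0 <= x ->
    let xt := 2 * x / (1 + Num.sqrt (1 + 2 * (1 + delta) * x * eps / sigma)) in
    (P [set w | (x * sigma < \sum_(i < n) xi i w)%R] <=
     ((1 - Phi xt) * (1 + C * (1 + xt) * (eps / sigma)))%:E)%E.
Proof.
move=> delta01; exists (large_deviationC delta).
move=> n d T P xi eps sigma indxi mean0 e0 mom sg0 sgE x x0; cbv zeta.
pose V i : \bar R := 'E_P[fun w => (xi i w ^+ 2)%R]%E.
have V0 i : (0 <= V i)%E by apply: expectation_ge0 => w; exact: sqr_ge0.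
(* Finite second moments are not among the hypotheses; they follow from the finiteness of the sum
   [sigma ^ 2] of nonnegative terms. *)
have Vfin i : V i \is a fin_num.
  rewrite ge0_fin_numE//; apply: le_lt_trans (ltry (sigma ^+ 2)).
  rewrite sgE (bigD1 i)//= leeDl//; apply: sume_ge0 => j _; exact: V0.
(* The family is continued by zero beyond [n], to fit the indexing by natural numbers; [bernstein0]
   covers the added terms. *)
pose X k : T -> R := if insub k is Some i then xi i else fun=> 0.
pose v k : R := if insub k is Some i then fine (V i) else 0.
have XE (i : 'I_n) : X i = xi i by rewrite /X valK.
have B k : bernstein P (X k) eps (v k).
  rewrite /X /v; case: insubP => [i _ _|_]; last exact: bernstein0.
  split=> //.
  - by have := mean0 i; rewrite unlock.
  - by rewrite fineK// /V unlock.
  - by move=> k' k3; rewrite EFinM fineK//; have := mom i _ k3; rewrite /V unlock.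
have indX (A : nat -> set R) : (forall k, measurable (A k)) ->
    P (\bigcap_(i in `I_n) (X i @^-1` A i)) = (\prod_(i < n) P (X i @^-1` A i))%E.
  move=> mA; under eq_bigr do rewrite XE.
  rewrite -(indxi (fun i => A i))//; congr (P _); apply/seteqP; split=> t h i.
    by move=> _; rewrite -XE; exact: h (ltn_ord i).
  by move=> /= ilt; have := h (Ordinal ilt) I; rewrite /= -XE.
have sgv : sigma ^+ 2 = \sum_(i < n) v i.
  apply: EFin_inj; rewrite sgE -sumEFin; apply: eq_bigr => i _.
  by rewrite /v valK fineK.
have := large_deviation_sum delta01 B indX sg0 sgv x0.
have -> : 2 * (1 + delta) * (x * (eps / sigma)) = 2 * (1 + delta) * x * eps / sigma.
  by rewrite !mulrA.
suff -> : psum X n = fun w => \sum_(i < n) xi i w by [].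
by apply/funext => w; apply: eq_bigr => i _; rewrite XE.
Qed.
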